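(* Let $B\subset A$ be an inclusion of simple unital $C^*$-algebras with a conditional expectation of index-finite type, and let $n\ge1$. (i) For any nonzero $x\in B'\cap A_n$, $\ \mathcal S(x)\,\mathcal S(\mathcal F_n(x))\ge\dfrac{\kappa_{n-1}^2}{[A:B]_0}$. (ii) For any nonzero $w\in A'\cap A_{n+1}$, $\ \mathcal S(w)\,\mathcal S(\mathcal F_n^{-1}(w))\ge\dfrac{\kappa_{n-1}^2}{[A:B]_0}$.
   Context: Setting. $B\subset A$ is an inclusion of simple unital $C^*$-algebras (common unit) admitting a conditional expectation of index-finite type. A conditional expectation $E:A\to B$ is of index-finite type if it has a quasi-basis, i.e. a finite set $\{\lambda_1,\dots,\lambda_m\}\subset A$ with $x=\sum_i\lambda_iE(\lambda_i^*x)=\sum_iE(x\lambda_i)\lambda_i^*$ for all $x\in A$; its Watatani index is $\sum_i\lambda_i\lambda_i^*$ (a positive scalar here). $E_0:A\to B$ is the minimal conditional expectation (the unique one of smallest index), $[A:B]_0$ is its index, $\tau=[A:B]_0^{-1}$. Put $A_{-1}=B$, $A_0=A$; for $n\ge1$, $A_n$ is the $C^*$-basic construction of $A_{n-2}\subset A_{n-1}$ with respect to $E_{n-1}$, with Jones projection $e_n\in A_n$ (so $e_nxe_n=E_{n-1}(x)e_n$ for $x\in A_{n-1}$ and $A_n=\mathrm{span}\,A_{n-1}e_nA_{n-1}$), and $E_n:A_n\to A_{n-1}$ is the dual (minimal) conditional expectation, $E_n(xe_ny)=\tau xy$ for $x,y\in A_{n-1}$. For $C\subset D$, $C'\cap D=\{d\in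 D: dc=cd\ \forall c\in C\}$; the relative commutants $B'\cap A_n$ are finite-dimensional. $\mathrm{tr}$ is the faithful tracial state on $B'\cap A_n$ given by the restriction of $E_0\circ E_1\circ\cdots\circ E_n$; these are compatible for varying $n$ and are restricted to the subalgebras $A'\cap A_n$. Fourier transform. $v_n=e_ne_{n-1}\cdots e_1$. $E^{B'\cap A_n}_{A'\cap A_n}$ is the $\mathrm{tr}$-preserving conditional expectation; $E^{B'\cap A_n}_{A'\cap A_n}(x)=\tau\sum_i\lambda_ix\lambda_i^*$ for any quasi-basis $\{\lambda_i\}$ of $E_0$. $\mathcal F_n:B'\cap A_n\to A'\cap A_{n+1}$, $\mathcal F_n(x)=\tau^{-\frac{n+2}{2}}E^{B'\cap A_{n+1}}_{A'\cap A_{n+1}}(xv_{n+1})$, a bijection with inverse $\mathcal F_n^{-1}(w)=\tau^{-\frac{n+2}{2}}E_{n+1}(wv_{n+1}^* )$. Support. $\mathcal S(x)=\mathrm{tr}(R(x))$, where $R(x)$ is the range projection of $x$. Constants. $\kappa_n^+=\min\{\mathrm{tr}(p):p\text{ a nonzero projection in }B'\cap A_n\}$, $\kappa_n^-=\min\{\mathrm{tr}(q):q\text{ a nonzero projection in }A'\cap A_{n+1}\}$, $\kappa_n=\sqrt{\kappa_n^+\kappa_n^-}$. *)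

(* Defs.v *)
From HB Require Import structures.
From mathcomp Require Import all_boot all_order all_algebra.
From mathcomp Require Import all_classical all_reals exp.
From mathcomp.real_closed Require Export complex.

Set Implicit Arguments.
Unset Strict Implicit.
Unset Printing Implicit Defensive.

Import Order.TTheory GRing.Theory Num.Theory.
Local Open Scope classical_set_scope.
Local Open Scope complex_scope.
Local Open Scope ring_scope.

(* Unital C*-algebras over R[i].  The norm [cnorm] takes values in R and is a
   field of the structure, with completeness stated by Cauchy sequences,
   because MathComp-Analysis' normed modules cannot be joined with [algType]. *)
HB.mixin Record isCStarAlgebra (R : realType) M of GRing.Algebra R[i] M := {
  star : M -> M;
  starK : forall x : M, star (star x) = x;
  starD : forall x y : M, star (x + y) = star x + star y;
  starZ : forall (a : R[i]) (x : M), star (a *: x) = conjc a *: star x;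
  starM : forall x y : M, star (x * y) = star y * star x;
  cnorm : M -> R;
  cnorm0_eq0 : forall x : M, cnorm x = 0 -> x = 0;
  cnormD : forall x y : M, cnorm (x + y) <= cnorm x + cnorm y;
  cnormZ : forall (a : R[i]) (x : M), cnorm (a *: x) = complex.Re `|a| * cnorm x;
  cnormM : forall x y : M, cnorm (x * y) <= cnorm x * cnorm y;
  cnorm_star : forall x : M, cnorm (star x * x) = cnorm x ^+ 2;
  cnorm_complete : forall u : nat -> M,
    (forall eps : R, 0 < eps -> exists N : nat, forall m n : nat,
       (N <= m)%N -> (N <= n)%N -> cnorm (u m - u n) < eps) ->
    exists l : M, forall eps : R, 0 < eps -> exists N : nat, forall n : nat,
       (N <= n)%N -> cnorm (u n - l) < eps
}.

#[short(type="cstarAlgType")]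
HB.structure Definition CStarAlgebra (R : realType) :=
  {M of isCStarAlgebra R M & GRing.Algebra R[i] M}.

Section CStar.
Context {R : realType} {M : cstarAlgType R}.
Implicit Types (B C D J : set M) (E G : M -> M) (x y p q : M).

Definition norm_closed D :=
  forall x, (forall eps : R, 0 < eps -> exists2 y, D y & cnorm (x - y) < eps) ->
    D x.

Definition cstar_subalgebra D :=
  [/\ D 1,
      forall (a : R[i]) x y, D x -> D y -> D (a *: x + y),
      forall x y, D x -> D y -> D (x * y),
      forall x, D x -> D (star x)
    & norm_closed D].

Definition closed_ideal D J :=
  [/\ J `<=` D, J 0,
      forall x y, J x -> J y -> J (x - y),
      forall d x, D d -> J x -> J (d * x) /\ J (x * d)
    & norm_closed J].

Definition simple D := forall J, closed_ideal D J -> J = [set 0] \/ J = D.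

Definition commutant C D := [set d | D d /\ forall c, C c -> d * c = c * d].

Definition projection p := star p = p /\ p * p = p.

(* The last clause says that E maps positive elements to positive elements. *)
Definition cond_exp C D E :=
  [/\ forall x, D x -> C (E x),
      forall (a : R[i]) x y, D x -> D y -> E (a *: x + y) = a *: E x + E y,
      forall c, C c -> E c = c,
      forall c x c', C c -> D x -> C c' -> E (c * x * c') = c * E x * c'
    & forall x, D x -> exists2 z, C z & E (star x * x) = star z * z].

Definition quasi_basis D E (m : nat) (l : 'I_m -> M) :=
  (forall i, D (l i)) /\
  forall x, D x ->
    x = \sum_i l i * E (star (l i) * x) /\
    x = \sum_i E (x * l i) * star (l i).

(* E : D -> C is of index-finite type with Watatani index the scalar c. *)
Definition has_index C D E (c : R) :=
  cond_exp C D E /\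
  exists m (l : 'I_m -> M),
    quasi_basis D E l /\ \sum_i l i * star (l i) = c%:C%:A.

Definition minimal_cond_exp C D E (c : R) :=
  has_index C D E c /\ forall E' c', has_index C D E' c' -> c <= c'.

(* D1 is the C*-basic construction of C <= D with respect to E, with Jones
   projection e: D is a right Hilbert C-module for <x, y> = E (x^* y), and D1
   acts faithfully on it by adjointable operators, D by left multiplication and
   e as E, so that D1 is the span of D e D.  (The closure of this span is
   omitted: it is already closed when E is of index-finite type.) *)
Definition basic_construction C D E (D1 : set M) (e : M) :=
  [/\ D `<=` D1, projection e,
      exists pi : M -> M -> M,
        [/\ forall d x, D1 d -> D x -> D (pi d x),
            forall (a : R[i]) d d' x, D1 d -> D1 d' -> D x ->
              pi (a *: d + d') x = a *: pi d x + pi d' x,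
            forall d d' x, D1 d -> D1 d' -> D x -> pi (d * d') x = pi d (pi d' x),
            forall d x y, D1 d -> D x -> D y ->
              E (star (pi d x) * y) = E (star x * pi (star d) y)
          & [/\ forall d, D1 d -> (forall x, D x -> pi d x = 0) -> d = 0,
                forall d x, D d -> D x -> pi d x = d * x
              & forall x, D x -> pi e x = E x]]
    & D1 = [set d | exists m (x y : 'I_m -> M),
                    [/\ forall i, D (x i), forall i, D (y i)
                      & d = \sum_i x i * e * y i]]].

Definition is_range_proj D x p :=
  [/\ D p, projection p, p * x = x
    & forall q, D q -> projection q -> q * x = x -> q * p = p].

(* Range projection computed in a finite-dimensional C*-algebra D. *)
Definition range_proj D x := xget 0 [set p | is_range_proj D x p].

(* [level B A n] is A_{n-1}, with A_{-1} = B. *)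
Definition level B (A : nat -> set M) (n : nat) : set M :=
  if n is k.+1 then A k else B.

(* All A_n are C*-subalgebras, with the same unit, of an ambient C*-algebra M,
   for instance the inductive limit of the tower.  [e 0] is not used. *)
Definition jones_tower B (A : nat -> set M) (E : nat -> M -> M) (e : nat -> M)
    (ind : R) :=
  [/\ forall n, cstar_subalgebra (A n),
      forall n, basic_construction (level B A n) (A n) (E n) (A n.+1) (e n.+1),
      forall n, cond_exp (A n) (A n.+1) (E n.+1)
    & forall n x y, A n x -> A n y ->
        E n.+1 (x * e n.+1 * y) = (ind^-1)%:C *: (x * y)].

(* E_0 o E_1 o ... o E_n *)
Fixpoint comp_exp (E : nat -> M -> M) (n : nat) x : M :=
  if n is k.+1 then comp_exp E k (E k.+1 x) else E 0%N x.

(* On B' /\ A_n the composite has values in the scalars B' /\ B = R[i] 1. *)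
Definition tr (E : nat -> M -> M) (n : nat) x : R[i] :=
  xget 0 [set t : R[i] | comp_exp E n x = t%:A].

Definition tr_preserving_cond_exp B (A : nat -> set M) (E : nat -> M -> M)
    (n : nat) G :=
  cond_exp (commutant (A 0%N) (A n)) (commutant B (A n)) G /\
  forall x, commutant B (A n) x -> tr E n (G x) = tr E n x.

(* v_n = e_n e_{n-1} ... e_1 *)
Fixpoint jones_word (e : nat -> M) (n : nat) : M :=
  if n is k.+1 then e k.+1 * jones_word e k else 1.

(* G is meant to be the conditional expectation
   B' /\ A_{n+1} -> A' /\ A_{n+1} preserving the trace. *)
Definition fourier (e : nat -> M) (ind : R) G (n : nat) x : M :=
  (ind^-1 `^ (- ((n%:R + 2) / 2)))%:C *: G (x * jones_word e n.+1).

Definition inv_fourier (E : nat -> M -> M) (e : nat -> M) (ind : R) (n : nat)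
    (w : M) : M :=
  (ind^-1 `^ (- ((n%:R + 2) / 2)))%:C
    *: E n.+1 (w * star (jones_word e n.+1)).

(* S(x) for x in D, a finite-dimensional C*-subalgebra of B' /\ A_n *)
Definition support_size D (E : nat -> M -> M) (n : nat) x : R :=
  complex.Re (tr E n (range_proj D x)).

(* The smallest trace of a nonzero projection of D (D finite-dimensional,
   so that the infimum is attained). *)
Definition min_trace D (E : nat -> M -> M) (n : nat) : R :=
  inf [set complex.Re (tr E n p) | p in [set p | [/\ D p, projection p & p != 0]]].

Definition kappa_plus B (A : nat -> set M) (E : nat -> M -> M) (n : nat) : R :=
  min_trace (commutant B (A n)) E n.

Definition kappa_minus (A : nat -> set M) (E : nat -> M -> M) (n : nat) : R :=
  min_trace (commutant (A 0%N) (A n.+1)) E n.+1.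

Definition kappa B (A : nat -> set M) (E : nat -> M -> M) (n : nat) : R :=
  Num.sqrt (kappa_plus B A E n * kappa_minus A E n).

End CStar.

(* Main.v *)
(* Put y = F(x) and write P, Q for the traces of the range projections p of x and
   r of y, X for tr(x^* x).  If g is a spectral projection of y y^* with
   eigenvalue mu, then mu tr(g) = tr((p g)^* k x v y^* g) with k = tau^(-(n+2)/2),
   because the Fourier transform is an A'-bimodule expectation.  Cauchy-Schwarz
   bounds this by tr(g p g) = tr(g E(p) g) and by tr(g y v^* x^* x v y^* g), where
   v^* x^* x v is controlled by E_n(x^* x); the elements E(p) of A' /\ A_n and
   E_n(x^* x) of B' /\ A_(n-1) are dominated by P / kappa^- and X / kappa^+.
   This gives mu <= ind P X / kappa^2, so that X = tr(y y^* ) <= Q ind P X / kappa^2.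

   The tower properties behind this reduce to one consequence of minimality,
   sum_i l_i a l_i^* = ind E_0(a) for a in B' /\ A, obtained by perturbing E_0 to
   E_0(k . k): it forces tr to be a trace and yields the formula
   E(x) = tau sum_i l_i x l_i^*.  The relative commutants are finite-dimensional
   since the Pimsner-Popa inequality bounds the size of orthonormal families. *)

Require Import Defs.
From HB Require Import structures.
From mathcomp Require Import all_boot all_order all_algebra.
From mathcomp Require Import all_classical all_reals exp.
From mathcomp Require Import ring lra.

Set Implicit Arguments.
Unset Strict Implicit.
Unset Printing Implicit Defensive.

Import Order.TTheory GRing.Theory Num.Theory.
Local Open Scope classical_set_scope.
Local Open Scope complex_scope.
Local Open Scope ring_scope.

(** * Normalization in noncommutative algebras *)

(** The factor [1 / ind] is what remains when the constants cancel: [k^2 = ind^(n+2)] meets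
    [ind^(-n)], from collapsing the Jones word onto [e 1], and [ind^(-1)], from the expectation of
    [e 1]. The index [n - 1] of kappa comes from a drop of one level on each side: averaging an
    element of A_n over a quasi-basis of [E 0] stays inside A_n, and [E n] maps into A_(n-1).

    Minimality quantifies over all competing expectations and says nothing directly about the later
    ones. It is therefore converted once, at the bottom, into an identity between quasi-basis sums;
    simplicity likewise enters only through the trivial centers of B and A_0, and triviality is then
    carried up the tower.

    Only norm axioms for C*-algebras are available, so the order has to be built: positivity of
    [star z * z] comes from growth rates of powers, and spectral projections come from annihilating
    polynomials. Later, operator domination is recorded as an exact identity with a square [b * b],
    and Cauchy-Schwarz as a quadratic inequality in a real parameter [s]. *)

Section NCRing.
Context {K : comNzRingType} {A : algType K}.

Inductive nexp :=
| NAtom of nat | NZero | NOne | NAdd of nexp & nexp | NOpp of nexp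
| NMul of nexp & nexp | NScale of K & nexp.

Fixpoint neval (env : seq A) t : A :=
  match t with
  | NAtom i => nth 0 env i
  | NZero => 0
  | NOne => 1
  | NAdd t u => neval env t + neval env u
  | NOpp t => - neval env t
  | NMul t u => neval env t * neval env u
  | NScale c t => c *: neval env t
  end.

Definition nmono (env : seq A) (w : seq nat) : A :=
  foldr (fun i x => nth 0 env i * x) 1 w.

Definition npoly (env : seq A) (s : seq (K * seq nat)) : A :=
  foldr (fun m x => m.1 *: nmono env m.2 + x) 0 s.

(** Written by plain recursion so that [cbn] in the tactic [nc] decides equality of concrete
    words. *)
Fixpoint nword_eq (w u : seq nat) : bool :=
  match w, u with
  | [::], [::] => true
  | i :: w', j :: u' => if eqn i j then nword_eq w' u' else false
  | _, _ => false
  end.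

Lemma nword_eqP w u : nword_eq w u -> w = u.
Proof.
elim: w u => [|i w IHw] [|j u] //=.
by case: eqnP => // -> /IHw ->.
Qed.

Fixpoint ninsert (c : K) (w : seq nat) (s : seq (K * seq nat)) :=
  match s with
  | [::] => [:: (c, w)]
  | (d, u) :: s' =>
    if nword_eq w u then (c + d, u) :: s' else (d, u) :: ninsert c w s'
  end.

Definition nadd (s t : seq (K * seq nat)) :=
  foldr (fun m x => ninsert m.1 m.2 x) t s.

Definition nscale (c : K) (w : seq nat) (s : seq (K * seq nat)) :=
  map (fun m => (c * m.1, w ++ m.2)) s.

Definition nmul (s t : seq (K * seq nat)) :=
  foldr (fun m x => nadd (nscale m.1 m.2 t) x) [::] s.

Fixpoint nnorm t : seq (K * seq nat) :=
  match t with
  | NAtom i => [:: (1, [:: i])]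
  | NZero => [::]
  | NOne => [:: (1, [::])]
  | NAdd t u => nadd (nnorm t) (nnorm u)
  | NOpp t => nscale (-1) [::] (nnorm t)
  | NMul t u => nmul (nnorm t) (nnorm u)
  | NScale c t => nscale c [::] (nnorm t)
  end.

(** No [True] follows the last coefficient, so that [repeat split] leaves only scalar equations for
    [ring] or [field]. *)
Fixpoint nzero (s : seq (K * seq nat)) : Prop :=
  match s with
  | [::] => True
  | [:: m] => m.1 = 0
  | m :: s' => m.1 = 0 /\ nzero s'
  end.

Lemma nmono_cat env w u : nmono env (w ++ u) = nmono env w * nmono env u.
Proof. by elim: w => [|i w /= ->]; rewrite /= ?mul1r ?mulrA. Qed.

Lemma ninsertE env c w s :
  npoly env (ninsert c w s) = c *: nmono env w + npoly env s.
Proof.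
elim: s => [|[d u] s IHs] //=; case: ifP => [/nword_eqP ->|_] /=.
  by rewrite scalerDl addrA.
by rewrite IHs addrCA.
Qed.

Lemma naddE env s t : npoly env (nadd s t) = npoly env s + npoly env t.
Proof. by elim: s => [|m s /= IHs]; rewrite /= ?add0r // ninsertE IHs addrA. Qed.

Lemma nscaleE env c w s :
  npoly env (nscale c w s) = (c *: nmono env w) * npoly env s.
Proof.
elim: s => [|m s /= ->]; rewrite ?mulr0 // mulrDr nmono_cat; congr (_ + _).
by rewrite -scalerAl -scalerAr scalerA.
Qed.

Lemma nmulE env s t : npoly env (nmul s t) = npoly env s * npoly env t.
Proof.
elim: s => [|m s /= IHs]; first by rewrite mul0r.
by rewrite naddE nscaleE IHs mulrDl.
Qed.

Lemma nnormE env t : npoly env (nnorm t) = neval env t.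
Proof.
elim: t => [i|||t IHt u IHu|t IHt|t IHt u IHu|c t IHt] //=;
  rewrite ?scale1r ?mulr1 ?addr0 ?naddE ?nscaleE ?nmulE ?IHt ?IHu //=.
  by rewrite scaleN1r mulN1r.
by rewrite -scalerAl mul1r.
Qed.

Lemma nzeroE env s : nzero s -> npoly env s = 0.
Proof.
elim: s => [|m s IHs] //= H; case: s H IHs => [->|n s [-> Hs] ->] //=;
  by rewrite scale0r addr0.
Qed.

Lemma ncring_correct env t u : nzero (nnorm (NAdd t (NOpp u))) ->
  neval env t = neval env u.
Proof. by move/(nzeroE env); rewrite nnormE /= => /eqP; rewrite subr_eq0 => /eqP. Qed.
End NCRing.

Ltac nc_mem x l :=
  lazymatch l with
  | nil => constr:(false) | cons x _ => constr:(true)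
  | cons _ ?l' => nc_mem x l'
  end.
Ltac nc_atoms l e :=
  lazymatch e with
  | 0 => l | 1 => l
  | ?a + ?b => let l := nc_atoms l a in nc_atoms l b
  | - ?a => nc_atoms l a
  | ?a * ?b => let l := nc_atoms l a in nc_atoms l b
  | _ *: ?a => nc_atoms l a
  | _ => lazymatch nc_mem e l with
         | true => l | false => constr:(cons e l) end
  end.
Ltac nc_index x l :=
  lazymatch l with
  | cons x _ => constr:(O)
  | cons _ ?l' => let i := nc_index x l' in constr:(S i)
  end.
Ltac nc_quote K l e :=
  lazymatch e with
  | 0 => constr:(@NZero K) | 1 => constr:(@NOne K)
  | ?a + ?b => let a := nc_quote K l a in let b := nc_quote K l b in
               constr:(@NAdd K a b)
  | - ?a => let a := nc_quote K l a in constr:(@NOpp K a)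
  | ?a * ?b => let a := nc_quote K l a in let b := nc_quote K l b in
               constr:(@NMul K a b)
  | ?c *: ?a => let a := nc_quote K l a in constr:(@NScale K c a)
  | _ => let i := nc_index e l in constr:(@NAtom K i)
  end.
(* Reduces an identity in an associative algebra to identities between the
   coefficients of the words in its atoms. *)
Ltac nc K A :=
  match goal with |- ?x = ?y =>
    let T := type of x in
    let l := nc_atoms constr:(@nil T) x in
    let l := nc_atoms l y in
    let t := nc_quote K l x in
    let u := nc_quote K l y in
    change (@neval K A l t = @neval K A l u);
    apply: ncring_correct;
    cbn [nzero nnorm nadd nmul nscale ninsert nword_eq eqn foldr map cat fst snd]
  end.

Ltac ncr :=
  match goal with
  | M : CStarAlgebra.type ?R |- _ => nc (R[i]) M
  end.
Ltac ncring := ncr; repeat split; ring.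
Ltac ncfield := ncr; repeat split; field.

(** * Positivity in C*-algebras *)

Section Norm.
Context {R : realType} {M : cstarAlgType R}.
Implicit Types (x y z : M) (r s t : R).

Definition sa x := star x = x.

Lemma cnormZr r x : cnorm (r%:C *: x) = `|r| * cnorm x.
Proof. by rewrite cnormZ normc_def /= expr0n addr0 sqrtr_sqr. Qed.

Lemma cnorm0 : cnorm (0 : M) = 0.
Proof.
rewrite -(scale0r (0 : M)) -[0 in LHS](rmorph0 (real_complex R)).
by rewrite cnormZr normr0 mul0r.
Qed.

Lemma cnormN x : cnorm (- x) = cnorm x.
Proof.
by rewrite -scaleN1r -[-1](rmorphN1 (real_complex R)) cnormZr normrN1 mul1r.
Qed.

Lemma cnorm_ge0 x : 0 <= cnorm x.
Proof. by have := cnormD x (- x); rewrite subrr cnorm0 cnormN; lra. Qed.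

Lemma cnormB x y : cnorm (x - y) = cnorm (y - x).
Proof. by rewrite -cnormN opprB. Qed.

Lemma cnormB_le x y : cnorm (x - y) <= cnorm x + cnorm y.
Proof. by rewrite (le_trans (cnormD _ _))// cnormN. Qed.

Lemma cnormD3 x y z : cnorm (x - z) <= cnorm (x - y) + cnorm (y - z).
Proof. by rewrite -[x - z](subrKA y); apply: cnormD. Qed.

Lemma star_is_additive : zmod_morphism (star : M -> M).
Proof. by move=> x y; rewrite starD -scaleN1r starZ rmorphN1 scaleN1r. Qed.

HB.instance Definition _ :=
  GRing.isZmodMorphism.Build M M (star : M -> M) star_is_additive.

Lemma star0 : star (0 : M) = 0. Proof. exact: raddf0. Qed.
Lemma starN x : star (- x) = - star x. Proof. exact: raddfN. Qed.
Lemma starB x y : star (x - y) = star x - star y. Proof. exact: raddfB. Qed.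

Lemma starZr r x : star (r%:C *: x) = r%:C *: star x.
Proof. by rewrite starZ conjc_real. Qed.

Lemma star1 : star (1 : M) = 1.
Proof. by rewrite -[star 1]mul1r -{1}(starK 1) -starM mul1r starK. Qed.

Lemma star_sum m (F : 'I_m -> M) : star (\sum_i F i) = \sum_i star (F i).
Proof. exact: raddf_sum. Qed.

Lemma cnorm1 : cnorm (1 : M) = 1.
Proof.
have := cnorm_star (1 : M); rewrite star1 mulr1 expr2 => h.
have n0 : cnorm (1 : M) != 0 by apply/eqP => /cnorm0_eq0/eqP; rewrite oner_eq0.
by apply: (mulfI n0); rewrite -h mulr1.
Qed.

Lemma cnormA r : cnorm (r%:C%:A : M) = `|r|.
Proof. by rewrite cnormZr cnorm1 mulr1. Qed.

Lemma cnorm_starE x : cnorm (star x) = cnorm x.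
Proof.
have le y : cnorm y <= cnorm (star y).
  have [->|n0] := eqVneq y 0; first by rewrite star0.
  have yp : 0 < cnorm y.
    rewrite lt_def cnorm_ge0 andbT; apply: contra_neq n0; exact: cnorm0_eq0.
  rewrite -(ler_pM2r yp) -expr2 -cnorm_star; exact: cnormM.
by apply/eqP; rewrite eq_le le andbT -{2}(starK x) le.
Qed.

Lemma cnorm_sa_sq x : sa x -> cnorm (x * x) = cnorm x ^+ 2.
Proof. by move=> h; rewrite -cnorm_star h. Qed.

Lemma star_eq0 x : star x * x = 0 -> x = 0.
Proof.
move=> h; apply: cnorm0_eq0; have := cnorm_star x; rewrite h cnorm0.
by move/esym/eqP; rewrite sqrf_eq0 => /eqP.
Qed.

(** The form in which limits are taken below: [r] absorbs the constants of an estimate in [e]. *)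
Lemma cnorm_eps x r : (forall e, 0 < e -> cnorm x <= r * e) -> x = 0.
Proof.
move=> h; apply: cnorm0_eq0; apply/eqP; rewrite eq_le cnorm_ge0 andbT.
rewrite leNgt; apply/negP => xp.
have e0 : 0 < cnorm x / (`|r| + 1) / 2.
  by rewrite !divr_gt0//; have := normr_ge0 r; lra.
have := h _ e0; set q := cnorm x / (`|r| + 1).
have -> : cnorm x = q * (`|r| + 1) by rewrite /q; field; have := normr_ge0 r; lra.
have q0 : 0 < q by rewrite /q divr_gt0//; have := normr_ge0 r; lra.
have := ler_norm r; have := normr_ge0 r; nra.
Qed.

Lemma saD x y : sa x -> sa y -> sa (x + y).
Proof. by rewrite /sa starD => -> ->. Qed.
Lemma saZ r x : sa x -> sa (r%:C *: x).
Proof. by rewrite /sa starZr => ->. Qed.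
Lemma sa1 : sa (1 : M). Proof. exact: star1. Qed.
Lemma saA r : sa (r%:C%:A : M). Proof. by apply: saZ; exact: sa1. Qed.
Lemma saN x : sa x -> sa (- x). Proof. by rewrite /sa starN => ->. Qed.
Lemma saB x y : sa x -> sa y -> sa (x - y).
Proof. by move=> hx hy; apply: saD => //; exact: saN. Qed.
Lemma saM x y : sa x -> sa y -> x * y = y * x -> sa (x * y).
Proof. by rewrite /sa starM => -> -> ->. Qed.
Lemma sa_sq x : sa x -> sa (x * x).
Proof. by move=> h; apply: saM. Qed.
Lemma sa_starM x : sa (star x * x).
Proof. by rewrite /sa starM starK. Qed.
Lemma saX x n : sa x -> sa (x ^+ n).
Proof.
move=> h; elim: n => [|n IHn]; first by rewrite expr0; exact: sa1.
by rewrite exprS; apply: saM => //; exact: commrX.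
Qed.
End Norm.

(** * Square roots of elements close to 1 *)

Section SquareRoot.
Context {R : realType} {M : cstarAlgType R}.
Implicit Types (x y z : M) (r s t : R).

Lemma bernoulli (q : R) n : 0 <= q -> 1 + n%:R * q <= (1 + q) ^+ n.
Proof.
move=> q0; elim: n => [|n IHn]; first by rewrite mul0r addr0 expr0.
have h1 : 0 <= n%:R * q * q by rewrite !mulr_ge0 ?ler0n.
have h2 : 0 <= q * ((1 + q) ^+ n - (1 + n%:R * q)).
  by apply: mulr_ge0 => //; rewrite subr_ge0.
rewrite exprS -natr1; move: ((1 + q) ^+ n) (n%:R : R) h1 h2 IHn => X m.
lra.
Qed.

Lemma geometric_lt (r e : R) : 0 <= r < 1 -> 0 < e -> exists N, r ^+ N < e.
Proof.
move=> /andP[r0 r1] e0.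
have [->|rn0] := eqVneq r 0; first by exists 1%N; rewrite expr1.
have rp : 0 < r by rewrite lt_def rn0.
have [q q0 rE] : exists2 q, 0 < q & r^-1 = 1 + q.
  by exists (r^-1 - 1); rewrite ?subr_gt0 ?invf_gt1// addrC subrK.
have q0' := ltW q0.
have q1 : 0 < 1 + q by lra.
exists (Num.bound (e^-1 / q)).
rewrite -[r]invrK rE exprVn -[X in _ < X]invrK ltf_pV2 ?posrE ?invr_gt0 ?exprn_gt0//.
apply: lt_le_trans (bernoulli _ q0').
have : e^-1 / q < (Num.bound (e^-1 / q))%:R.
  by apply: archi_boundP; rewrite divr_ge0// ltW// invr_gt0.
rewrite ltr_pdivrMr// => h; lra.
Qed.

(* [d] is the fixed point of [d |-> (w + d * d) / 2]. *)
Lemma sqrt_near1 (w : M) (r : R) : sa w -> 0 <= r < 1 ->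
    cnorm w <= r ->
  exists d, [/\ sa d, cnorm d <= r, (1 - d) * (1 - d) = 1 - w,
    forall y, w * y = y * w -> d * y = y * d
    & forall D, cstar_subalgebra D -> D w -> D d].
Proof.
move=> saw /andP[r0 r1] wr.
pose f d : M := (2^-1)%:C *: (w + d * d).
pose u n := iter n f 0.
have uS n : u n.+1 = f (u n) by [].
have ur n : cnorm (u n) <= r.
  elim: n => [|n IHn]; first by rewrite cnorm0.
  rewrite uS cnormZr ger0_norm ?invr_ge0//.
  have := cnormD w (u n * u n); have := cnormM (u n) (u n).
  have := cnorm_ge0 (u n); nra.
(* The identity [x * x - y * y = x * (x - y) + (x - y) * y] makes [f] a contraction of ratio [r] on
   the ball of radius [r]. *)
have contr x y : cnorm x <= r -> cnorm y <= r ->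
    cnorm (f x - f y) <= r * cnorm (x - y).
  move=> xr yr.
  have -> : f x - f y = (2^-1)%:C *: (x * (x - y) + (x - y) * y).
    by rewrite /f; ncring.
  rewrite cnormZr ger0_norm ?invr_ge0//.
  have := cnormD (x * (x - y)) ((x - y) * y).
  have := cnormM x (x - y); have := cnormM (x - y) y.
  have := cnorm_ge0 (x - y); nra.
have cauchy n j : cnorm (u (n + j)%N - u n) <= r ^+ n.
  elim: n => [|n IHn].
    by rewrite add0n subr0 expr0; exact: le_trans (ur j) (ltW r1).
  rewrite addSn !uS exprS; apply: le_trans (contr _ _ (ur _) (ur _)) _.
  exact: ler_wpM2l.
have [d dP] : exists l, forall eps : R, 0 < eps -> exists N : nat, forall n,
    (N <= n)%N -> cnorm (u n - l) < eps.
  apply: cnorm_complete => e e0.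
  have e2 : 0 < e / 2 by lra.
  have r01 : 0 <= r < 1 by rewrite r0.
  have [N hN] := geometric_lt r01 e2.
  exists N => m n Nm Nn.
  have -> : u m - u n = (u m - u N) - (u n - u N) by rewrite opprB subrKA.
  apply: le_lt_trans (cnormB_le _ _) _.
  have := cauchy N (m - N)%N; have := cauchy N (n - N)%N; rewrite !subnKC//; lra.
have near e : 0 < e -> exists n, cnorm (u n - d) < e /\ cnorm (u n.+1 - d) < e.
  by move=> e0; have [N hN] := dP e e0; exists N; split; apply: hN.
have comu y : w * y = y * w -> forall n, u n * y = y * u n.
  move=> wy; elim=> [|n IHn]; first by rewrite mul0r mulr0.
  rewrite uS /f -scalerAl -scalerAr mulrDl mulrDr wy -mulrA IHn mulrA IHn.
  by rewrite mulrA.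
have sau n : sa (u n).
  elim: n => [|n IHn]; first exact: star0.
  by rewrite uS; apply: saZ; apply: saD => //; exact: sa_sq.
have dr : cnorm d <= r.
  apply/ler_addgt0Pr => e e0; have [n [hn _]] := near e e0.
  have := cnormD (u n) (d - u n); rewrite addrC subrK cnormB.
  have := ur n; lra.
have dfix : d = f d.
  apply/eqP; rewrite -subr_eq0; apply/eqP; apply: (@cnorm_eps _ _ _ 2) => e e0.
  have [n [h1 h2]] := near e e0.
  have := cnormD3 d (u n.+1) (f d); rewrite (cnormB d (u n.+1)).
  have := contr _ _ (ur n) dr; rewrite -uS.
  have := ler_wpM2r (cnorm_ge0 (u n - d)) (ltW r1); lra.
exists d; split => //.
- apply/eqP; rewrite -subr_eq0; apply/eqP; apply: (@cnorm_eps _ _ _ 2) => e e0.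
  have [n [h _]] := near e e0.
  have := cnormD3 (star d) (u n) d; rewrite -[in star d - u n](sau n) -starB.
  rewrite cnorm_starE (cnormB d (u n)); lra.
- have {1}-> : (1 - d) * (1 - d) = 1 - d - d + d * d by ncring.
  by rewrite [X in 1 - X - _]dfix [X in _ - X + _]dfix /f; ncfield.
- move=> y wy; apply/eqP; rewrite -subr_eq0; apply/eqP.
  apply: (@cnorm_eps _ _ _ (2 * cnorm y)) => e e0.
  have [n [h _]] := near e e0.
  have -> : d * y - y * d = y * (u n - d) - (u n - d) * y.
    by rewrite mulrBl mulrBr (comu y wy); ncring.
  have := cnormB_le (y * (u n - d)) ((u n - d) * y).
  have := cnormM y (u n - d); have := cnormM (u n - d) y.
  have := cnorm_ge0 y; nra.
- move=> D [D1 DZ DM _ Dc] Dw; apply: Dc => e e0; have [n [h _]] := near e e0.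
  exists (u n); last by rewrite cnormB.
  have D0 : D 0 by have := DZ (-1) _ _ D1 D1; rewrite scaleN1r addNr.
  elim: n {h} => [|n IHn] //; rewrite uS /f -[X in D X]addr0.
  by apply: (DZ) => //; rewrite -[w]scale1r; apply: (DZ) => //; exact: DM.
Qed.

End SquareRoot.

(** * The positive cone, without spectra *)

Section Positive.
Context {R : realType} {M : cstarAlgType R}.
Implicit Types (x y z a c g w : M) (r s t e : R).

(** For self-adjoint [x] the norm condition says that the spectrum lies in [[0, 2 t]]. In this form
    sums and nonnegative multiples are immediate. *)
Definition pos x := sa x /\ exists t, cnorm (t%:C%:A - x) <= t.

Lemma pos_sa x : pos x -> sa x. Proof. by case. Qed.

Lemma posD x y : pos x -> pos y -> pos (x + y).
Proof.
move=> [sx [t tx]] [sy [s sy']]; split; first exact: saD.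
exists (t + s).
have -> : (t + s)%:C%:A - (x + y) = (t%:C%:A - x) + (s%:C%:A - y) by ncring.
by have := cnormD (t%:C%:A - x) (s%:C%:A - y); lra.
Qed.

Lemma posZ r x : 0 <= r -> pos x -> pos (r%:C *: x).
Proof.
move=> r0 [sx [t tx]]; split; first exact: saZ.
exists (r * t).
have -> : (r * t)%:C%:A - r%:C *: x = r%:C *: (t%:C%:A - x) by ncring.
by rewrite cnormZr ger0_norm// ler_wpM2l.
Qed.

Lemma posA r : 0 <= r -> pos (r%:C%:A : M).
Proof.
by move=> r0; split; [exact: saA|exists r; rewrite subrr cnorm0].
Qed.

Lemma posA_ge0 r : pos (r%:C%:A : M) -> 0 <= r.
Proof.
move=> [_ [t]]; rewrite -scalerBl -rmorphB cnormA => h.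
by have := ler_norm (t - r); lra.
Qed.

Lemma pos0 : pos (0 : M).
Proof. by rewrite -(scale0r 1) -(rmorph0 (real_complex R)); exact: posA. Qed.

Lemma pos_sum m (F : 'I_m -> M) : (forall i, pos (F i)) -> pos (\sum_i F i).
Proof. by move=> h; elim/big_ind: _ => //; [exact: pos0|exact: posD]. Qed.

Lemma conjc_i : conjc ('i%C : R[i]) = - 'i%C.
Proof. by apply/eqP; rewrite eq_complex /= oppr0 !eqxx. Qed.

(* [a + i c] is a multiple of a unitary. *)
Lemma sq_le_scalar a c s : 0 <= s -> sa a -> sa c -> a * c = c * a ->
  a * a + c * c = s%:C%:A -> cnorm (a * a) <= s.
Proof.
move=> s0 sa_a sa_c ac acs; rewrite cnorm_sa_sq//.
pose u := a + 'i%C *: c.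
have su : star u = a - 'i%C *: c.
  by rewrite /u starD starZ sa_a sa_c conjc_i scaleNr.
have ii : 'i%C * 'i%C = -1 :> R[i] by rewrite -expr2 sqr_i.
have un : cnorm u ^+ 2 = s.
  rewrite -cnorm_star su /u; set j : R[i] := 'i%C in ii *.
  have -> : (a - j *: c) * (a + j *: c) = a * a + c * c.
    rewrite mulrDr 2!mulrBl -!scalerAl -!scalerAr ac scalerA ii scaleN1r.
    by rewrite opprK addrA subrK.
  by rewrite acs cnormA ger0_norm.
have aE : a = (2^-1)%:C *: (u + star u) by rewrite su /u; ncfield.
have : cnorm a <= cnorm u.
  rewrite aE cnormZr ger0_norm ?invr_ge0//.
  have := cnormD u (star u); rewrite cnorm_starE; lra.
by rewrite -un; have := cnorm_ge0 a; nra.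
Qed.

(** After rescaling to norm at most 1/2, [1 - b * b] is itself a square [(1 - d) * (1 - d)].
    Commuting squares with sum 1 have norm at most 1, so [t = 1] witnesses positivity. *)
Lemma sq_pos a : sa a -> pos (a * a).
Proof.
move=> sa_a; have n0 := cnorm_ge0 a.
set k := 2 * (cnorm a + 1).
have k0 : 0 < k by rewrite /k; lra.
have k0' := ltW k0.
pose b := k^-1%:C *: a.
have sb : sa b by exact: saZ.
have nb : cnorm b <= 2^-1.
  by rewrite cnormZr ger0_norm ?invr_ge0// ler_pdivrMl// /k; lra.
have nbb : cnorm (b * b) <= 2^-1.
  by rewrite cnorm_sa_sq//; have := cnorm_ge0 b; nra.
have h01 : 0 <= (2^-1 : R) < 1 by lra.
have [d [sd _ dE dc _]] := sqrt_near1 (sa_sq sb) h01 nbb.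
have db : d * b = b * d by apply: dc; rewrite mulrA.
have : cnorm ((1 - d) * (1 - d)) <= 1.
  apply: (@sq_le_scalar _ b) => //.
  - by apply: saB => //; exact: sa1.
  - by rewrite mulrBl mulrBr db mul1r mulr1.
  - by rewrite dE subrK rmorph1 scale1r.
rewrite dE => h.
have -> : a * a = (k ^+ 2)%:C *: (b * b).
  rewrite /b -scalerAl -scalerAr !scalerA -!rmorphM/=.
  by rewrite (_ : k ^+ 2 * k^-1 * k^-1 = 1) ?rmorph1 ?scale1r//; field; lra.
apply: posZ; first exact: sqr_ge0.
by split; [exact: sa_sq|exists 1; rewrite rmorph1 scale1r].
Qed.

(** The shift by [e] brings the norm of [w] down to [t / (t + e) < 1], as the iteration requires;
    [pos_closed] later removes it. The last two clauses keep the root commuting with whatever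
    commutes with [x], and inside any C*-subalgebra containing [x]. *)
Lemma pos_sqrt x e : pos x -> 0 < e -> exists c, [/\ sa c, c * c = x + e%:C%:A,
    forall y, x * y = y * x -> c * y = y * c
    & forall D, cstar_subalgebra D -> D x -> D c].
Proof.
move=> [sx [t tx]] e0.
have t0 : 0 <= t by exact: le_trans (cnorm_ge0 _) tx.
have T0 : 0 < t + e by lra.
have T0' := ltW T0.
pose w := (t + e)^-1%:C *: (t%:C%:A - x).
have sw : sa w by apply: saZ; apply: saB => //; exact: saA.
have r01 : 0 <= t / (t + e) < 1.
  by rewrite divr_ge0//= ?ltW// ltr_pdivrMr// mul1r; lra.
have nw : cnorm w <= t / (t + e).
  by rewrite cnormZr ger0_norm ?invr_ge0// [leRHS]mulrC ler_wpM2l// invr_ge0.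
have [d [sd _ dE dc dD]] := sqrt_near1 sw r01 nw.
pose k := Num.sqrt (t + e).
have kk : k * k = t + e by rewrite -expr2 sqr_sqrtr// ltW.
exists (k%:C *: (1 - d)); split.
- by apply: saZ; apply: saB => //; exact: sa1.
- rewrite -scalerAl -scalerAr scalerA dE -rmorphM/= kk scalerBr /w scalerA.
  rewrite -rmorphM/= divff ?gt_eqF// rmorph1; ncring.
- move=> y xy; have dy : d * y = y * d.
    by apply: dc; rewrite /w -scalerAl -scalerAr mulrBl mulrBr xy -scalerAl
      -scalerAr mul1r mulr1.
  by rewrite -scalerAl -scalerAr mulrBl mulrBr dy mul1r mulr1.
- move=> D DD Dx; have [D1 DZ _ _ _] := DD.
  have D0 : D 0 by have := DZ (-1) _ _ D1 D1; rewrite scaleN1r addNr.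
  have Dw : D w.
    have -> : w = (- (t + e)^-1%:C) *: x + ((t + e)^-1 * t)%:C *: 1.
      by rewrite /w; ncring.
    by apply: (DZ) => //; rewrite -[X in D X]addr0; apply: (DZ).
  have -> : k%:C *: (1 - d) = (- k%:C) *: d + k%:C *: 1 by ncring.
  apply: (DZ); first exact: dD.
  by rewrite -[X in D X]addr0; apply: (DZ).
Qed.

(** Up to [e], both elements are squares of commuting self-adjoint elements [c] and [b], so
    [sq_le_scalar] applies. *)
Lemma pos_add_scalar x y s : pos x -> pos y -> x * y = y * x ->
  x + y = s%:C%:A -> cnorm x <= s.
Proof.
move=> px py xy xys.
have s0 : 0 <= s by apply: posA_ge0; rewrite -xys; exact: posD.
suff h e : 0 < e -> cnorm x <= s + 3 * e.
  apply/ler_addgt0Pr => e e0; have e3 : 0 < e / 3 by lra.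
  by have := h _ e3; lra.
move=> e0; have e0' := ltW e0.
have [c [sc cE cc _]] := pos_sqrt px e0; have [b [sb bE bc _]] := pos_sqrt py e0.
have cb : c * b = b * c by apply: cc; apply/esym/bc.
have h : cnorm (c * c) <= s + 2 * e.
  apply: (@sq_le_scalar _ b) => //; first lra.
  by rewrite cE bE addrACA xys; ncring.
have := cnormB_le (c * c) e%:C%:A; rewrite {1}cE addrK cnormA ger0_norm//.
lra.
Qed.

Lemma scalar_comm r x : r%:C%:A * x = x * r%:C%:A.
Proof. by rewrite -scalerAl -scalerAr mul1r mulr1. Qed.

(** Frees the existential in [pos]: every upper bound of the norm is a witness. *)
Lemma pos_norm x t : pos x -> cnorm x <= t -> cnorm (t%:C%:A - x) <= t.
Proof.
move=> px xt; have sx := pos_sa px.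
have p : pos (t%:C%:A - x).
  split; first by apply: saB => //; exact: saA.
  by exists t; rewrite opprB addrC subrK.
apply: pos_add_scalar p px _ _; last by rewrite subrK.
by rewrite mulrBl mulrBr scalar_comm.
Qed.

Lemma norm_pos x t : sa x -> cnorm x <= t -> pos (t%:C%:A - x).
Proof.
move=> sx xt; split; first by apply: saB => //; exact: saA.
by exists t; rewrite opprB addrC subrK.
Qed.

Lemma pos_le_norm x s : pos x -> pos (s%:C%:A - x) -> cnorm x <= s.
Proof.
move=> px pxs; apply: (pos_add_scalar px pxs); last by rewrite addrC subrK.
by rewrite mulrBl mulrBr scalar_comm.
Qed.

(** The witness must not depend on [e]; by [pos_norm], [cnorm x + 1] serves for all [e <= 1] at
    once. *)
Lemma pos_closed x : (forall e, 0 < e -> pos (x + e%:C%:A)) -> pos x.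
Proof.
move=> h; have sx : sa x.
  have [sx1 _] := h _ ltr01.
  by rewrite -(addrK (1%:C%:A) x); apply: saB => //; exact: saA.
split=> //; exists (cnorm x + 1).
suff k e : 0 < e <= 1 -> cnorm ((cnorm x + 1)%:C%:A - x) <= cnorm x + 1 + e.
  apply/ler_addgt0Pr => e e0; have [e1|e1] := leP e 1.
    by apply: k; rewrite e0.
  have := k 1; lra.
move=> /andP[e0 e1]; have e0' := ltW e0; have pe := h _ e0.
have := @pos_norm _ (cnorm x + 1) pe.
have := cnormD x e%:C%:A; rewrite cnormA ger0_norm// => h1 h2.
have {h1 h2} h1 : cnorm ((cnorm x + 1)%:C%:A - (x + e%:C%:A)) <= cnorm x + 1.
  by apply: h2; lra.
have -> : (cnorm x + 1)%:C%:A - x =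
  ((cnorm x + 1)%:C%:A - (x + e%:C%:A)) + e%:C%:A by ncring.
apply: le_trans (cnormD _ _) _; rewrite cnormA ger0_norm//; lra.
Qed.

Lemma pos_closedZ x r : (forall e, 0 < e -> pos (x + (e * r)%:C%:A)) -> pos x.
Proof.
move=> h; apply: pos_closed => e e0.
have r1 : 0 < `|r| + 1 by have := normr_ge0 r; lra.
have e1 : 0 < e / (`|r| + 1) by rewrite divr_gt0.
have -> : x + e%:C%:A =
    x + (e / (`|r| + 1) * r)%:C%:A + (e - e / (`|r| + 1) * r)%:C%:A by ncring.
apply: posD; first exact: h.
apply: posA; rewrite subr_ge0 -mulrA; apply: ler_piMr; first exact: ltW.
by rewrite mulrC ler_pdivrMr// mul1r; have := ler_norm r; lra.
Qed.

(** With [c] a root of [x + e], commutation makes [g * c] self-adjoint, and [g * x * g + e g^2] is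
    its square. Positivity of [star z * z] is itself derived from this commuting case. *)
Lemma pos_conj x g : pos x -> sa g -> x * g = g * x -> pos (g * x * g).
Proof.
move=> px sg xg; apply: (@pos_closedZ _ (cnorm (g * g))) => e e0.
have [c [sc cE cc _]] := pos_sqrt px e0.
have cg : c * g = g * c by exact: cc.
have -> : g * x * g + (e * cnorm (g * g))%:C%:A =
    (g * c) * (g * c) + e%:C *: ((cnorm (g * g))%:C%:A - g * g).
  have -> : (g * c) * (g * c) = g * (c * c) * g.
    by rewrite -!mulrA cg.
  by rewrite cE; ncring.
apply: posD; first by apply: sq_pos; apply: saM.
by apply: posZ; [exact: ltW|apply: norm_pos => //; exact: sa_sq].
Qed.

Lemma pos_pow x n : pos x -> pos (x ^+ n).
Proof.
move=> px; have [m ->] : exists m, n = (odd n + m.*2)%N.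
  by exists n./2; rewrite odd_double_half.
move: (odd n) => b; elim: m => [|m IHm].
  rewrite addn0; case: b; rewrite ?expr1 ?expr0//.
  by rewrite -[1]scale1r -(rmorph1 (real_complex R)); exact: posA.
have -> : x ^+ (b + m.+1.*2) = x * x ^+ (b + m.*2) * x.
  by rewrite doubleS !addnS exprS exprSr mulrA.
by apply: pos_conj => //; [exact: pos_sa|rewrite -exprSr -exprS].
Qed.

End Positive.

(** * Positivity of [star z * z] *)

Section Kaplansky.
Context {R : realType} {M : cstarAlgType R}.
Implicit Types (x y z a c g w : M) (r s t e : R).

Lemma exp_gt_linear (r C : R) : 1 < r -> exists k, 1 + C * (2 ^ k)%:R < r ^+ (2 ^ k).
Proof.
move=> r1; pose q := r - 1; have q0 : 0 < q by rewrite subr_gt0.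
have rE : r = 1 + q by rewrite /q addrC subrK.
clearbody q; subst r; clear r1.
pose k := Num.bound (2 * `|C| / q ^+ 2); exists k.+1.
have kP : 2 * `|C| < (2 ^ k)%:R * q ^+ 2.
  rewrite -ltr_pdivrMr ?exprn_gt0//.
  apply: lt_trans (_ : k%:R < _); last by rewrite ltr_nat ltn_expl.
  by apply: archi_boundP; apply: divr_ge0; [exact: mulr_ge0|exact: sqr_ge0].
have m0 : 1 <= (2 ^ k)%:R :> R by rewrite ler1n expn_gt0.
have -> : (2 ^ k.+1 = 2 ^ k * 2)%N by rewrite expnS mulnC.
rewrite exprM natrM; move: (bernoulli (2 ^ k) (ltW q0)) kP m0.
move: ((1 + q) ^+ (2 ^ k)) ((2 ^ k)%:R : R) => X m hX hm m1.
have hC := ler_norm C; have hC0 := normr_ge0 C.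
have mq : 0 < m * q by rewrite mulr_gt0//; lra.
have h3 : (1 + m * q) ^+ 2 <= X ^+ 2.
  by rewrite lerXn2r ?nnegrE; lra.
have h4 : m * (2 * `|C|) < m * (m * q ^+ 2) by rewrite ltr_pM2l//; lra.
have h5 : m * C <= m * `|C| by rewrite ler_wpM2l//; lra.
have -> : 1 + C * (m * 2) = 1 + 2 * (m * C) by ring.
apply: lt_le_trans h3; have -> : (1 + m * q) ^+ 2 = 1 + 2 * (m * q) + m * (m * q ^+ 2) by ring.
lra.
Qed.

Lemma sa_pow2_norm w k : sa w -> cnorm (w ^+ (2 ^ k)) = cnorm w ^+ (2 ^ k).
Proof.
move=> sw; elim: k => [|k IHk]; first by rewrite expn0 !expr1.
by rewrite expnS mulnC !exprM expr2 cnorm_sa_sq ?IHk//; exact: saX.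
Qed.

(** A substitute for the spectral radius formula: for self-adjoint [w] the norm is multiplicative
    along the exponents [2^k], and there a linear factor cannot compensate an exponential gap. *)
Lemma norm_le_of_growth w t C : sa w -> 0 < t ->
  (forall m, cnorm (w ^+ m) <= (1 + C * m%:R) * t ^+ m) -> cnorm w <= t.
Proof.
move=> sw t0 h; rewrite leNgt; apply/negP => wt.
have [|k] := @exp_gt_linear (cnorm w / t) C; first by rewrite ltr_pdivlMr// mul1r.
rewrite expr_div_n ltr_pdivlMr ?exprn_gt0// -sa_pow2_norm//.
by have := h (2 ^ k)%N; lra.
Qed.

(* [c c^*] and [c^* c] have the same powers up to a bounded factor:
   [c c^* (s + c c^* )^m = c (s + c^* c)^m c^*]. *)
Lemma pos_1sub_starC c : pos (1 - star c * c) -> pos (1 - c * star c).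
Proof.
move=> p; have scs : sa (c * star c) by rewrite /sa starM starK.
set t := cnorm (1 - star c * c) + 1.
have t1 : 1 <= t by rewrite /t; have := cnorm_ge0 (1 - star c * c); lra.
have t0 : 0 <= t by lra.
pose s := t - 1; have s0 : 0 <= s by rewrite /s; lra.
have nt : cnorm (s%:C%:A + star c * c) <= t.
  have := @pos_norm _ _ _ t p; rewrite /t -/t.
  have -> : t%:C%:A - (1 - star c * c) = s%:C%:A + star c * c.
    by rewrite /s; ncring.
  by apply; rewrite /t; lra.
split; first by apply: saB => //; exact: sa1.
exists t.
have -> : t%:C%:A - (1 - c * star c) = s%:C%:A + c * star c by rewrite /s; ncring.
set x := s%:C%:A + star c * c in nt; set w := s%:C%:A + c * star c.
have sw : sa w by apply: saD => //; exact: saA.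
have cw m : c * star c * w ^+ m = c * x ^+ m * star c.
  have wc : w * c = c * x by rewrite /w /x; ncring.
  have wmc : w ^+ m * c = c * x ^+ m.
    elim: m => [|m IHm]; first by rewrite !expr0 mul1r mulr1.
    by rewrite exprSr -mulrA wc mulrA IHm -mulrA -exprSr.
  have comm : c * star c * w = w * (c * star c) by rewrite /w; ncring.
  by rewrite -wmc -[RHS]mulrA; apply: commrX.
have xm m : cnorm (x ^+ m) <= t ^+ m.
  elim: m => [|m IHm]; first by rewrite !expr0 cnorm1.
  rewrite !exprS; apply: le_trans (cnormM _ _) _.
  by apply: ler_pM => //; exact: cnorm_ge0.
apply: (@norm_le_of_growth _ _ (cnorm c ^+ 2)) => //; first lra.
elim=> [|m IHm]; first by rewrite !expr0 cnorm1 mulr0 addr0 mulr1.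
have -> : w ^+ m.+1 = s%:C *: w ^+ m + c * star c * w ^+ m.
  by rewrite exprS {1}/w mulrDl -scalerAl mul1r.
apply: le_trans (cnormD _ _) _; rewrite cnormZr ger0_norm// cw.
have h2 : cnorm (c * x ^+ m * star c) <= cnorm c ^+ 2 * t ^+ m.
  apply: le_trans (cnormM _ _) _; rewrite cnorm_starE expr2 mulrAC.
  apply: ler_wpM2r; first exact: cnorm_ge0.
  by apply: le_trans (cnormM _ _) _; apply: ler_wpM2l => //; exact: cnorm_ge0.
rewrite -natr1 (exprS t); have tm : 0 <= t ^+ m by exact: exprn_ge0.
have C0 : 0 <= cnorm c ^+ 2 by exact: sqr_ge0.
have m0 : 0 <= m%:R :> R by exact: ler0n.
move: (cnorm c ^+ 2) (t ^+ m) (m%:R : R) (cnorm (w ^+ m)) IHm h2 tm C0 m0.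
move=> C T m' W IHm h2 T0 C0 m0.
have h3 : s * W <= s * ((1 + C * m') * T) by exact: ler_wpM2l.
have CT : 0 <= C * T by exact: mulr_ge0.
have CTm : 0 <= C * m' * T by rewrite !mulr_ge0.
have h4 : 0 <= (t - 1) * (C * T) by rewrite mulr_ge0// subr_ge0.
have h5 : 0 <= (t - s) * ((1 + C * m') * T).
  by rewrite mulr_ge0//; [rewrite /s; lra|rewrite mulrDl mul1r; lra].
have -> : (1 + C * (m' + 1)) * (t * T) = t * ((1 + C * m') * T) + t * (C * T) by ring.
by clearbody s; lra.
Qed.

Lemma pos_1sub a : cnorm a <= 1 -> sa a -> pos (1 - a).
Proof.
by move=> h sx; rewrite -[1]scale1r -(rmorph1 (real_complex R)); apply: norm_pos.
Qed.

(* With [y = z^* z] and [w = 1 - y >= 0], the elements [c = z w^m] satisfy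
   [1 - c^* c = w + y (1 + w + ... + w^(2m-1)) y >= 0], which bounds [y w^2m]
   and hence lets [w^m] grow at most linearly. *)
Lemma star_mul_pos z : pos (star z * z).
Proof.
wlog z1 : z / cnorm (star z * z) <= 1.
  move=> h; set k := cnorm (star z * z) + 1.
  have k0 : 0 < k by rewrite /k; have := cnorm_ge0 (star z * z); lra.
  have k0' := ltW k0; have ik0 : 0 <= k^-1 by rewrite invr_ge0.
  pose u := (Num.sqrt k^-1)%:C *: z.
  have uE : star u * u = k^-1%:C *: (star z * z).
    by rewrite /u starZr -scalerAl -scalerAr scalerA -rmorphM/= -expr2 sqr_sqrtr.
  have -> : star z * z = k%:C *: (star u * u).
    by rewrite uE scalerA -rmorphM/= divff ?gt_eqF// rmorph1 scale1r.
  apply: posZ => //; apply: h.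
  by rewrite uE cnormZr ger0_norm// ler_pdivrMl// mulr1 /k; lra.
set y := star z * z in z1 *; have sy : sa y by exact: sa_starM.
set w := 1 - y; have pw : pos w by exact: pos_1sub.
have sw := pos_sa pw.
have yE : y = 1 - w by rewrite /w opprB addrC subrK.
have yw n : y * w ^+ n = w ^+ n * y.
  by apply: commrX; rewrite /GRing.comm yE; ncring.
have bound2 m : cnorm (y * w ^+ (m + m)) <= 3.
  pose c := z * w ^+ m.
  have cc : star c * c = y * w ^+ (m + m).
    by rewrite /c starM saX// -mulrA (mulrA (star z)) -/y mulrA -yw -mulrA exprD.
  have p1 : pos (1 - star c * c).
    have -> : 1 - star c * c = w + \sum_(i < m + m) y * w ^+ i * y.
      have := subrX1 w (m + m).
      have -> : w - 1 = - y by rewrite yE opprB.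
      move=> /eqP; rewrite subr_eq => /eqP wE.
      have -> : \sum_(i < m + m) y * w ^+ i * y = y * (y * \sum_(i < m + m) w ^+ i).
        by rewrite !mulr_sumr; apply: eq_bigr => i _; rewrite -mulrA yw.
      rewrite cc wE; move: (\sum_(i < m + m) w ^+ i) => S.
      by rewrite /w; ncring.
    apply: posD => //; apply: pos_sum => i; apply: pos_conj => //.
    exact: pos_pow.
  have p2 := pos_1sub_starC p1.
  (* [a] and [b] are the real and imaginary parts of [c], so [star c * c + c * star c] is twice
     [a * a + b * b]. This turns positivity of [1 - c * star c] into that of [1 + star c * c]. *)
  pose a := (2^-1)%:C *: (c + star c).
  pose b := (- (2^-1)%:C * 'i%C) *: (c - star c).
  have sa_a : sa a by apply: saZ; rewrite /sa starD starK addrC.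
  have sb : sa b.
    have -> : b = - ((2^-1)%:C *: ('i%C *: (c - star c))) by rewrite /b; ncring.
    by rewrite /sa starN starZr starZ starB starK conjc_i; ncring.
  have ii : 'i%C * 'i%C = -1 :> R[i] by rewrite -expr2 sqr_i.
  have p3 : pos (1 + star c * c).
    have -> : 1 + star c * c = (1 - c * star c) + 2%:C *: (a * a + b * b).
      rewrite /a /b; move: ('i%C : R[i]) ii => j jj.
      have -> : (- (2^-1)%:C * j) *: (c - star c) * ((- (2^-1)%:C * j) *: (c - star c))
         = - (2^-1 * 2^-1)%:C *: ((c - star c) * (c - star c)).
        rewrite -scalerAl -scalerAr scalerA; congr (_ *: _).
        by rewrite mulrACA jj mulrN1 mulrNN rmorphM.
      by ncfield.
    by apply: posD => //; apply: posZ => //; apply: posD; exact: sq_pos.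
  rewrite -cc; have := @pos_le_norm _ _ _ 2 p3.
  have -> : 2%:C%:A - (1 + star c * c) = 1 - star c * c by ncring.
  move=> /(_ p1) h.
  have -> : star c * c = (1 + star c * c) - 1 by rewrite addrC addKr.
  by apply: le_trans (cnormB_le _ _) _; rewrite cnorm1; lra.
have [C C0 bound] : exists2 C, 0 <= C & forall n, cnorm (y * w ^+ n) <= C.
  exists (3 + 3 * cnorm w); first by have := cnorm_ge0 w; lra.
  move=> n; have nw := cnorm_ge0 w; rewrite -(odd_double_half n) -addnn.
  have := bound2 n./2; case: (odd n) => /=; last by rewrite add0n; lra.
  rewrite add1n exprS mulrA yE => h.
  have -> : (1 - w) * w = w * (1 - w) by ncring.
  rewrite -mulrA -yE; apply: le_trans (cnormM _ _) _; rewrite yE.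
  have := ler_wpM2l nw h; lra.
have nw : cnorm w <= 1.
  apply: (@norm_le_of_growth _ _ C) => //.
  elim=> [|m IHm]; first by rewrite !expr0 cnorm1 mulr0 addr0 mulr1.
  move: IHm; rewrite !expr1n !mulr1 => IHm.
  have -> : w ^+ m.+1 = w ^+ m - y * w ^+ m by rewrite exprS {1}/w mulrBl mul1r.
  apply: le_trans (cnormB_le _ _) _; have := bound m; rewrite -natr1.
  move: (m%:R : R) IHm => m'; lra.
by rewrite yE; apply: pos_1sub.
Qed.

Lemma mul_star_pos z : pos (z * star z).
Proof. by have := star_mul_pos (star z); rewrite starK. Qed.

End Kaplansky.

(** * Centers of simple algebras *)

Section Subalgebras.
Context {R : realType} {M : cstarAlgType R}.
Implicit Types (x y z a c : M) (r s t e : R) (C D : set M).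

(** The algebraic part of [cstar_subalgebra], through which relative commutants are handled. *)
Definition star_subalg D :=
  [/\ D 1,
      forall (a : R[i]) x y, D x -> D y -> D (a *: x + y),
      forall x y, D x -> D y -> D (x * y)
    & forall x, D x -> D (star x)].

Lemma cstar_star_subalg D : cstar_subalgebra D -> star_subalg D.
Proof. by case. Qed.

Section Closure.
Variable D : set M.
Hypothesis DS : star_subalg D.

Lemma mem1 : D 1. Proof. by case: DS. Qed.
Lemma mem0 : D 0.
Proof. by case: DS => D1 DZ _ _; have := DZ (-1) _ _ D1 D1; rewrite scaleN1r addNr. Qed.
Lemma memD x y : D x -> D y -> D (x + y).
Proof. by case: DS => _ DZ _ _ Dx Dy; have := DZ 1 _ _ Dx Dy; rewrite scale1r. Qed.
Lemma memZ (a : R[i]) x : D x -> D (a *: x).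
Proof. by case: DS => _ DZ _ _ Dx; have := DZ a _ _ Dx mem0; rewrite addr0. Qed.
Lemma memN x : D x -> D (- x).
Proof. by move=> Dx; rewrite -scaleN1r; exact: memZ. Qed.
Lemma memB x y : D x -> D y -> D (x - y).
Proof. by move=> Dx Dy; apply: memD => //; exact: memN. Qed.
Lemma memM x y : D x -> D y -> D (x * y).
Proof. by case: DS => _ _ DM _; exact: DM. Qed.
Lemma mem_star x : D x -> D (star x).
Proof. by case: DS => _ _ _; exact. Qed.
Lemma mem_sum (I : Type) (s : seq I) (P : pred I) (F : I -> M) :
  (forall i, P i -> D (F i)) -> D (\sum_(i <- s | P i) F i).
Proof. by move=> h; elim/big_ind: _ => //; [exact: mem0|exact: memD]. Qed.
Lemma memX x n : D x -> D (x ^+ n).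
Proof.
by move=> Dx; elim: n => [|n IHn]; rewrite ?expr0 ?exprS; [exact: mem1|exact: memM].
Qed.
End Closure.

Lemma commutant_subalg C D : (forall c, C c -> C (star c)) -> star_subalg D ->
  star_subalg (commutant C D).
Proof.
move=> CS DS; split.
- by split; [exact: mem1|move=> c _; rewrite mul1r mulr1].
- move=> a x y [Dx xC] [Dy yC]; split; first by apply: memD => //; exact: memZ.
  by move=> c Cc; rewrite mulrDl mulrDr -scalerAl -scalerAr xC// yC.
- move=> x y [Dx xC] [Dy yC]; split; first exact: memM.
  by move=> c Cc; rewrite -mulrA yC// mulrA xC// mulrA.
- move=> x [Dx xC]; split; first exact: mem_star.
  by move=> c Cc; rewrite -{1}(starK c) -starM -xC ?starM ?starK//; exact: CS.
Qed.

Lemma mem_re D x : star_subalg D -> D x -> D ((2^-1)%:C *: (x + star x)).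
Proof. by move=> DS Dx; apply: memZ => //; apply: memD => //; exact: mem_star. Qed.

Lemma mem_im D x : star_subalg D -> D x ->
  D ((2^-1)%:C *: (- 'i%C *: (x - star x))).
Proof. by move=> DS Dx; do 2 apply: memZ => //; apply: memB => //; exact: mem_star. Qed.

Lemma sa_re x : sa ((2^-1)%:C *: (x + star x)).
Proof. by apply: saZ; rewrite /sa starD starK addrC. Qed.

Lemma sa_im x : sa ((2^-1)%:C *: (- 'i%C *: (x - star x))).
Proof.
by apply: saZ; rewrite /sa scaleNr starN starZ starB starK conjc_i; ncring.
Qed.

Lemma re_im x : x = (2^-1)%:C *: (x + star x) +
  'i%C *: ((2^-1)%:C *: (- 'i%C *: (x - star x))).
Proof.
have ii : 'i%C * 'i%C = -1 :> R[i] by rewrite -expr2 sqr_i.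
have -> : 'i%C *: ((2^-1)%:C *: (- 'i%C *: (x - star x)))
    = - ('i%C * 'i%C) *: ((2^-1)%:C *: (x - star x)) by ncring.
by rewrite ii; ncfield.
Qed.

Definition scalars C D := forall z, commutant C D z -> exists t : R[i], z = t%:A.

(* If [d = 1 - a^2] were invertible then [d >= delta > 0] and [|a| < 1]. *)
Lemma simple_center_sq D a : cstar_subalgebra D -> simple D ->
  commutant D D a -> sa a -> cnorm a = 1 -> a * a = 1.
Proof.
move=> DC Dsimple [Da aC] sx na; have DS := cstar_star_subalg DC.
pose d := 1 - a * a.
have Dd : D d by apply: memB => //; [exact: mem1|exact: memM].
have dC x : D x -> d * x = x * d.
  move=> Dx; have ax := aC _ Dx.
  by rewrite /d mulrBl mulrBr mul1r mulr1 -mulrA ax mulrA ax mulrA.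
(* The closed ideal generated by the central element [d]. If it is zero then [a * a = 1]; otherwise
   it contains 1 and [d] has an approximate inverse. *)
pose J := [set x | D x /\ forall e, 0 < e -> exists b, D b /\ cnorm (x - d * b) < e].
have Jid : closed_ideal D J.
  split.
  - by move=> x [].
  - split; first exact: mem0.
    by move=> e e0; exists 0; rewrite mulr0 subrr cnorm0; split=> //; exact: mem0.
  - move=> x y [Dx hx] [Dy hy]; split; first exact: memB.
    move=> e e0; have e2 : 0 < e / 2 by lra.
    have [b [Db xb]] := hx _ e2; have [c [Dc yc]] := hy _ e2.
    exists (b - c); split; first exact: memB.
    have -> : x - y - d * (b - c) = (x - d * b) - (y - d * c) by ncring.
    by have := cnormB_le (x - d * b) (y - d * c); lra.
  - move=> c x Dc [Dx hx]; split; (split; first exact: memM) => e e0;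
    have k0 : 0 < cnorm c + 1 by have := cnorm_ge0 c; lra.
      have [b [Db xb]] := hx (e / (cnorm c + 1)) (divr_gt0 e0 k0).
      exists (c * b); split; first exact: memM.
      have -> : c * x - d * (c * b) = c * (x - d * b).
        by rewrite mulrBr !mulrA (dC c).
      apply: le_lt_trans (cnormM _ _) _.
      rewrite ltr_pdivlMr// in xb.
      by have := cnorm_ge0 (x - d * b); lra.
    have [b [Db xb]] := hx (e / (cnorm c + 1)) (divr_gt0 e0 k0).
    exists (b * c); split; first exact: memM.
    have -> : x * c - d * (b * c) = (x - d * b) * c by ncring.
    apply: le_lt_trans (cnormM _ _) _.
    rewrite ltr_pdivlMr// in xb.
    by have := cnorm_ge0 (x - d * b); lra.
  - move=> x hx.
    have Dx : D x.
      by case: DC => _ _ _ _ Dcl; apply: Dcl => e /hx[y [Dy _] xy]; exists y.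
    split=> // e e0; have e2 : 0 < e / 2 by lra.
    have [y [Dy hy] xy] := hx _ e2; have [b [Db yb]] := hy _ e2.
    exists b; split=> //; have := cnormD3 x y (d * b); lra.
case: (Dsimple _ Jid) => JE.
  have : J d.
    split=> // e e0; exists 1; rewrite mulr1 subrr cnorm0; split=> //; exact: mem1.
  by rewrite JE /= /d => /subr0_eq.
exfalso; have : J 1 by rewrite JE; exact: mem1.
(* With [d * b] within 1/4 of 1, [star (d * b) * (d * b)] is at least 1/4, and it is at most
   [K2 d^2]. Since [d - d^2 = a * d * a] is positive, [d] is at least [1 / (4 K2)], which
   contradicts [a * a] having norm 1. *)
move=> [_ /(_ 4^-1)[|b [Db nb]]]; first by lra.
have Dsb : D (star b) by exact: mem_star.
have saa : sa (a * a) by exact: sa_sq.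
have naa : cnorm (a * a) = 1 by rewrite cnorm_sa_sq// na expr1n.
have sd : sa d by apply: saB => //; exact: sa1.
have pd : pos d by apply: pos_1sub => //; rewrite naa.
pose K2 := cnorm (star b * b).
have K0 : 0 <= K2 by exact: cnorm_ge0.
have p1 : pos (K2%:C *: (d * d) - d * (star b * b) * d).
  have -> : K2%:C *: (d * d) - d * (star b * b) * d
      = d * (K2%:C%:A - star b * b) * d by ncring.
  apply: pos_conj => //; first by apply: norm_pos => //; exact: sa_starM.
  by apply/esym/dC; apply: memB => //; [apply: memZ => //; exact: mem1|exact: memM].
have cE : d * (star b * b) * d = star (d * b) * (d * b).
  by rewrite starM sd -(dC _ Dsb) -!mulrA (dC _ Db).
have p2 : pos (star (d * b) * (d * b) - (4^-1)%:C%:A).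
  set c := d * b in nb *; pose x := 1 - c.
  have xE : 1 - star c * c = x + star x - star x * x.
    by rewrite /x starB star1; ncring.
  have : cnorm (1 - star c * c) <= 3 / 4.
    rewrite xE; apply: le_trans (cnormB_le _ _) _.
    have := cnormD x (star x); rewrite cnorm_starE cnorm_star.
    have := cnorm_ge0 x; rewrite /x; nra.
  move/norm_pos => /(_ (saB sa1 (sa_starM c))).
  by have -> : (3 / 4)%:C%:A - (1 - star c * c) = star c * c - (4^-1)%:C%:A by ncfield.
have p3 : pos (K2%:C *: d - (4^-1)%:C%:A).
  have -> : K2%:C *: d - (4^-1)%:C%:A = (K2%:C *: (d * d) - d * (star b * b) * d)
    + (star (d * b) * (d * b) - (4^-1)%:C%:A) + K2%:C *: (a * d * a).
    by rewrite -cE /d; ncring.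
  apply: posD; first exact: posD.
  by apply: posZ => //; apply: pos_conj => //; exact: dC.
have [K20|K20] := eqVneq K2 0.
  have : pos ((- 4^-1)%:C%:A : M).
    have -> : (- 4^-1)%:C%:A = K2%:C *: d - (4^-1)%:C%:A by rewrite K20; ncring.
    by [].
  by move/posA_ge0; lra.
have K2p : 0 < K2 by rewrite lt_def K20.
have iK2p : 0 < K2^-1 by rewrite invr_gt0.
have p4 : pos ((1 - K2^-1 * 4^-1)%:C%:A - a * a).
  have -> : (1 - K2^-1 * 4^-1)%:C%:A - a * a =
      K2^-1%:C *: (K2%:C *: d - (4^-1)%:C%:A).
    rewrite scalerBr [X in _ = X - _]scalerA -rmorphM/= mulVf// rmorph1 scale1r.
    by rewrite /d; ncring.
  by apply: posZ => //; exact: ltW.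
have := pos_le_norm (sq_pos sx) p4; rewrite naa => h.
have : 0 < K2^-1 * 4^-1 by apply: mulr_gt0 => //; rewrite invr_gt0.
lra.
Qed.

(** A self-adjoint central [b] of norm 1 squares to 1, and its eigenspace [b * x = x] is a closed
    ideal; the two possible ideals give [b = -1] and [b = 1]. Real and imaginary parts reduce the
    general case to this one. *)
Lemma simple_center D : cstar_subalgebra D -> simple D -> scalars D D.
Proof.
move=> DC Dsimple; have DS := cstar_star_subalg DC.
have ZS : star_subalg (commutant D D).
  by apply: commutant_subalg => // c; exact: mem_star.
suff sacase a : commutant D D a -> sa a -> exists t : R[i], a = t%:A.
  move=> z Zz; have [s sE] := sacase _ (mem_re ZS Zz) (sa_re z).
  have [t tE] := sacase _ (mem_im ZS Zz) (sa_im z).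
  by exists (s + 'i%C * t); rewrite (re_im z) sE tE; ncring.
move=> Za sx; have [->|an0] := eqVneq a 0; first by exists 0; rewrite scale0r.
have na : cnorm a != 0 by apply: contra_neq an0; exact: cnorm0_eq0.
have na0 : 0 < cnorm a by rewrite lt_def na cnorm_ge0.
pose b := (cnorm a)^-1%:C *: a.
have Zb : commutant D D b by exact: memZ.
have sb : sa b by exact: saZ.
have nb : cnorm b = 1 by rewrite cnormZr ger0_norm ?invr_ge0 ?cnorm_ge0// mulVf.
have bb := simple_center_sq DC Dsimple Zb sb nb.
have aE : a = (cnorm a)%:C *: b.
  by rewrite scalerA -rmorphM/= mulfV// rmorph1 scale1r.
suff [b1|b1] : b = 1 \/ b = -1.
- by exists (cnorm a)%:C; rewrite {1}aE b1.
- by exists (- (cnorm a)%:C); rewrite {1}aE b1 scalerN scaleNr.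
have [Db bC] := Zb; have D1 := mem1 DS.
pose J := [set x | D x /\ b * x = x].
have Jid : closed_ideal D J.
  split.
  - by move=> x [].
  - by split; [exact: mem0|rewrite mulr0].
  - by move=> x y [Dx hx] [Dy hy]; split; [exact: memB|rewrite mulrBr hx hy].
  - move=> c x Dc [Dx hx]; split; (split; first exact: memM).
      by rewrite mulrA bC// -mulrA hx.
    by rewrite mulrA hx.
  - move=> x hx; split.
      by case: DC => _ _ _ _ Dcl; apply: Dcl => e /hx[y [Dy _] xy]; exists y.
    apply/eqP; rewrite -subr_eq0; apply/eqP; apply: (@cnorm_eps _ _ _ 2) => e e0.
    have [y [Dy by_] xy] := hx _ e0.
    have -> : b * x - x = b * (x - y) - (x - y) by rewrite mulrBr by_; ncring.
    by have := cnormB_le (b * (x - y)) (x - y); have := cnormM b (x - y); rewrite nb; lra.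
case: (Dsimple _ Jid) => JE.
  have : J (1 + b) by split; [exact: memD|rewrite mulrDr bb mulr1 addrC].
  by rewrite JE /= => /eqP; rewrite addrC addr_eq0 => /eqP; right.
by have : J 1; [rewrite JE|case=> _; rewrite mulr1; left].
Qed.
End Subalgebras.

(** * Conditional expectations of index-finite type *)

Section ScalarOf.
Context {R : realType} {M : cstarAlgType R}.
Implicit Types (x y z : M) (r : R) (s t : R[i]).

Definition scalar_of y : R[i] := xget 0 [set t : R[i] | y = t%:A].

Lemma scaleA_inj s t : s%:A = t%:A :> M -> s = t.
Proof.
move/eqP; rewrite -subr_eq0 -scalerBl scaler_eq0 oner_eq0 orbF subr_eq0.
by move/eqP.
Qed.

Lemma scalar_ofA t : scalar_of t%:A = t.
Proof.
rewrite /scalar_of; case: xgetP => [s -> /= /scaleA_inj //|/(_ t) /=].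
by move=> h; exfalso; apply: h.
Qed.

Lemma pos_scalar_ge0 t : pos (t%:A : M) -> 0 <= t.
Proof.
move=> p; have := pos_sa p; rewrite /sa starZ star1 => /scaleA_inj tc.
have tE : t = (complex.Re t)%:C.
  by move: tc; case: t {p} => a b /= [] h; congr (_ +i* _); lra.
by rewrite tE lecR; apply: (@posA_ge0 _ M); rewrite -tE.
Qed.

Lemma ge0_Re t : 0 <= t -> t = (complex.Re t)%:C.
Proof. by move=> h; rewrite RRe_real// ger0_real. Qed.

Lemma Re_ge0 t : 0 <= t -> 0 <= complex.Re t.
Proof. by move=> h; rewrite -lecR -ge0_Re. Qed.
End ScalarOf.

Definition expectation {R : realType} {M : cstarAlgType R} (C D : set M) E :=
  [/\ star_subalg C, cstar_subalgebra D, C `<=` D & cond_exp C D E].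

Section ConditionalExpectation.
Context {R : realType} {M : cstarAlgType R}.
Implicit Types (x y z : M) (r : R) (s t : R[i]).
Variables (C D : set M) (E : M -> M).
Hypothesis H : expectation C D E.
Let CS : star_subalg C. Proof. by case: H. Qed.
Let DC : cstar_subalgebra D. Proof. by case: H. Qed.
Let CD : C `<=` D. Proof. by case: H. Qed.
Let ce : cond_exp C D E. Proof. by case: H. Qed.
Let DS : star_subalg D. Proof. exact: cstar_star_subalg. Qed.

Lemma ce_mem x : D x -> C (E x). Proof. by case: ce => h *; exact: h. Qed.
Lemma ce_memD x : D x -> D (E x). Proof. by move=> /ce_mem/CD. Qed.
Lemma ce_lin (a : R[i]) x y : D x -> D y -> E (a *: x + y) = a *: E x + E y.
Proof. by case: ce => _ h *; exact: h. Qed.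
Lemma ce_id x : C x -> E x = x. Proof. by case: ce => _ _ h *; exact: h. Qed.
Lemma ceD x y : D x -> D y -> E (x + y) = E x + E y.
Proof. by move=> Dx Dy; have := ce_lin 1 Dx Dy; rewrite !scale1r. Qed.
Lemma ce0 : E 0 = 0. Proof. by apply: ce_id; exact: mem0. Qed.
Lemma ce1 : E 1 = 1. Proof. by apply: ce_id; exact: mem1. Qed.
Lemma ceZ (a : R[i]) x : D x -> E (a *: x) = a *: E x.
Proof. by move=> Dx; have := ce_lin a Dx (mem0 DS); rewrite !addr0 ce0 addr0. Qed.
Lemma ceN x : D x -> E (- x) = - E x.
Proof. by move=> Dx; rewrite -scaleN1r ceZ// scaleN1r. Qed.
Lemma ceB x y : D x -> D y -> E (x - y) = E x - E y.
Proof. by move=> Dx Dy; rewrite ceD ?ceN//; exact: memN. Qed.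
Lemma ce_sum (I : Type) (s : seq I) (F : I -> M) : (forall i, D (F i)) ->
  E (\sum_(i <- s) F i) = \sum_(i <- s) E (F i).
Proof.
move=> DF; elim: s => [|i s IHs]; first by rewrite !big_nil ce0.
by rewrite !big_cons ceD ?IHs//; exact: mem_sum.
Qed.
Lemma ceMl c x : C c -> D x -> E (c * x) = c * E x.
Proof.
case: ce => _ _ _ h _ Cc Dx; have := h c x 1 Cc Dx (mem1 CS).
by rewrite !mulr1.
Qed.
Lemma ceMr c x : C c -> D x -> E (x * c) = E x * c.
Proof.
case: ce => _ _ _ h _ Cc Dx; have := h 1 x c (mem1 CS) Dx Cc.
by rewrite !mul1r.
Qed.
Lemma ce_star_pos x : D x -> pos (E (star x * x)).
Proof. by case: ce => _ _ _ _ h Dx; have [z _ ->] := h _ Dx; exact: star_mul_pos. Qed.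

(** Polarization: [E] sends [star y * y], with [y = x + conjc a *: 1], to a self-adjoint element,
    and the values [a = 1] and [a = i] separate [E (star x)] from [E x]. *)
Lemma ce_star x : D x -> E (star x) = star (E x).
Proof.
move=> Dx; have D1 := mem1 DS; have Dsx := mem_star DS Dx.
have sa_of a : sa (E (star x * x + (conjc a *: star x + (a *: x + (conjc a * a) *: 1)))).
  have -> : star x * x + (conjc a *: star x + (a *: x + (conjc a * a) *: 1)) =
    star (x + conjc a *: 1) * (x + conjc a *: 1).
    by rewrite starD starZ star1 conjcK; ncring.
  by apply: pos_sa; apply: ce_star_pos; apply: memD => //; exact: memZ.
have s0 : sa (E (star x * x)) by apply: pos_sa; exact: ce_star_pos.
have key a : conjc a *: E (star x) + a *: E x =
    a *: star (E (star x)) + conjc a *: star (E x).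
  have Dxx : D (star x * x) by exact: memM.
  have Dcs : D (conjc a *: star x) by exact: memZ.
  have Dax : D (a *: x) by exact: memZ.
  have Dk : D ((conjc a * a) *: 1) by exact: memZ.
  have := sa_of a; rewrite (ceD Dxx) ?(ceD Dcs) ?(ceD Dax); try by repeat apply: memD.
  rewrite /sa !starD s0 => /addrI; rewrite !ceZ// ce1 !starZ star1 conjcK.
  rewrite rmorphM/= conjcK [a * _]mulrC !addrA => /addIr <-.
  by rewrite addrC.
have h1 := key 1; have := key 'i%C; rewrite conjc_i.
move: h1; rewrite rmorph1 !scale1r !scaleNr => h1 h2.
have ii : 'i%C * 'i%C = -1 :> R[i] by rewrite -expr2 sqr_i.
have {h2} h2 : - E (star x) + E x = star (E (star x)) - star (E x).
  have := congr1 (fun y => (- 'i%C) *: y) h2.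
  rewrite /= !scalerDr !scalerN !scalerA mulNr ii opprK !scale1r.
  by rewrite ?scaleN1r ?opprK.
have : 2 *: E (star x) = 2 *: star (E x).
  have -> : 2 *: E (star x) = (E (star x) + E x) - (- E (star x) + E x) by ncring.
  by rewrite h1 h2; ncring.
by apply: scalerI; rewrite pnatr_eq0.
Qed.

(** Positivity in [cond_exp] is stated for [star x * x] with [x] in [D], so the square root of
    [x + r] has to be found inside [D]. *)
Lemma ce_pos x : D x -> pos x -> pos (E x).
Proof.
move=> Dx px; apply: pos_closed => r r0.
have [c [sc cE _ /(_ D DC Dx) Dc]] := pos_sqrt px r0.
have D1 := mem1 DS.
have -> : E x + r%:C%:A = E (star c * c).
  by rewrite sc cE ceD ?ceZ ?ce1//; exact: memZ.
exact: ce_star_pos.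
Qed.

Section Scalars.
Hypothesis CC : scalars C C.
Local Notation N := (commutant C D).

(* The paper's tr; the paper's tau is [ind^-1] below. *)
Definition tau x : R[i] := scalar_of (E x).

Lemma commutant_star_subalg : star_subalg N.
Proof. by apply: commutant_subalg => // c; exact: mem_star. Qed.

Lemma tauE x : N x -> E x = (tau x)%:A.
Proof.
move=> [Dx xC]; have [|t tE] := CC (z := E x).
  split; first exact: ce_mem.
  by move=> c Cc; rewrite -ceMr// -ceMl// xC.
by rewrite /tau tE scalar_ofA.
Qed.

Lemma tau_lin (a : R[i]) x y : N x -> N y -> tau (a *: x + y) = a * tau x + tau y.
Proof.
move=> Nx Ny; apply: (@scaleA_inj _ M); have [Dx _] := Nx; have [Dy _] := Ny.
rewrite -tauE; last first.
  have NS := commutant_star_subalg.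
  by apply: memD => //; exact: memZ.
by rewrite ce_lin// !tauE// scalerDl scalerA.
Qed.

Let NS := commutant_star_subalg.

Lemma tau0 : tau 0 = 0.
Proof. by rewrite /tau ce0 -(scale0r (1 : M)) scalar_ofA. Qed.
Lemma tau1 : tau 1 = 1.
Proof. by rewrite /tau ce1 -[1 in LHS]scale1r scalar_ofA. Qed.
Lemma tauD x y : N x -> N y -> tau (x + y) = tau x + tau y.
Proof. by move=> Nx Ny; have := tau_lin 1 Nx Ny; rewrite scale1r mul1r. Qed.
Lemma tauZ (a : R[i]) x : N x -> tau (a *: x) = a * tau x.
Proof. by move=> Nx; have := tau_lin a Nx (mem0 NS); rewrite !addr0 tau0 addr0. Qed.
Lemma tauB x y : N x -> N y -> tau (x - y) = tau x - tau y.
Proof.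
move=> Nx Ny; rewrite -scaleN1r addrC tau_lin// mulN1r addrC; reflexivity.
Qed.
Lemma tau_sum (I : Type) (s : seq I) (F : I -> M) : (forall i, N (F i)) ->
  tau (\sum_(i <- s) F i) = \sum_(i <- s) tau (F i).
Proof.
move=> NF; elim: s => [|i s IHs]; first by rewrite !big_nil tau0.
by rewrite !big_cons tauD ?IHs//; exact: mem_sum.
Qed.
Lemma tau_star x : N x -> tau (star x) = conjc (tau x).
Proof.
move=> Nx; have [Dx _] := Nx; apply: (@scaleA_inj _ M).
by rewrite -tauE ?ce_star// ?tauE// ?starZ ?star1//; exact: mem_star.
Qed.
Lemma tau_ge0 x : N x -> 0 <= tau (star x * x).
Proof.
move=> Nx; have [Dx _] := Nx; apply: (@pos_scalar_ge0 _ M).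
by rewrite -tauE; [exact: ce_star_pos|apply: memM => //; exact: mem_star].
Qed.
Lemma tau_ge0' x : N x -> 0 <= tau (x * star x).
Proof. by move=> Nx; have := tau_ge0 (mem_star NS Nx); rewrite starK. Qed.
Lemma tau_proj_ge0 x : N x -> projection x -> 0 <= tau x.
Proof. by move=> Nx [sx xx]; rewrite -xx -{1}sx; exact: tau_ge0. Qed.
End Scalars.

(** * Quasi-bases: Bessel and Pimsner-Popa inequalities *)

Section QuasiBasis.
Variables (m : nat) (l : 'I_m -> M) (c : R).
Hypotheses (qb : quasi_basis D E l) (qc : \sum_i l i * star (l i) = c%:C%:A).

Lemma qb_mem i : D (l i). Proof. by case: qb. Qed.
Lemma qb_smem i : D (star (l i)). Proof. by apply: mem_star => //; exact: qb_mem. Qed.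
Lemma qb1 x : D x -> \sum_i l i * E (star (l i) * x) = x.
Proof. by case: qb => _ h /h[]. Qed.
Lemma qb2 x : D x -> \sum_i E (x * l i) * star (l i) = x.
Proof. by case: qb => _ h /h[]. Qed.

(* The difference of the two sides of Bessel's inequality is exhibited as
   [sum_k z_k z_k^*] with [z_k = l_k - r sum_i d_i E (d_i^* l_k)]. *)
Lemma bessel k (d : 'I_k -> M) (r : R) (t : R) : (forall i, D (d i)) ->
  (forall i j, E (star (d i) * d j) = ((i == j)%:R * t%:C)%:A) ->
  pos (c%:C%:A - (2 * r - r ^+ 2 * t)%:C *: \sum_i d i * star (d i)).
Proof.
move=> Dd od.
have Dsd i : D (star (d i)) by exact: mem_star.
pose P x := \sum_i d i * E (star (d i) * x).
have DP x : D x -> D (P x).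
  move=> Dx; apply: mem_sum => // i _; apply: memM => //.
  by apply: ce_memD; exact: memM.
set S := \sum_i d i * star (d i).
have sS : star S = S.
  by rewrite /S star_sum; apply: eq_bigr => i _; rewrite starM starK.
have sE i j : star (E (star (d i) * l j)) = E (star (l j) * d i).
  rewrite -ce_star ?starM ?starK//; apply: memM => //; exact: qb_mem.
have lP : \sum_j l j * star (P (l j)) = S.
  rewrite /P; under eq_bigr => j _ do rewrite star_sum mulr_sumr.
  rewrite exchange_big /=; apply: eq_bigr => i _.
  rewrite -[X in _ = X * _](qb1 (Dd i)) mulr_suml; apply: eq_bigr => j _.
  by rewrite starM sE mulrA.
have Pl : \sum_j P (l j) * star (l j) = S.
  rewrite -sS -lP star_sum; apply: eq_bigr => j _; by rewrite starM starK.
have Pd i : P (d i) = t%:C *: d i.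
  rewrite /P (bigD1 i)//= big1 ?addr0 => [|j ji].
    by rewrite od eqxx mul1r -scalerAr mulr1.
  by rewrite od (negbTE ji) mul0r scale0r mulr0.
have PP : \sum_j P (l j) * star (P (l j)) = t%:C *: S.
  rewrite {2}/P; under eq_bigr => j _ do rewrite star_sum mulr_sumr.
  rewrite exchange_big /= /S scaler_sumr; apply: eq_bigr => i _.
  rewrite scalerAl -Pd -[X in _ = P X * _](qb1 (Dd i)).
  have -> : P (\sum_j l j * E (star (l j) * d i)) =
      \sum_j P (l j) * E (star (l j) * d i).
    rewrite /P; under [RHS]eq_bigr => j _ do rewrite mulr_suml.
    rewrite exchange_big /=; apply: eq_bigr => k' _.
    rewrite mulr_sumr ce_sum => [|j]; last first.
      do 2 (apply: memM => //); first exact: qb_mem.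
      by apply: ce_memD; apply: memM => //; exact: qb_smem.
    rewrite mulr_sumr; apply: eq_bigr => j _.
    rewrite mulrA ceMr ?mulrA//; last by apply: memM => //; exact: qb_mem.
    by apply: ce_mem; apply: memM => //; exact: qb_smem.
  rewrite mulr_suml; apply: eq_bigr => j _.
  by rewrite starM sE mulrA.
have -> : c%:C%:A - (2 * r - r ^+ 2 * t)%:C *: S =
    \sum_j (l j - r%:C *: P (l j)) * star (l j - r%:C *: P (l j)).
  have expand j : (l j - r%:C *: P (l j)) * star (l j - r%:C *: P (l j)) =
      (l j * star (l j) - r%:C *: (l j * star (P (l j))))
      - r%:C *: (P (l j) * star (l j)) + (r ^+ 2)%:C *: (P (l j) * star (P (l j))).
    by rewrite starB starZr; ncring.
  under eq_bigr => j _ do rewrite expand.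
  rewrite big_split /= !sumrB -!scaler_sumr qc lP Pl PP; ncring.
by apply: pos_sum => j; exact: mul_star_pos.
Qed.

(** Bessel's inequality with [t = 0]: there [r] is unconstrained, and [r = e^-1] bounds [x * star x]
    by [c e / 2] for every [e]. *)
Lemma ce_faithful x : D x -> E (star x * x) = 0 -> x = 0.
Proof.
move=> Dx Ex0; suff : star x = 0 by move/(congr1 star); rewrite starK star0.
apply: star_eq0; rewrite starK; apply: (@cnorm_eps _ _ _ (c / 2)) => e e0.
have := @bessel 1 (fun _ => x) e^-1 0 (fun _ => Dx); rewrite big_ord1 => h.
have {h} h : pos ((c * e / 2)%:C%:A - x * star x).
  have -> : (c * e / 2)%:C%:A - x * star x =
    (e / 2)%:C *: (c%:C%:A - (2 * e^-1 - e^-1 ^+ 2 * 0)%:C *: (x * star x)).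
    rewrite scalerBr !scalerA -!rmorphM/=.
    have -> : e / 2 * (2 * e^-1 - e^-1 ^+ 2 * 0) = 1 :> R by field; rewrite gt_eqF.
    by rewrite rmorph1 scale1r; congr (_%:C%:A - _); field.
  apply: posZ; first by lra.
  by apply: h => i j; rewrite Ex0 mulr0 scale0r.
by have := pos_le_norm (mul_star_pos x) h; lra.
Qed.

(* The Pimsner-Popa inequality. *)
Lemma pimsner_popa x (t : R) : 0 < t -> D x -> E (star x * x) = t%:C%:A ->
  cnorm (x * star x) <= c * t.
Proof.
move=> t0 Dx Ex; apply: pos_le_norm; first exact: mul_star_pos.
(* [r = t^-1] maximizes [2 r - r^2 t], with value [t^-1]. *)
have := @bessel 1 (fun _ => x) t^-1 t (fun _ => Dx); rewrite big_ord1 => h.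
have -> : (c * t)%:C%:A - x * star x =
    t%:C *: (c%:C%:A - (2 * t^-1 - t^-1 ^+ 2 * t)%:C *: (x * star x)).
  rewrite scalerBr !scalerA -!rmorphM/=.
  have -> : t * (2 * t^-1 - t^-1 ^+ 2 * t) = 1 :> R by field; rewrite gt_eqF.
  by rewrite rmorph1 scale1r; congr (_%:C%:A - _); ring.
apply: posZ; first exact: ltW.
by apply: h => i j; rewrite Ex (ord1 i) (ord1 j) eqxx mul1r.
Qed.

Lemma index_ge1 : 1 <= c.
Proof.
have := @pimsner_popa 1 1 ltr01 (mem1 DS).
by rewrite star1 !mulr1 cnorm1 ce1 rmorph1 scale1r; apply.
Qed.
End QuasiBasis.
End ConditionalExpectation.

(** * Finite dimension of the relative commutant *)

Section FiniteDimension.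
Context {R : realType} {M : cstarAlgType R}.
Implicit Types (x y z : M) (r : R) (s t : R[i]).
Variables (C D : set M) (E : M -> M).
Hypotheses (H : expectation C D E) (CC : scalars C C).
Variables (m : nat) (l : 'I_m -> M) (c : R).
Hypotheses (qb : quasi_basis D E l) (qc : \sum_i l i * star (l i) = c%:C%:A).
Let DS : star_subalg D. Proof. by case: H => _ /cstar_star_subalg. Qed.
Local Notation N := (commutant C D).
Local Notation tau := (tau E).
Let NS := commutant_star_subalg H.

Lemma tau_eq0 x : N x -> tau (star x * x) = 0 -> x = 0.
Proof.
move=> Nx t0; have [Dx _] := Nx; apply: (ce_faithful H qb qc Dx).
by rewrite (tauE H CC) ?t0 ?scale0r//; apply: memM => //; exact: mem_star.
Qed.

Lemma tau_gt0 x : N x -> x != 0 -> 0 < tau (star x * x).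
Proof.
move=> Nx xn0; rewrite lt_def (tau_ge0 H CC)// andbT.
by apply: contra_neq xn0; exact: tau_eq0.
Qed.

Definition orthonormal k (d : 'I_k -> M) :=
  (forall i, N (d i)) /\ forall i j, tau (star (d i) * d j) = (i == j)%:R.

(* Bessel's inequality bounds [sum_i E (d_i d_i^* )] by [c], and each summand is at
   least [1 / c] by the Pimsner-Popa inequality. *)
Lemma orthonormal_bound k (d : 'I_k -> M) : orthonormal d -> k%:R <= c ^+ 2.
Proof.
move=> [Nd od]; have Dd i : D (d i) by have [] := Nd i.
have Ndd i j : N (star (d i) * d j) by apply: memM => //; exact: mem_star.
have Ndd' i : N (d i * star (d i)) by apply: memM => //; exact: mem_star.
have c1 := index_ge1 H qb qc.
have p : pos (c%:C%:A - \sum_i d i * star (d i)).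
  have := @bessel _ _ _ _ _ H _ _ _ qb qc k d 1 1 Dd.
  have -> : 2 * 1 - 1 ^+ 2 * 1 = 1 :> R by ring.
  rewrite rmorph1 scale1r; apply => i j.
  by rewrite (tauE H CC)// od mulr1.
have NT : N (\sum_i d i * star (d i)) by exact: mem_sum.
have N1 := mem1 NS.
have le1 : \sum_i tau (d i * star (d i)) <= c%:C.
  have Nc : N (c%:C%:A) by exact: memZ.
  rewrite -subr_ge0; apply: (@pos_scalar_ge0 _ M).
  have -> : c%:C - \sum_i tau (d i * star (d i)) =
      tau (c%:C%:A - \sum_i d i * star (d i)).
    by rewrite (tauB H CC)// (tauZ H CC)// (tau1 H) mulr1 (tau_sum H CC).
  have NB : N (c%:C%:A - \sum_i d i * star (d i)) by exact: memB.
  by rewrite -(tauE H CC)//; apply: (ce_pos H) => //; case: NB.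
have ge1 i : c^-1%:C <= tau (d i * star (d i)).
  have t0 : 0 <= tau (d i * star (d i)) by exact: (tau_ge0' H CC).
  have tp : 0 < tau (d i * star (d i)).
    rewrite -{1}(starK (d i)); apply: (tau_gt0); first exact: mem_star.
    apply: contra_eq_neq (od i i); move/(congr1 star); rewrite starK star0 => ->.
    by rewrite mulr0 (tau0 H) eqxx eq_sym oner_neq0.
  set t := tau _ in t0 tp *; have tE := ge0_Re t0.
  rewrite tE lecR; have tp' : 0 < complex.Re t by rewrite -ltcR -tE.
  have := pimsner_popa H qb qc tp' (mem_star DS (Dd i)).
  rewrite starK (tauE H CC)// -/t -tE => /(_ erefl) h.
  rewrite -[c^-1]mul1r ler_pdivrMr; last by lra.
  rewrite mulrC; apply: le_trans h.
  have := norm_pos (sa_starM (d i)) (lexx _).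
  set b := cnorm _ => /(ce_pos H _) h.
  have {h} : pos ((b%:C - 1)%:A : M).
    have -> : (b%:C - 1)%:A = E (b%:C%:A - star (d i) * d i).
      rewrite (ceB H) ?(ceZ H) ?(ce1 H) ?(tauE H CC) ?od ?eqxx ?scalerBl//.
      - exact: mem1.
      - by apply: memZ => //; exact: mem1.
      - by case: (Ndd i i).
    apply: h; apply: memB => //; first by apply: memZ => //; exact: mem1.
    by case: (Ndd i i).
  by move/pos_scalar_ge0; rewrite subr_ge0 -(rmorph1 (real_complex R)) lecR.
have : (c^-1 *+ k)%:C <= c%:C.
  apply: le_trans le1; rewrite -[k in X in X <= _]card_ord -sumr_const rmorph_sum.
  exact: ler_sum.
have -> : c^-1 *+ k = k%:R / c by rewrite mulr_natl.
by rewrite lecR ler_pdivrMr ?expr2//; lra.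
Qed.

Lemma tauJ x y : N x -> N y -> tau (star y * x) = conjc (tau (star x * y)).
Proof.
move=> Nx Ny; rewrite -(tau_star H CC) ?starM ?starK//.
by apply: memM => //; exact: mem_star.
Qed.

Lemma orthonormal_extend k (d : 'I_k -> M) y : orthonormal d -> N y -> y != 0 ->
    (forall i, tau (star (d i) * y) = 0) ->
  exists d' : 'I_k.+1 -> M, orthonormal d'.
Proof.
move=> [Nd od] Ny yn0 dy; have yp := tau_gt0 Ny yn0.
set t := tau _ in yp; have tE := ge0_Re (ltW yp).
have tp : 0 < complex.Re t by rewrite -ltcR -tE.
pose q := Num.sqrt (complex.Re t)^-1.
have qq : q * q = (complex.Re t)^-1 by rewrite -expr2 sqr_sqrtr// invr_ge0 ltW.
pose u := q%:C *: y.
have Nu : N u by exact: memZ.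
have Nsd i x : N x -> N (star (d i) * x).
  by move=> Nx; apply: memM => //; exact: mem_star.
have du i : tau (star (d i) * u) = 0.
  by rewrite /u -scalerAr (tauZ H CC) ?dy ?mulr0//; exact: Nsd.
exists (fun i => oapp d u (unlift ord_max i)); split.
  by move=> i; case: unliftP => [j _|_] //=.
move=> i j; case: (unliftP ord_max i) => [i' ->|->];
  case: (unliftP ord_max j) => [j' ->|->] //=.
- by rewrite od (inj_eq lift_inj).
- by rewrite du eq_sym (negbTE (neq_lift _ _)).
- by rewrite tauJ// du rmorph0 (negbTE (neq_lift _ _)).
- rewrite eqxx /u starZr -scalerAl -scalerAr scalerA -rmorphM/= qq (tauZ H CC).
    by rewrite -/t [X in _ * X]tE -rmorphM/= mulVf ?rmorph1// gt_eqF.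
  by apply: memM => //; exact: mem_star.
Qed.

(** Since the sizes of orthonormal families are bounded, a largest one exists; a nonzero residue of
    some [x] would extend it. *)
Lemma orthonormal_basis : exists k (d : 'I_k -> M), orthonormal d /\
  forall x, N x -> x = \sum_i tau (star (d i) * x) *: d i.
Proof.
pose P k := `[< exists d : 'I_k -> M, orthonormal d >].
have P0 : exists k, P k.
  exists 0%N; apply/asboolP; exists (fun _ => 0); split; first by case.
  by case.
have Pb k : P k -> (k <= Num.bound (c ^+ 2))%N.
  move=> /asboolP[d /orthonormal_bound h].
  rewrite -(ler_nat R); apply: le_trans h (ltW _).
  by apply: archi_boundP; exact: sqr_ge0.
have [k /asboolP[d od] kmax] := ex_maxnP P0 Pb.
exists k, d; split=> // x Nx; have [Nd odE] := od.
apply/eqP; rewrite -subr_eq0; apply/negP => /negP yn0.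
set y := x - _ in yn0.
have Ny : N y.
  by apply: memB => //; apply: mem_sum => // i _; exact: memZ.
have Nsd i z : N z -> N (star (d i) * z).
  by move=> Nz; apply: memM => //; exact: mem_star.
have dy i : tau (star (d i) * y) = 0.
  rewrite /y mulrBr mulr_sumr (tauB H CC) ?(tau_sum H CC).
  - rewrite (bigD1 i)//= big1 ?addr0 => [|j ji].
      rewrite -scalerAr (tauZ H CC); last exact: Nsd.
      by rewrite odE eqxx mulr1 subrr.
    rewrite -scalerAr (tauZ H CC) ?odE ?(negbTE ji) ?mulr0//; last exact: Nsd.
    by rewrite eq_sym (negbTE ji) mulr0.
  - by move=> j; apply: Nsd; exact: memZ.
  - exact: Nsd.
  - by apply: mem_sum => // j _; apply: Nsd; exact: memZ.
have [d' od'] := orthonormal_extend od Ny yn0 dy.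
have /kmax : P k.+1 by apply/asboolP; exists d'.
by rewrite ltnn.
Qed.

(** The [k + 1] powers [h^0, ..., h^k] have coordinate vectors of length [k], hence a linear
    relation. *)
Lemma commutant_algebraic h : N h -> exists2 p : {poly R[i]}, p != 0 &
  horner_alg h p = 0.
Proof.
move=> Nh; have [k [d [[Nd od] dE]]] := orthonormal_basis.
have Nhn j : N (h ^+ j) by exact: memX.
pose A := \matrix_(j < k.+1, i < k) tau (star (d i) * h ^+ j).
have : kermx A != 0.
  by rewrite -mxrank_eq0 mxrank_ker subn_eq0 -ltnNge ltnS rank_leq_col.
move=> /rowV0Pn[v /sub_kermxP vA vn0].
exists (\poly_(j < k.+1) v 0 (inord j)).
  apply: contra_neq vn0 => p0; apply/rowP => j; rewrite mxE.
  have := congr1 (fun p : {poly R[i]} => p`_j) p0.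
  by rewrite coef_poly ltn_ord coef0 inord_val.
rewrite poly_def raddf_sum /=.
have -> : \sum_(j < k.+1) horner_alg h (v 0 (inord j) *: 'X^j) =
    \sum_(j < k.+1) \sum_(i < k) (v 0 j * A j i) *: d i.
  apply: eq_bigr => j _; rewrite linearZ/= rmorphXn/= horner_algX inord_val.
  rewrite [h ^+ j]dE// mulr_algl scaler_sumr; apply: eq_bigr => i _.
  by rewrite scalerA mxE.
rewrite exchange_big /= big1 // => i _; rewrite -scaler_suml.
have := congr1 (fun B : 'rV_k => B 0 i) vA; rewrite !mxE => ->.
by rewrite scale0r.
Qed.
End FiniteDimension.

(** * Spectral decomposition *)

Section Spectral.
Context {R : realType} {M : cstarAlgType R}.
Implicit Types (x y z h : M) (r : R) (s t : R[i]) (p q : {poly R[i]}).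

Definition spectral_family (N : set M) k (a : 'I_k -> R) (f : 'I_k -> M) h :=
  [/\ forall i, N (f i) /\ projection (f i), forall i, f i != 0,
      forall i j, i != j -> f i * f j = 0,
      \sum_i f i = 1 & h = \sum_i (a i)%:C *: f i].

Lemma spectral_mul N k (a : 'I_k -> R) (f : 'I_k -> M) h i :
  spectral_family N a f h -> h * f i = (a i)%:C *: f i.
Proof.
move=> [fP _ ff _ ->]; rewrite mulr_suml (bigD1 i)//= big1 ?addr0 => [|j ji].
  by rewrite -scalerAl; have [_ [_ ->]] := fP i.
by rewrite -scalerAl ff// scaler0.
Qed.

Lemma spectral_mull N k (a : 'I_k -> R) (f : 'I_k -> M) h i :
  spectral_family N a f h -> f i * h = (a i)%:C *: f i.
Proof.
move=> [fP _ ff _ ->]; rewrite mulr_sumr (bigD1 i)//= big1 ?addr0 => [|j ji].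
  by rewrite -scalerAr; have [_ [_ ->]] := fP i.
by rewrite -scalerAr ff 1?eq_sym// scaler0.
Qed.

Lemma horner_algXB h a : horner_alg h ('X - a%:P) = h - a%:A.
Proof. by rewrite raddfB/= horner_algX horner_algC. Qed.

Lemma horner_algZ h a p : horner_alg h (a *: p) = a *: horner_alg h p.
Proof. by rewrite linearZ/= mulr_algl. Qed.

Lemma horner_alg_mem N h p : star_subalg N -> N h -> N (horner_alg h p).
Proof.
move=> NS Nh; rewrite /horner_alg /horner_morph.
rewrite horner_coef; apply: mem_sum => // i _; apply: memM => //; last exact: memX.
by rewrite coef_map /=; apply: memZ => //; exact: mem1.
Qed.

Lemma horner_alg_comm h p q : horner_alg h p * horner_alg h q =
  horner_alg h q * horner_alg h p.
Proof. by rewrite -!rmorphM mulrC. Qed.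

Lemma min_annihilator h p : p != 0 -> horner_alg h p = 0 ->
  exists q, [/\ q != 0, horner_alg h q = 0 &
    forall g : {poly R[i]}, g != 0 -> (size g < size q)%N -> horner_alg h g != 0].
Proof.
move=> pn0 hp.
pose P k := `[< exists q, [/\ q != 0, horner_alg h q = 0 & size q = k] >].
have P0 : exists k, P k by exists (size p); apply/asboolP; exists p.
have [k /asboolP[q [qn0 hq qk]] kmin] := ex_minnP P0.
exists q; split=> // g gn0 gq; apply/negP => /eqP hg.
have /kmin : P (size g) by apply/asboolP; exists g.
by rewrite leqNgt -qk gq.
Qed.

Lemma annihilator_factor q g a : q = g * ('X - a%:P) -> q != 0 ->
  g != 0 /\ (size g < size q)%N.
Proof.
move=> -> qn0; have gn0 : g != 0 by apply: contra_neq qn0 => ->; rewrite mul0r.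
by split=> //; rewrite size_Mmonic ?monicXsubC// size_XsubC addn2.
Qed.

(** The minimal annihilating polynomial of a self-adjoint [h] has real simple roots, and its
    Lagrange interpolation polynomials, evaluated at [h], are the spectral projections. *)
Lemma spectral N h p : star_subalg N -> N h -> sa h -> p != 0 ->
    horner_alg h p = 0 ->
  exists k (a : 'I_k -> R) (f : 'I_k -> M), spectral_family N a f h.
Proof.
move=> NS Nh sh pn0 hp.
have [q [qn0 hq qmin]] := min_annihilator pn0 hp.
(* By minimality [u = g(h)] is a nonzero eigenvector for [a]; [star u * h * u] is then both [a] and
   [conjc a] times [star u * u]. *)
have real_root g a : q = g * ('X - a%:P) -> conjc a = a.
  move=> qE; have [gn0 gq] := annihilator_factor qE qn0.
  have un0 := qmin _ gn0 gq; set u := horner_alg h g in un0.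
  have hu : h * u = a *: u.
    have : (h - a%:A) * u = 0.
      by rewrite -horner_algXB /u horner_alg_comm -rmorphM -qE.
    by rewrite mulrBl -scalerAl mul1r => /eqP; rewrite subr_eq0 => /eqP.
  have uu : star u * u != 0 by apply: contra_neq un0; exact: star_eq0.
  have h1 : star u * h * u = a *: (star u * u) by rewrite -mulrA hu -scalerAr.
  have h2 : star u * h * u = conjc a *: (star u * u).
    have := congr1 star h1; rewrite starZ !starM starK sh mulrA => ->.
    by [].
  apply/eqP; rewrite -subr_eq0; apply: contraTT uu => an0.
  rewrite negbK; have := scaler_eq0 (conjc a - a) (star u * u).
  by rewrite scalerBl -h1 -h2 subrr eqxx (negbTE an0) /= => <-.
(* For real [a], a double factor would give [v = (h - a) g(h)] with [star v * v = 0], because [q(h)]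
   occurs in the product; then a smaller polynomial annihilates [h]. *)
have simple_root g a : q <> g * ('X - a%:P) * ('X - a%:P).
  move=> qE; have [gn0 gq] := annihilator_factor qE qn0.
  have /eqP[] := qmin _ gn0 gq.
  have ra : conjc a = a by exact: real_root qE.
  have sah : star (h - a%:A) = h - a%:A by rewrite starB sh starZ star1 ra.
  apply: star_eq0; rewrite rmorphM/= horner_alg_comm horner_algXB starM sah.
  rewrite -mulrA -horner_algXB -!rmorphM/=.
  have -> : ('X - a%:P) * (('X - a%:P) * g) = q by rewrite qE; ring.
  by rewrite hq mulr0.
have [s qs] := closed_field_poly_normal q.
have lqn0 : lead_coef q != 0 by rewrite lead_coef_eq0.
have sfac a : a \in s ->
    q = (lead_coef q *: \prod_(z <- rem a s) ('X - z%:P)) * ('X - a%:P).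
  move=> as_; rewrite {1}qs (perm_big _ (perm_to_rem as_)) big_cons /=.
  by rewrite -scalerAl mulrC.
have us : uniq s.
  apply: count_mem_uniq => a; have [as_|as_] := boolP (a \in s); last first.
    by apply/eqP; rewrite -leqn0 leqNgt -has_count has_pred1.
  apply/eqP; rewrite (permP (perm_to_rem as_)) /= eqxx eqSS -leqn0 leqNgt.
  rewrite -has_count has_pred1; apply/negP => a2.
  have := sfac _ as_; rewrite (perm_big _ (perm_to_rem a2)) big_cons /=.
  rewrite [_ * \prod_(_ <- _) _]mulrC scalerAl; exact: simple_root.
have sreal a : a \in s -> a = (complex.Re a)%:C.
  move=> /sfac/real_root; case: a => a b /= [] h1; congr (_ +i* _); lra.
pose n := size s; pose a_ (i : 'I_n) := s`_i.
have as_ i : a_ i \in s by exact: mem_nth.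
have a_inj : injective a_.
  by move=> i j /eqP; rewrite nth_uniq// => /eqP/val_inj.
pose w (i : 'I_n) : R[i] := \prod_(z <- rem (a_ i) s) (a_ i - z).
pose L (i : 'I_n) : {poly R[i]} := (w i)^-1 *: \prod_(z <- rem (a_ i) s) ('X - z%:P).
have wn0 i : w i != 0.
  rewrite prodf_seq_neq0; apply/allP => z; rewrite mem_rem_uniq// inE => /andP[za _].
  by rewrite subr_eq0 eq_sym.
have size_rem i : size (\prod_(z <- rem (a_ i) s) ('X - z%:P)) = n.
  by rewrite size_prod_XsubC size_rem// prednK// /n; case: (s) (as_ i).
have sizeL i : (size (L i) <= n)%N.
  by rewrite (leq_trans (size_scale_leq _ _))// size_rem.
have sizeq : size q = n.+1 by rewrite qs size_scale// size_prod_XsubC.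
have Ln0 i : L i != 0.
  rewrite scaler_eq0 negb_or invr_eq0 wn0 /=.
  by rewrite -size_poly_gt0 size_rem /n; case: (s) (as_ i).
have Lii i : (L i).[a_ i] = 1.
  rewrite hornerZ horner_prod; under eq_bigr do rewrite hornerXsubC.
  by rewrite mulVf.
have Lij i j : i != j -> (L i).[a_ j] = 0.
  move=> ij; rewrite hornerZ (rootP _) ?mulr0// root_prod_XsubC.
  by rewrite mem_rem_uniq// inE as_ andbT (inj_eq a_inj) eq_sym.
(* The difference has size at most [n] and vanishes at the [n] distinct roots. The case [n = 0] is
   excluded because a nonzero constant cannot annihilate [h]. *)
have sumL : \sum_i L i = 1.
  apply/eqP; rewrite -subr_eq0; apply: contraT => Tn0.
  have n0 : (0 < n)%N.
    rewrite lt0n; apply: contraNneq (oner_neq0 M) => n0.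
    have /eqP := hq; rewrite qs (size0nil n0) big_nil horner_algZ rmorph1.
    by rewrite  scaler_eq0 (negbTE lqn0).
  have sr : all (root (\sum_i L i - 1)) s.
    apply/allP => z zs; have iz : (index z s < n)%N by rewrite index_mem.
    have -> : z = a_ (Ordinal iz) by rewrite /a_ /= nth_index.
    rewrite rootE hornerD hornerN hornerC horner_sum (bigD1 (Ordinal iz))//= Lii.
    by rewrite big1 ?addr0 ?subrr// => j ji; exact: Lij.
  have := max_poly_roots Tn0 sr us; rewrite ltnNge (leq_trans (size_polyD _ _))//.
  rewrite size_polyN size_poly1 geq_max n0 andbT.
  by apply: (big_ind (fun g : {poly R[i]} => size g <= n)%N) => [|x y hx hy|//];
    rewrite ?size_poly0// (leq_trans (size_polyD _ _))// geq_max hx.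
pose f i := horner_alg h (L i).
have fn0 i : f i != 0 by apply: qmin => //; rewrite sizeq ltnS.
have Nf i : N (f i) by exact: horner_alg_mem.
have hf i : h * f i = a_ i *: f i.
  have : (h - (a_ i)%:A) * f i = 0.
    rewrite /f horner_algZ -horner_algXB -scalerAr horner_alg_comm -rmorphM/=.
    have := hq; rewrite (sfac _ (as_ i)) -scalerAl horner_algZ => /eqP.
    by rewrite scaler_eq0 (negbTE lqn0) => /eqP ->; rewrite scaler0.
  by rewrite mulrBl -scalerAl mul1r => /eqP; rewrite subr_eq0 => /eqP.
have hfc i : f i * h = a_ i *: f i.
  by rewrite -hf -[X in _ * X](horner_algX h) horner_alg_comm horner_algX.
have sumf : \sum_i f i = 1 by rewrite -raddf_sum/= sumL rmorph1.
have ff i j : i != j -> f i * f j = 0.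
  move=> ij; have h1 : a_ i *: (f i * f j) = a_ j *: (f i * f j).
    by rewrite scalerAl -hfc -mulrA hf -scalerAr.
  apply/eqP; have := scaler_eq0 (a_ i - a_ j) (f i * f j).
  by rewrite scalerBl h1 subrr eqxx subr_eq0 (inj_eq a_inj) (negbTE ij) /= => <-.
have fi2 i : f i * f i = f i.
  have := mulr1 (f i); rewrite -sumf mulr_sumr (bigD1 i)//= big1 ?addr0// => j ji.
  by rewrite ff// eq_sym.
(* The eigenvalues being real, [star (f i)] belongs to the eigenvalue [a_ i] and is killed by every
   other [f j]. Hence [star (f i)] equals a self-adjoint element. *)
have sff i : f i * star (f i) = star (f i).
  have := mul1r (star (f i)); rewrite -sumf mulr_suml (bigD1 i)//= big1 ?addr0// => j ji.
  have h1 : a_ j *: (f j * star (f i)) = a_ i *: (f j * star (f i)).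
    rewrite scalerAl -hfc -mulrA -{1}sh -starM hfc starZ.
    by rewrite [a_ i]sreal// conjc_real -sreal// -scalerAr.
  apply/eqP; have := scaler_eq0 (a_ j - a_ i) (f j * star (f i)).
  by rewrite scalerBl h1 subrr eqxx subr_eq0 (inj_eq a_inj) (negbTE ji) /= => <-.
have sf i : star (f i) = f i.
  by have := congr1 star (sff i); rewrite starM starK sff.
exists n, (fun i => complex.Re (a_ i)), f; split=> //.
rewrite -[LHS]mulr1 -sumf mulr_sumr; apply: eq_bigr => i _.
by rewrite hf -sreal.
Qed.
End Spectral.

(** * Extremal expectations *)

Section Extremal.
Context {R : realType} {M : cstarAlgType R}.
Implicit Types (x y z a : M) (C D F : set M) (E G : M -> M).

(* The last clause is what minimality is used for.  Unlike minimality itself, it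
   visibly passes to composites and to dual expectations. *)
Definition extremal C D E (c : R) :=
  [/\ expectation C D E, scalars C C &
      exists m (l : 'I_m -> M), [/\ quasi_basis D E l,
        \sum_i l i * star (l i) = c%:C%:A &
        forall a, commutant C D a ->
          \sum_i l i * a * star (l i) = c%:C *: E a]].

Lemma quasi_basisP C D E m (l : 'I_m -> M) : expectation C D E ->
  (forall i, D (l i)) ->
  (forall x, D x -> \sum_i l i * E (star (l i) * x) = x) -> quasi_basis D E l.
Proof.
move=> H Dl h; have [_ /cstar_star_subalg DS _ _] := H.
split=> // x Dx; split; first by rewrite h.
rewrite -[LHS]starK -(h (star x)); last exact: mem_star.
rewrite star_sum; apply: eq_bigr => i _; rewrite starM -(ce_star H) ?starM ?starK//.
by apply: memM => //; apply: mem_star.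
Qed.

(** Multiplication by [d] acts on the quasi-basis through the coefficients
    [E (star (l i) * d * l j)]. They lie in [C], so they pass through [a] from one side to the
    other. *)
Lemma quasi_basis_commutant C D F E m (l : 'I_m -> M) a :
  expectation C D E -> quasi_basis D E l -> star_subalg F -> D `<=` F ->
  commutant C F a -> commutant D F (\sum_i l i * a * star (l i)).
Proof.
move=> H qb FS DF [Fa aC]; have [CS DC CD ce] := H.
have DS := cstar_star_subalg DC; have Dl := qb_mem qb.
have Dsl i : D (star (l i)) by exact: mem_star.
split.
  by apply: mem_sum => // i _; apply: memM => //; [apply: memM => //|]; exact: DF.
move=> d Dd.
have -> : (\sum_i l i * a * star (l i)) * d =
    \sum_i \sum_j l i * a * (E (star (l i) * (d * l j)) * star (l j)).
  rewrite mulr_suml; apply: eq_bigr => i _; rewrite -mulr_sumr.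
  rewrite -[in LHS]mulrA -{1}(qb2 qb (memM DS (Dsl i) Dd)); congr (_ * _).
  by apply: eq_bigr => j _; rewrite mulrA.
rewrite exchange_big /= mulr_sumr; apply: eq_bigr => j _.
rewrite !mulrA -[X in _ = X * _ * _](qb1 qb (memM DS Dd (Dl j))) !mulr_suml.
apply: eq_bigr => i _.
have Cij : C (E (star (l i) * (d * l j))).
  by apply: (ce_mem H); do 2 apply: memM => //.
by move: Cij; rewrite !mulrA; set b := E _ => Cb; rewrite -(mulrA (l i) a) aC// !mulrA.
Qed.

Lemma expectation_comp C D F E G : expectation C D E -> expectation D F G ->
  expectation C F (fun x => E (G x)).
Proof.
move=> HE HG; have [CS DC CD ceE] := HE; have [DS FC DF ceG] := HG.
have FS := cstar_star_subalg FC.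
split=> //; first by move=> x /CD/DF.
split.
- by move=> x Fx; apply: (ce_mem HE); exact: (ce_mem HG).
- by move=> a x y Fx Fy; rewrite (ce_lin HG)// (ce_lin HE)//; exact: (ce_mem HG).
- by move=> x Cx; rewrite (ce_id HG) ?(ce_id HE)//; exact: CD.
- move=> c x c' Cc Fx Cc'; case: ceG => GD _ _ -> //; [|exact: CD|exact: CD].
  by case: ceE => _ _ _ -> //; exact: GD.
- move=> x Fx; case: ceG => _ _ _ _ /(_ x Fx)[z Dz ->].
  by case: ceE => _ _ _ _ /(_ z Dz).
Qed.

(** The products [l' j * l i] form a quasi-basis of the composite. In the double sum the inner one,
    over [l], lands in the commutant of [D], where extremality of [G] applies; extremality of [E]
    then handles [G a]. *)
Lemma extremal_comp C D F E G c c' : extremal C D E c -> extremal D F G c' ->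
  extremal C F (fun x => E (G x)) (c * c').
Proof.
move=> [HE CC [m [l [qb qc qe]]]] [HG _ [m' [l' [qb' qc' qe']]]].
have HEG := expectation_comp HE HG; split=> //.
have [CS DC CD ceE] := HE; have [DS FC DF ceG] := HG.
have FS := cstar_star_subalg FC; have Dl := qb_mem qb; have Fl' := qb_mem qb'.
have Dsl i : D (star (l i)) by exact: mem_star.
have Fsl' i : F (star (l' i)) by exact: mem_star.
(* Quasi-bases are indexed by ordinals, so the pairs are enumerated. *)
pose T := ('I_m' * 'I_m)%type.
pose nu (k : 'I_#|{: T}|) := l' (enum_val k).1 * l (enum_val k).2.
have nuE (f : M -> M) : \sum_k f (nu k) = \sum_j \sum_i f (l' j * l i).
  rewrite pair_bigA /=; apply/esym.
  exact: (@big_enum_val _ _ _ _ predT (fun p : T => f (l' p.1 * l p.2))).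
have Fnu k : F (nu k) by apply: memM => //; exact: DF.
exists #|{: T}|, nu; split.
- apply: (quasi_basisP HEG Fnu) => x Fx.
  rewrite (nuE (fun y => y * E (G (star y * x)))).
  rewrite -[RHS](qb1 qb' Fx); apply: eq_bigr => j _.
  have DG : D (G (star (l' j) * x)) by apply: (ce_mem HG); exact: memM.
  rewrite -[X in _ = _ * X](qb1 qb DG) mulr_sumr; apply: eq_bigr => i _.
  by rewrite starM -[in LHS](mulrA (star (l i))) (ceMl HG) ?mulrA//; exact: memM.
- rewrite (nuE (fun y => y * star y)).
  have -> : (c * c')%:C%:A = \sum_j c%:C *: (l' j * star (l' j)).
    by rewrite -scaler_sumr qc' rmorphM scalerA.
  apply: eq_bigr => j _.
  have -> : c%:C *: (l' j * star (l' j)) = l' j * c%:C%:A * star (l' j) by ncring.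
  rewrite -qc mulr_sumr mulr_suml; apply: eq_bigr => i _.
  by rewrite starM !mulrA.
- move=> a [Fa aC].
  rewrite (nuE (fun y => y * a * star y)).
  have Ng : commutant D F (\sum_i l i * a * star (l i)).
    exact: (quasi_basis_commutant HE qb FS DF).
  have -> : \sum_j \sum_i (l' j * l i) * a * star (l' j * l i) =
      \sum_j l' j * (\sum_i l i * a * star (l i)) * star (l' j).
    apply: eq_bigr => j _; rewrite mulr_sumr mulr_suml; apply: eq_bigr => i _.
    by rewrite starM !mulrA.
  rewrite qe'// (ce_sum HG) => [|i]; last first.
    by apply: memM => //; [apply: memM => //|]; exact: DF.
  have Fla i : F (l i * a) by apply: memM => //; exact: DF.
  under eq_bigr => i _ do rewrite (ceMr HG)// (ceMl HG)//.
  rewrite qe ?scalerA -?rmorphM 1?mulrC//; split; first exact: (ce_mem HG).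
  by move=> x Cx; have Dx := CD _ Cx; rewrite -(ceMr HG)// -(ceMl HG)// aC.
Qed.

Section Trace.
Variables (C D : set M) (E : M -> M) (c : R).
Hypothesis X : extremal C D E c.
Local Notation N := (commutant C D).

(* [theta x = sum_i l_i E (x l_i^* )] is the modular automorphism of [E] on the
   relative commutant: [E (x y) = E (y theta(x))].  For the functional
   [a |-> sum_i l_i a l_i^*] it has to be replaced by its inverse, so that the
   two being proportional gives [theta^2 = 1]; being positive, theta is 1. *)
Lemma extremal_trace x y : N x -> D y -> E (x * y) = E (y * x).
Proof.
have [H CC [m [l [qb qc qe]]]] := X; have [CS DC CD ce] := H.
have DS := cstar_star_subalg DC; have Dl := qb_mem qb; have Dsl := qb_smem H qb.
have NS := commutant_star_subalg H; have c1 := index_ge1 H qb qc.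
pose theta x := \sum_i l i * E (x * star (l i)).
have Dtheta z : D z -> D (theta z).
  move=> Dz; apply: mem_sum => // i _; apply: memM => //; apply: (ce_memD H).
  exact: memM.
(* After expanding [w], the coefficients [E (w * l i)] lie in [C] and move past [z]. *)
have thetaE z w : N z -> D w -> E (z * w) = E (w * theta z).
  move=> [Dz zC] Dw; rewrite -{1}(qb2 qb Dw) mulr_sumr (ce_sum H); last first.
    move=> i; apply: memM => //; apply: memM => //; apply: (ce_memD H).
    exact: memM.
  rewrite /theta mulr_sumr (ce_sum H); last first.
    move=> i; apply: memM => //; apply: memM => //; apply: (ce_memD H).
    exact: memM.
  apply: eq_bigr => i _.
  have C1 : C (E (w * l i)) by apply: (ce_mem H); exact: memM.
  have C2 : C (E (z * star (l i))) by apply: (ce_mem H); exact: memM.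
  have D1 : D (w * l i) by exact: memM.
  have D2 : D (z * star (l i)) by exact: memM.
  by rewrite (mulrA z) (zC _ C1) -(mulrA (E _) z) (ceMl H)// (mulrA w) (ceMr H C2 D1).
have nondeg w : D w -> (forall y, D y -> E (y * w) = 0) -> w = 0.
  by move=> Dw h; apply: (ce_faithful H qb qc Dw); apply: h; exact: mem_star.
have Ntheta z : N z -> N (theta z).
  move=> Nz; have [Dz zC] := Nz; have Dt := Dtheta _ Dz; split=> // b Cb.
  have Db := CD _ Cb.
  apply/eqP; rewrite -subr_eq0; apply/eqP; apply: nondeg.
    by apply: memB => //; exact: memM.
  move=> u Du; have Dub : D (u * b) by exact: memM.
  rewrite mulrBr (ceB H); [|by do 2 (apply: memM => //)..].
  rewrite !mulrA (ceMr H Cb (memM DS Du Dt)) -(thetaE z u)// -(thetaE z (u * b))//.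
  by rewrite mulrA (ceMr H Cb (memM DS Dz Du)) subrr.
(* Extremality replaces [c E] by the quasi-basis sum, for which [theta] shifts factors the opposite
   way. Combined with [thetaE] it gives [E (a * z) = E (a * theta (theta z))]. *)
have GE z a : N z -> N a -> E (a * z) = E (theta z * a).
  move=> Nz Na; have [Dz zC] := Nz; have [Da aC] := Na; have Dt := Dtheta _ Dz.
  have cn0 : c%:C != 0 :> R[i] by rewrite fmorph_eq0; apply: lt0r_neq0; lra.
  apply: (scalerI cn0); rewrite -(qe _ (memM NS Na Nz)).
  rewrite -(qe _ (memM NS (Ntheta _ Nz) Na)).
  have -> : \sum_i l i * (a * z) * star (l i) =
      \sum_i \sum_j l i * a * (E (z * star (l i) * l j) * star (l j)).
    apply: eq_bigr => i _; rewrite -mulr_sumr (qb2 qb); last exact: memM.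
    by rewrite !mulrA.
  rewrite exchange_big /=; apply: eq_bigr => j _.
  have Dtj : D (l j * theta z) by exact: memM.
  rewrite mulrA -[in RHS](qb1 qb Dtj) !mulr_suml; apply: eq_bigr => i _.
  have D1 : D (star (l i) * l j) by exact: memM.
  have C1 : C (E (star (l i) * l j * theta z)).
    by apply: (ce_mem H); exact: memM.
  by rewrite -(mulrA z) thetaE// !mulrA -(mulrA (l i)) aC// mulrA.
have theta2 z : N z -> theta (theta z) = z.
  move=> Nz; have Nt := Ntheta _ Nz; have Ntt := Ntheta _ Nt.
  apply/eqP; rewrite -subr_eq0; apply/eqP.
  set w := _ - z; have Nw : N w by exact: memB.
  have [Dw _] := Nw; apply: (ce_faithful H qb qc Dw).
  have Nsw : N (star w) by exact: mem_star.
  have [Dsw _] := Nsw; have [Dtt _] := Ntt; have [Dz _] := Nz.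
  rewrite /w mulrBr -/w (ceB H); [|exact: memM|exact: memM].
  by rewrite -thetaE// -GE// subrr.
have theta1 z : N z -> theta z = z.
  move=> Nz; have Nt := Ntheta _ Nz; have [Dt _] := Nt; have [Dz _] := Nz.
  apply/esym/eqP; rewrite -subr_eq0; apply/eqP.
  set w := z - theta z; have Nw : N w by exact: memB.
  have [Dw _] := Nw; have Dsw := mem_star DS Dw; have Nsw : N (star w) by exact: mem_star.
  (* On such a [w], [thetaE] gives [E (w * star w) = - E (star w * w)]; both expectations are
     nonnegative scalars, so [w = 0]. *)
  have tw : theta w = - w.
    rewrite opprB -[X in _ - X](theta2 _ Nz) /w /theta -sumrB.
    apply: eq_bigr => i _; rewrite mulrBl (ceB H) ?mulrBr//.
      exact: memM.
    by apply: memM.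
  have h := thetaE w (star w) Nw Dsw.
  apply: (tau_eq0 H CC qb qc Nw); apply/eqP; rewrite eq_le (tau_ge0 H CC Nw) andbT.
  have : tau E (w * star w) = - tau E (star w * w).
    rewrite /tau h tw mulrN (ceN H) ?(tauE H CC) ?scalar_ofA -?scaleNr ?scalar_ofA//.
      by apply: memM.
    by apply: memM.
  by have := tau_ge0' H CC Nw => /[swap] ->; rewrite oppr_ge0.
by move=> Nx Dy; rewrite thetaE// theta1.
Qed.
End Trace.
End Extremal.

(** * The basic construction and the dual expectation *)

Section BasicConstruction.
Context {R : realType} {M : cstarAlgType R}.
Implicit Types (x y z a : M).
Variables (C D D1 : set M) (E E1 : M -> M) (e : M) (c : R).
Hypotheses (H : expectation C D E) (bc : basic_construction C D E D1 e).
Hypotheses (D1C : cstar_subalgebra D1) (ce1 : cond_exp D D1 E1).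
Hypothesis E1E : forall x y, D x -> D y -> E1 (x * e * y) = (c^-1)%:C *: (x * y).
Let CD : C `<=` D. Proof. by case: H. Qed.
Let DS : star_subalg D. Proof. by case: H => _ /cstar_star_subalg. Qed.
Let D1S : star_subalg D1. Proof. exact: cstar_star_subalg. Qed.
Let DD1 : D `<=` D1. Proof. by case: bc. Qed.

Lemma dual_expectation : expectation D D1 E1.
Proof. by split. Qed.
Let H1 := dual_expectation.

Lemma jones_proj : projection e. Proof. by case: bc. Qed.
Let se : star e = e. Proof. by case: jones_proj. Qed.
Let ee : e * e = e. Proof. by case: jones_proj. Qed.

Lemma jones_mem : D1 e.
Proof.
case: bc => _ _ _ ->; exists 1%N, (fun _ => 1), (fun _ => 1).
by split; [move=> _; exact: mem1..|rewrite big_ord1 mul1r mulr1].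
Qed.

Lemma jones_span z : D1 z -> exists m (x y : 'I_m -> M),
  [/\ forall i, D (x i), forall i, D (y i) & z = \sum_i x i * e * y i].
Proof. by case: bc => _ _ _ ->. Qed.

(** Faithfulness is put in the form used below: an identity in [D1] is checked by letting both sides
    act on [D]. *)
Lemma jones_rep : exists pi : M -> M -> M,
  [/\ [/\ forall d x, D1 d -> D x -> D (pi d x),
        forall d d' x, D1 d -> D1 d' -> D x -> pi (d * d') x = pi d (pi d' x),
        forall (t : R[i]) d x, D1 d -> D x -> pi (t *: d) x = t *: pi d x
      & forall m (d : 'I_m -> M) x, (forall i, D1 (d i)) -> D x ->
          pi (\sum_i d i) x = \sum_i pi (d i) x],
      forall d d', D1 d -> D1 d' -> (forall x, D x -> pi d x = pi d' x) -> d = d',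
      forall d x, D d -> D x -> pi d x = d * x
    & forall x, D x -> pi e x = E x].
Proof.
case: bc => _ _ [pi [piD pil piM _ [pi0 piD' pie]]] _; exists pi.
have piZ0 x : D x -> pi 0 x = 0.
  by move=> Dx; rewrite piD' ?mul0r//; exact: mem0.
have piZ (t : R[i]) d x : D1 d -> D x -> pi (t *: d) x = t *: pi d x.
  by move=> Dd Dx; have := pil t d 0 x Dd (mem0 D1S) Dx; rewrite piZ0// !addr0.
have pi_add d d' x : D1 d -> D1 d' -> D x -> pi (d + d') x = pi d x + pi d' x.
  by move=> Dd Dd' Dx; have := pil 1 d d' x Dd Dd' Dx; rewrite !scale1r.
split=> //; first split=> //.
- move=> m d x Dd Dx.
  suff [] : D1 (\sum_i d i) /\ pi (\sum_i d i) x = \sum_i pi (d i) x by [].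
  elim/big_ind2: _ => [|a b a' b' [Da <-] [Da' <-]|i _].
  - by split; [exact: mem0|exact: piZ0].
  - by split; [exact: memD|exact: pi_add].
  - by split.
- move=> d d' Dd Dd' h; apply/eqP; rewrite -subr_eq0; apply/eqP; apply: pi0.
    exact: memB.
  move=> x Dx; have D1N := memZ D1S (-1) Dd'.
  by rewrite -scaleN1r pi_add// piZ// h// scaleN1r subrr.
Qed.

Lemma jones_comm b : C b -> e * b = b * e.
Proof.
move=> Cb; have Db := CD Cb; have De := jones_mem; have D1b := DD1 Db.
have [pi [[piD piM _ _] piI piL pie]] := jones_rep.
apply: piI; [exact: memM..|] => x Dx.
have Dbx : D (b * x) by exact: memM.
have DEx := ce_memD H Dx.
by rewrite !piM// (piL b x)// (pie x)// (pie (b * x))// piL// (ceMl H).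
Qed.

Lemma jones_sandwich a : D a -> e * a * e = E a * e.
Proof.
move=> Da; have De := jones_mem; have D1a := DD1 Da.
have DEa := ce_memD H Da; have D1Ea := DD1 DEa.
have [pi [[piD piM _ _] piI piL pie]] := jones_rep.
have D1ea : D1 (e * a) by exact: memM.
apply: piI; [exact: memM..|] => x Dx.
have DEx := ce_memD H Dx; have CEx := ce_mem H Dx.
have DaEx : D (a * E x) by exact: memM.
rewrite (piM (e * a) e)// (piM (E a) e)// (pie x)// (piM e a)// (piL a)//.
by rewrite (pie (a * _))// (piL (E a))// (ceMr H).
Qed.

(** Acting on [x], the left side is the quasi-basis expansion of [x]. *)
Lemma jones_sum m (l : 'I_m -> M) : quasi_basis D E l ->
  \sum_i l i * e * star (l i) = 1.
Proof.
move=> qb; have De := jones_mem; have [pi [[piD piM _ piS] piI piL pie]] := jones_rep.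
have Dl := qb_mem qb; have D1l i := DD1 (Dl i).
have Dsl := qb_smem H qb; have D1sl i := DD1 (Dsl i).
have D1le i : D1 (l i * e * star (l i)) by do 2 (apply: memM => //).
apply: piI; [exact: mem_sum|exact: mem1|] => x Dx.
rewrite piS// piL//; last exact: mem1.
rewrite mul1r -[RHS](qb1 qb Dx); apply: eq_bigr => i _.
have Dsx : D (star (l i) * x) by exact: memM.
have DEsx := ce_memD H Dsx.
have D1e : D1 (l i * e) by exact: memM.
by rewrite (piM _ (star (l i)))// (piM (l i) e) ?(piL (star (l i)))// pie// piL.
Qed.

Lemma jones_exp : E1 e = (c^-1)%:C%:A.
Proof. by have := E1E (mem1 DS) (mem1 DS); rewrite !mul1r mulr1. Qed.

(** Push-down: [z * e] already lies in [D e], since [e * y * e = E y * e] for [y] in [D]. *)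
Lemma jones_pushr z : D1 z -> E1 (z * e) * e = (c^-1)%:C *: (z * e).
Proof.
move=> /jones_span[m [x [y [Dx Dy ->]]]]; have De := jones_mem.
have zE : (\sum_i x i * e * y i) * e = (\sum_i x i * E (y i)) * e.
  rewrite !mulr_suml; apply: eq_bigr => i _.
  by rewrite -mulrA -mulrA (mulrA e) jones_sandwich// mulrA.
have Ds : D (\sum_i x i * E (y i)).
  by apply: mem_sum => // i _; apply: memM => //; exact: (ce_memD H).
rewrite zE; have := E1E Ds (mem1 DS); rewrite !mulr1 => ->.
by rewrite -scalerAl.
Qed.

Lemma jones_pushl z : D1 z -> e * E1 (e * z) = (c^-1)%:C *: (e * z).
Proof.
move=> D1z; have De := jones_mem; have D1sz := mem_star D1S D1z.
have := congr1 star (jones_pushr D1sz); rewrite starZr !starM se starK => <-.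
by rewrite -(ce_star H1) ?starM ?se ?starK//; exact: memM.
Qed.

Section Dual.
Variables (m : nat) (l : 'I_m -> M).
Hypotheses (qb : quasi_basis D E l) (qc : \sum_i l i * star (l i) = c%:C%:A).
Let Dl := qb_mem qb.
Let Dsl := qb_smem H qb.
Let c0 : 0 < c. Proof. by have := index_ge1 H qb qc; lra. Qed.
Let q := Num.sqrt c.
Let qq : q * q = c. Proof. by rewrite -expr2 sqr_sqrtr// ltW. Qed.
Let ccV (x : M) : c%:C *: ((c^-1)%:C *: x) = x.
Proof. by rewrite scalerA -rmorphM/= mulfV ?rmorph1 ?scale1r// gt_eqF. Qed.
(** The quasi-basis of the dual expectation; the factor [sqrt c] compensates [E1 e = c^-1] and keeps
    the index equal to [c]. *)
Let mu i := q%:C *: (l i * e).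

Let smu i : star (mu i) = q%:C *: (e * star (l i)).
Proof. by rewrite /mu starZr starM se. Qed.

Let muE a : \sum_i mu i * a * star (mu i) = c%:C *: \sum_i l i * (e * a * e) * star (l i).
Proof.
rewrite scaler_sumr; apply: eq_bigr => i _.
by rewrite smu -qq rmorphM /mu; ncring.
Qed.

Lemma dual_quasi_basis : quasi_basis D1 E1 mu.
Proof.
have De := jones_mem.
apply: (quasi_basisP H1) => [i|x D1x].
  by apply: memZ => //; apply: memM => //; exact: DD1.
rewrite -[RHS]mul1r -(jones_sum qb) mulr_suml; apply: eq_bigr => i _.
have D1s : D1 (star (l i) * x) by apply: memM => //; exact: DD1.
have -> : star (mu i) * x = q%:C *: (e * (star (l i) * x)).
  by rewrite smu -scalerAl mulrA.
rewrite (ceZ H1); last exact: memM.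
rewrite /mu -scalerAl -scalerAr scalerA -rmorphM/= qq -!mulrA jones_pushl//.
by rewrite -scalerAr ccV.
Qed.

Lemma dual_index : \sum_i mu i * star (mu i) = c%:C%:A.
Proof.
have := muE 1; under eq_bigr => i _ do rewrite mulr1; move=> ->.
by rewrite mulr1 ee -(jones_sum qb); congr (_ *: _); apply: eq_bigr => i _; rewrite !mulrA.
Qed.

Lemma relcomm_push a : commutant C D1 a ->
  commutant C D (E1 (a * e)) /\ a * e = c%:C *: (E1 (a * e) * e).
Proof.
move=> [D1a aC]; have De := jones_mem; have D1ae : D1 (a * e) by exact: memM.
split; last by rewrite jones_pushr// ccV.
split; first exact: (ce_mem H1).
move=> b Cb; have Db := CD Cb.
by rewrite -(ceMl H1)// -(ceMr H1)// -mulrA jones_comm// mulrA aC// mulrA.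
Qed.

Lemma sandwich_push a : commutant C D1 a ->
  e * a * e = c%:C *: (E (E1 (a * e)) * e).
Proof.
move=> Na; have [[Dg _] aE] := relcomm_push Na.
by rewrite -mulrA {1}aE -scalerAr mulrA jones_sandwich.
Qed.

(** For [a] commuting with [D], put [g = E1 (a * e)], which has a scalar trace. The sum over [mu]
    equals [c^2] times that trace, because [e * a * e] is a multiple of [e]; and [E1 a] is the sum
    of the [l i * g * star (l i)], which extremality of [E] evaluates to [c] times it. *)
Lemma dual_extremal : scalars C C -> scalars D D ->
  (forall a, commutant C D a -> \sum_i l i * a * star (l i) = c%:C *: E a) ->
  extremal D D1 E1 c.
Proof.
move=> CC DDs qe; split=> //; exists m, mu; split.
- exact: dual_quasi_basis.
- exact: dual_index.
move=> a [D1a aD]; have De := jones_mem.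
have Na : commutant C D1 a by split=> // b Cb; apply: aD; exact: CD.
have [Ng aE] := relcomm_push Na; have [Dg _] := Ng.
rewrite muE sandwich_push// (tauE H CC Ng).
have -> : E1 a = \sum_i l i * E1 (a * e) * star (l i).
  rewrite -[a in LHS]mulr1 -(jones_sum qb) mulr_sumr (ce_sum H1) => [|i]; last first.
    by apply: memM => //; apply: memM => //; [apply: memM => //|]; exact: DD1.
  apply: eq_bigr => i _.
  rewrite !mulrA aD// -(mulrA (l i)) {1}aE -scalerAr -scalerAl.
  have D2 : D (l i * E1 (a * e)) by exact: memM.
  have D3 : D1 (l i * (E1 (a * e) * e) * star (l i)).
    by apply: memM; [|apply: memM; [|exact: DD1|apply: memM => //; exact: DD1]|exact: DD1].
  by rewrite (ceZ H1)// mulrA E1E// ccV.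
rewrite (qe _ Ng) (tauE H CC Ng); congr (_ *: _).
have -> : \sum_i l i * (c%:C *: ((tau E (E1 (a * e)))%:A * e)) * star (l i) =
   (c%:C * tau E (E1 (a * e))) *: \sum_i l i * e * star (l i).
  by rewrite scaler_sumr; apply: eq_bigr => i _; ncring.
by rewrite (jones_sum qb) scalerA.
Qed.

(** A central [z] satisfies [z * e = e * z * e], a scalar multiple of [e] by push-down; the
    resolution of 1 in [jones_sum] extends the scalar to [z]. *)
Lemma dual_scalars : scalars C C -> scalars D1 D1.
Proof.
move=> CC z [D1z zD]; have De := jones_mem.
have Nz : commutant C D1 z by split=> // b Cb; apply: zD; apply: DD1; exact: CD.
have [Ng _] := relcomm_push Nz.
have ze : z * e = (c%:C * tau E (E1 (z * e))) *: e.
  have : e * z * e = z * e by rewrite -zD// -mulrA ee.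
  by rewrite sandwich_push// (tauE H CC Ng) => h; rewrite -[LHS]h; ncring.
move: (c%:C * tau E (E1 (z * e))) ze => t ze; exists t.
rewrite -[LHS]mulr1 -(jones_sum qb) mulr_sumr scaler_sumr; apply: eq_bigr => i _.
by rewrite !mulrA (zD _ (DD1 (Dl i))) -(mulrA (l i) z) ze; ncring.
Qed.
End Dual.
End BasicConstruction.

(** * From minimality to extremality *)

Section Minimal.
Context {R : realType} {M : cstarAlgType R}.
Implicit Types (x y z a f : M).

(** The right-hand side takes its minimum [c] at [u = 1], so its derivative there, [c p - t],
    vanishes. *)
Lemma stationary_product (c p t : R) :
  (forall u, 0 < u -> c <= (1 + (u - 1) * p) * (c + (u^-1 - 1) * t)) -> t = c * p.
Proof.
move=> h; pose A := p * c - t; pose B := p * (c - t).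
have key v : -1 < v -> 0 <= v * (A + v * B).
  move=> v1; have u0 : 0 < 1 + v by lra.
  have := h _ u0; rewrite -subr_ge0 => h1.
  have := mulr_ge0 (ltW u0) h1.
  have -> : (1 + v) * ((1 + (1 + v - 1) * p) * (c + ((1 + v)^-1 - 1) * t) - c) =
    v * (A + v * B) by rewrite /A /B; field; rewrite gt_eqF.
  by [].
have A0 : 0 <= A.
  rewrite leNgt; apply/negP => An.
  have B0 := normr_ge0 B; have Bn := ler_norm B.
  pose v := - A / (`|B| + 1) / 2.
  have v0 : 0 < v by rewrite /v !divr_gt0//; lra.
  have vB : v * (`|B| + 1) = - A / 2 by rewrite /v; field; lra.
  have := key v; have : v * B <= v * `|B| by rewrite ler_wpM2l// ltW.
  move=> h1 h2; have {}h2 : 0 <= _ := h2 ltac:(lra).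
  have : A + v * B < 0 by lra.
  by rewrite -(pmulr_rlt0 _ v0); lra.
have A1 : A <= 0.
  rewrite leNgt; apply/negP => An.
  have B0 := normr_ge0 B; have Bn := ler_norm B.
  (* The summand [A] in the denominator keeps [v < 1], so that [u = 1 - v] is still positive. *)
  pose v := A / (A + `|B| + 1) / 2.
  have d0 : 0 < A + `|B| + 1 by lra.
  have v0 : 0 < v by rewrite /v !divr_gt0.
  have vB : v * (A + `|B| + 1) = A / 2 by rewrite /v; field; rewrite gt_eqF.
  have v1 : v < 1.
    by rewrite ltNge; apply/negP => v1; have := ler_wpM2r (ltW d0) v1; lra.
  have := key (- v); have : v * B <= v * `|B| by rewrite ler_wpM2l// ltW.
  move=> h1 h2; have {}h2 : 0 <= _ := h2 ltac:(lra).
  have vA : 0 < v * A by rewrite mulr_gt0.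
  have : 0 < A + - v * B by lra.
  by rewrite -(pmulr_rgt0 _ v0); lra.
rewrite /A in A0 A1; lra.
Qed.

Variables (C D : set M) (E : M -> M) (c : R).
Hypotheses (H : expectation C D E) (CC : scalars C C) (DD : scalars D D).
Hypothesis minE : minimal_cond_exp C D E c.
Local Notation N := (commutant C D).

(* [x |-> E (k x k)], with [k k' = 1], has quasi-basis [l_i k']. *)
Lemma perturbed_index m (l : 'I_m -> M) k k' (n t : R) :
  quasi_basis D E l -> N k -> N k' -> sa k -> sa k' -> k * k' = 1 -> k' * k = 1 ->
  0 < n -> E (k * k) = n%:C%:A ->
  \sum_i l i * (k' * k') * star (l i) = t%:C%:A -> c <= n * t.
Proof.
move=> qb [Dk kC] [Dk' k'C] sk sk' kk' k'k n0 En st.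
have [CS DC CD ce] := H; have DS := cstar_star_subalg DC; have D1 := mem1 DS.
have [_ min] := minE; have Dl := qb_mem qb.
pose E' x := (n^-1)%:C *: E (k * x * k).
have Dkk x : D x -> D (k * x * k) by move=> Dx; do 2 (apply: memM => //).
have n1 : (n^-1)%:C * n%:C = 1 :> R[i].
  by rewrite -rmorphM/= mulVf ?rmorph1// gt_eqF.
have HE' : expectation C D E'.
  split=> //; split.
  - by move=> x Dx; apply: memZ => //; apply: (ce_mem H); exact: Dkk.
  - move=> a x y Dx Dy; rewrite /E'.
    have -> : k * (a *: x + y) * k = a *: (k * x * k) + k * y * k by ncring.
    by rewrite (ce_lin H); [ncring|exact: Dkk..].
  - move=> x Cx; rewrite /E' kC// -mulrA (ceMl H)//; last exact: memM.
    by rewrite En -scalerAr mulr1 scalerA n1 scale1r.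
  - move=> x y z Cx Dy Cz; rewrite /E'.
    have -> : k * (x * y * z) * k = x * (k * y * k) * z.
      by rewrite !mulrA kC// -!mulrA -(kC z).
    rewrite (ceMr H Cz); last by apply: memM => //; [exact: CD|exact: Dkk].
    by rewrite (ceMl H Cx (Dkk _ Dy)); ncring.
  - move=> x Dx; case: ce => _ _ _ _ /(_ (x * k) (memM DS Dx Dk))[z Cz zE].
    exists ((Num.sqrt n^-1)%:C *: z); first exact: memZ.
    rewrite starZr -scalerAl -scalerAr scalerA -rmorphM/= -expr2 sqr_sqrtr ?invr_ge0 1?ltW//.
    by rewrite -zE starM sk /E' !mulrA.
pose q := Num.sqrt n; have qq : q * q = n by rewrite -expr2 sqr_sqrtr// ltW.
pose l' i := q%:C *: (l i * k').
have Dl' i : D (l' i) by apply: memZ => //; exact: memM.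
have sl' i : star (l' i) = q%:C *: (k' * star (l i)) by rewrite /l' starZr starM sk'.
apply: (min E'); split; first by case: HE'.
exists m, l'; split.
  apply: (quasi_basisP HE' Dl') => x Dx.
  have Dxk : D (x * k) by exact: memM.
  rewrite -[RHS]mulr1 -kk' mulrA -{1}(qb1 qb Dxk) mulr_suml; apply: eq_bigr => i _.
  have D2 : D (star (l i) * (x * k)) by apply: memM => //; apply: mem_star.
  rewrite /E' sl'.
  have -> : k * (q%:C *: (k' * star (l i)) * x) * k =
      q%:C *: ((k * k') * (star (l i) * (x * k))) by ncring.
  rewrite kk' mul1r (ceZ H)// /l'; have kE := k'C _ (ce_mem H D2).
  set X := E _ in kE *.
  have -> : q%:C *: (l i * k') * ((n^-1)%:C *: (q%:C *: X)) =
      (n^-1 * (q * q))%:C *: (l i * (k' * X)) by ncring.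
  by rewrite kE mulrA qq rmorphM/= n1 scale1r.
transitivity (n%:C *: \sum_i l i * (k' * k') * star (l i)); last first.
  by rewrite st scalerA -rmorphM.
rewrite scaler_sumr; apply: eq_bigr => i _.
by rewrite sl' /l' -qq; ncring.
Qed.

(** Both sides are scalars, say [s] and [c p]. Perturbing by [k = 1 - f + sqrt u f] gives an
    expectation of index [(1 + (u - 1) p) (c + (u^-1 - 1) s)], and minimality makes [u = 1]
    stationary. *)
Lemma projection_sum m (l : 'I_m -> M) f : quasi_basis D E l ->
  \sum_i l i * star (l i) = c%:C%:A -> N f -> projection f ->
  \sum_i l i * f * star (l i) = c%:C *: E f.
Proof.
move=> qb qc Nf [sf ff]; have [CS DC CD ce] := H.
have DS := cstar_star_subalg DC; have NS := commutant_star_subalg H.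
have [t tE] := DD (quasi_basis_commutant H qb DS (fun _ h => h) Nf).
have pt : pos (\sum_i l i * f * star (l i)).
  apply: pos_sum => i.
  have -> : l i * f * star (l i) = (l i * f) * star (l i * f).
    by rewrite starM sf !mulrA -(mulrA (l i) f f) ff.
  exact: mul_star_pos.
have t0 : 0 <= t by apply: (@pos_scalar_ge0 _ M); rewrite -tE.
have p0 : 0 <= tau E f by apply: (tau_proj_ge0 H CC).
have N1 := mem1 NS; have Ng : N (1 - f) by exact: memB.
have p1 : tau E f <= 1.
  rewrite -subr_ge0 -(tau1 H) -(tauB H CC)//; apply: (tau_proj_ge0 H CC) => //.
  split; first by rewrite starB star1 sf.
  have -> : (1 - f) * (1 - f) = 1 - f - f + f * f by ncring.
  by rewrite ff subrK.
have pE := tauE H CC Nf; move: tE pE; rewrite (ge0_Re t0) (ge0_Re p0).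
move: (Re_ge0 p0); move: p1; rewrite {1}(ge0_Re p0) -(rmorph1 (real_complex R)) lecR.
move: (complex.Re t) (complex.Re _) => s p p1 {}p0 sE pE.
rewrite sE pE scalerA -rmorphM/=; congr (_%:C%:A).
apply: stationary_product => u u0.
pose q := Num.sqrt u; have q0 : 0 < q by rewrite sqrtr_gt0.
have qq : q * q = u by rewrite -expr2 sqr_sqrtr// ltW.
have qV : q * q^-1 = 1 by rewrite mulfV// gt_eqF.
have mulk (a b : R) : (1 - f + a%:C *: f) * (1 - f + b%:C *: f) = 1 - f + (a * b)%:C *: f.
  have -> : (1 - f + a%:C *: f) * (1 - f + b%:C *: f) = 1 - f - f + f * f
      + a%:C *: (f - f * f) + b%:C *: (f - f * f) + (a * b)%:C *: (f * f) by ncring.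
  by rewrite ff subrr !scaler0 !addr0 subrK.
have Nk (a : R) : N (1 - f + a%:C *: f) by apply: memD => //; exact: memZ.
have sk (a : R) : sa (1 - f + a%:C *: f).
  by apply: saD; [apply: saB => //; exact: sa1|exact: saZ].
apply: (perturbed_index (k := 1 - f + q%:C *: f) (k' := 1 - f + (q^-1)%:C *: f) qb) => //.
- by rewrite mulk qV rmorph1 scale1r subrK.
- by rewrite mulk mulrC qV rmorph1 scale1r subrK.
- have : 0 <= u * p by rewrite mulr_ge0// ltW.
  have [->|pn0] := eqVneq p 0; first by lra.
  have pp : 0 < p by rewrite lt_def pn0.
  by have : 0 < u * p by [exact: mulr_gt0]; lra.
- have [Df _] := Nf; have D1 := mem1 DS.
  rewrite mulk qq (ceD H) ?(ceB H) ?(ceZ H) ?(ce1 H) ?pE//; first by ncring.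
  + exact: memB.
  + exact: memZ.
- rewrite mulk -invfM qq.
  transitivity (\sum_i l i * star (l i) + (u^-1 - 1)%:C *: \sum_i l i * f * star (l i)).
    by rewrite scaler_sumr -big_split; apply: eq_bigr => i _ /=; ncring.
  by rewrite qc sE; ncring.
Qed.

(** The identity is linear in [a], and the relative commutant is spanned by projections. *)
Lemma minimal_extremal : extremal C D E c.
Proof.
have [[_ [m [l [qb qc]]]] _] := minE; split=> //; exists m, l; split=> //.
have NS := commutant_star_subalg H.
suff sacase a : N a -> sa a -> \sum_i l i * a * star (l i) = c%:C *: E a.
  move=> a Na; set x := (2^-1)%:C *: (a + star a).
  set y := (2^-1)%:C *: (- 'i%C *: (a - star a)).
  have Nx : N x by exact: mem_re.
  have Ny : N y by exact: mem_im.
  have [Dx _] := Nx; have [Dy _] := Ny.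
  have DS : star_subalg D by case: H => _ /cstar_star_subalg.
  rewrite (re_im a) -/x -/y (ceD H Dx (memZ DS 'i%C Dy)) (ceZ H 'i%C Dy).
  have -> : c%:C *: (E x + 'i%C *: E y) = c%:C *: E x + 'i%C *: (c%:C *: E y) by ncring.
  rewrite -(sacase _ Nx (sa_re a)) -(sacase _ Ny (sa_im a)).
  by rewrite scaler_sumr -big_split; apply: eq_bigr => i _ /=; ncring.
move=> Na sx; have [p pn0 pa] := commutant_algebraic H CC qb qc Na.
have [k [al [f [fP _ _ _ aE]]]] := spectral NS Na sx pn0 pa.
have Df j : D (f j) by have [[]] := fP j.
have DS : star_subalg D by case: H => _ /cstar_star_subalg.
rewrite {2}aE (ce_sum H) => [|j]; last exact: memZ.
transitivity (\sum_j (al j)%:C *: \sum_i l i * f j * star (l i)).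
  under [RHS]eq_bigr => j _ do rewrite scaler_sumr.
  rewrite exchange_big; apply: eq_bigr => i _ /=.
  rewrite aE mulr_sumr mulr_suml; apply: eq_bigr => j _; ncring.
rewrite scaler_sumr; apply: eq_bigr => j _; have [Nf pf] := fP j.
by rewrite (projection_sum qb qc Nf pf) (ceZ H (al j)%:C (Df j)) !scalerA mulrC.
Qed.
End Minimal.

(** * Range projections and least traces *)

Section FiniteDimensionalSubalgebra.
Context {R : realType} {M : cstarAlgType R}.
Implicit Types (x y z : M) (r : R).
Variables (C D : set M) (E : M -> M) (c : R).
Hypothesis X : extremal C D E c.
Local Notation N := (commutant C D).
Let H : expectation C D E. Proof. by case: X. Qed.
Let CC : scalars C C. Proof. by case: X. Qed.
Let NS : star_subalg N. Proof. exact: commutant_star_subalg H. Qed.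

Definition rtau (G : M -> M) x : R := complex.Re (tau G x).

Lemma rtauD x y : N x -> N y -> rtau E (x + y) = rtau E x + rtau E y.
Proof.
move=> Nx Ny; rewrite /rtau (tauD H CC)//.
by case: (tau _ x) (tau _ y) => [? ?] [].
Qed.

Lemma rtauB x y : N x -> N y -> rtau E (x - y) = rtau E x - rtau E y.
Proof.
move=> Nx Ny; rewrite /rtau (tauB H CC)//.
by case: (tau _ x) (tau _ y) => [? ?] [].
Qed.

Lemma rtauZ r x : N x -> rtau E (r%:C *: x) = r * rtau E x.
Proof. by move=> Nx; rewrite /rtau (tauZ H CC)//; case: (tau _ x) => a b /=; ring. Qed.

Lemma rtau0 : rtau E 0 = 0.
Proof. by rewrite /rtau (tau0 H). Qed.

Lemma rtau_sum (I : Type) (s : seq I) (F : I -> M) : (forall i, N (F i)) ->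
  rtau E (\sum_(i <- s) F i) = \sum_(i <- s) rtau E (F i).
Proof.
move=> NF; elim: s => [|i s IHs]; first by rewrite !big_nil rtau0.
by rewrite !big_cons rtauD ?IHs//; exact: mem_sum.
Qed.

Lemma rtau_star x : N x -> rtau E (star x) = rtau E x.
Proof. by move=> Nx; rewrite /rtau (tau_star H CC)//; case: (tau _ x). Qed.

Lemma rtau_ge0 x : N x -> 0 <= rtau E (star x * x).
Proof. by move=> Nx; apply: Re_ge0; exact: (tau_ge0 H CC). Qed.

Lemma rtau_gt0 x : N x -> x != 0 -> 0 < rtau E (star x * x).
Proof.
have [_ _ [m [l [qb qc _]]]] := X => Nx xn0.
by have := tau_gt0 H CC qb qc Nx xn0; rewrite ltcE /= => /andP[].
Qed.

Lemma rtau_proj_ge0 x : N x -> projection x -> 0 <= rtau E x.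
Proof. by move=> Nx [sx xx]; rewrite -xx -{1}sx; exact: rtau_ge0. Qed.

Lemma rtau_proj_gt0 x : N x -> projection x -> x != 0 -> 0 < rtau E x.
Proof. by move=> Nx [sx xx] xn0; rewrite -xx -{1}sx; exact: rtau_gt0. Qed.

Lemma rtauC x y : N x -> N y -> rtau E (x * y) = rtau E (y * x).
Proof. by move=> Nx [Dy _]; rewrite /rtau /tau (extremal_trace X). Qed.

Variable K : set M.
Hypotheses (KS : star_subalg K) (KN : K `<=` N).

Lemma sub_spectral h : K h -> sa h ->
  exists k (a : 'I_k -> R) (f : 'I_k -> M), spectral_family K a f h.
Proof.
move=> Kh sh; have [_ _ [m [l [qb qc _]]]] := X.
have [p pn0 hp] := commutant_algebraic H CC qb qc (KN Kh).
exact: spectral KS Kh sh pn0 hp.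
Qed.

(** The range projection is the sum of the spectral projections of [x * star x] with nonzero
    eigenvalue. *)
Lemma range_projP x : K x -> is_range_proj K x (range_proj K x).
Proof.
move=> Kx; suff [p pP] : exists p, is_range_proj K x p.
  by rewrite /range_proj; case: xgetP => [q -> //|/(_ p)].
have sh : sa (x * star x) by rewrite /sa starM starK.
have Kh : K (x * star x) by apply: memM => //; exact: mem_star.
have [k [a [f S]]] := sub_spectral Kh sh; have [fP _ ff f1 hE] := S.
have Kf i : K (f i) by have [] := fP i.
have fs i : star (f i) = f i by have [_ []] := fP i.
have f2 i : f i * f i = f i by have [_ []] := fP i.
pose p := \sum_(i | a i != 0) f i.
pose g := \sum_(i | ~~ (a i != 0)) f i.
have pg : p + g = 1 by rewrite -f1 (bigID (fun i => a i != 0)).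
have sp : star p = p by rewrite /p raddf_sum /=; apply: eq_bigr => i _.
have pf i : a i != 0 -> p * f i = f i.
  move=> ai; rewrite mulr_suml (bigD1 i)//= f2 big1 ?addr0// => j /andP[_ ji].
  exact: ff.
have gh : g * (x * star x) = 0.
  rewrite mulr_suml big1 // => i /negPn/eqP ai.
  by rewrite (spectral_mull i S) ai rmorph0 scale0r.
have gx : g * x = 0.
  suff : star (g * x) = 0 by move/(congr1 star); rewrite starK star0.
  by apply: star_eq0; rewrite starK starM mulrA -(mulrA g) gh mul0r.
exists p; split.
- exact: mem_sum.
- by split=> //; rewrite {2}/p mulr_sumr; apply: eq_bigr => i; exact: pf.
- by rewrite -[RHS]mul1r -pg mulrDl gx addr0.
- move=> q Kq [sq qq] qx; rewrite /p mulr_sumr; apply: eq_bigr => i ai.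
  have fE : f i = (a i)^-1%:C *: (x * star x * f i).
    by rewrite (spectral_mul i S) scalerA -rmorphM/= mulVf// rmorph1 scale1r.
  by rewrite fE -scalerAr !mulrA qx.
Qed.

(** Convertible with [min_trace] when [E] is the composite expectation of the tower. *)
Definition min_rtau : R :=
  inf [set rtau E p | p in [set p | [/\ K p, projection p & p != 0]]].

Lemma min_rtau_lb p : K p -> projection p -> p != 0 -> min_rtau <= rtau E p.
Proof.
move=> Kp pp pn0; apply: ge_inf; last by exists p.
by exists 0 => _ [q [Kq pq _] <-]; apply: rtau_proj_ge0 => //; exact: KN.
Qed.

Lemma min_rtau_ge0 : 0 <= min_rtau.
Proof.
have p1 : projection (1 : M) by split; [exact: star1|rewrite mulr1].
have h : [set rtau E p | p in [set p | [/\ K p, projection p & p != 0]]] !=set0.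
  by exists (rtau E 1); exists 1 => //; split=> //; [exact: mem1|exact: oner_neq0].
apply: (lb_le_inf h) => _ [q [Kq pq _] <-].
by apply: rtau_proj_ge0 => //; exact: KN.
Qed.

(** An eigenvalue times the trace of its projection is at most the trace of [h], and that projection
    has trace at least [min_rtau]. Positivity of [h] is asked only against projections of [K], which
    is what values of expectations provide; the exact square [b * b] can be sandwiched later. *)
Lemma order_bound h : K h -> sa h ->
  (forall f, K f -> projection f -> 0 <= rtau E (f * h * f)) ->
  exists b, [/\ K b, sa b & (rtau E h)%:C%:A - min_rtau%:C *: h = b * b].
Proof.
move=> Kh sh hpos; have [k [a [f S]]] := sub_spectral Kh sh.
have [fP fn0 ff f1 hE] := S.
have Kf i : K (f i) by have [] := fP i.
have pf i : projection (f i) by have [] := fP i.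
have f2 i : f i * f i = f i by have [] := pf i.
have tf i : 0 < rtau E (f i) by apply: rtau_proj_gt0 => //; exact: KN.
have at0 i : 0 <= a i * rtau E (f i).
  rewrite -rtauZ; last exact: KN.
  have -> : (a i)%:C *: f i = f i * h * f i.
    by rewrite (spectral_mull i S) -scalerAl f2.
  exact: hpos.
have a0 i : 0 <= a i by rewrite -(pmulr_lge0 _ (tf i)).
have th : rtau E h = \sum_i a i * rtau E (f i).
  rewrite {1}hE rtau_sum => [|i]; last by apply: memZ => //; exact: KN.
  by apply: eq_bigr => i _; rewrite rtauZ//; exact: KN.
have bound i : 0 <= rtau E h - min_rtau * a i.
  rewrite subr_ge0; apply: (@le_trans _ _ (a i * rtau E (f i))).
    by rewrite mulrC ler_wpM2l//; apply: min_rtau_lb.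
  by rewrite th (bigD1 i)//= lerDl sumr_ge0.
pose s i := Num.sqrt (rtau E h - min_rtau * a i).
exists (\sum_i (s i)%:C *: f i); split.
- by apply: mem_sum => // i _; exact: memZ.
- by rewrite /sa star_sum; apply: eq_bigr => i _; rewrite starZr; have [->] := pf i.
- rewrite mulr_suml.
  transitivity (\sum_i (s i * s i)%:C *: f i); last first.
    apply: eq_bigr => i _; rewrite mulr_sumr (bigD1 i)//= big1 ?addr0 => [|j ji].
      by rewrite -scalerAl -scalerAr f2 scalerA rmorphM.
    by rewrite -scalerAl -scalerAr ff ?scaler0// eq_sym.
  rewrite -f1 {2}hE !scaler_sumr -sumrB; apply: eq_bigr => i _.
  by rewrite /s -expr2 sqr_sqrtr//; ncring.
Qed.
End FiniteDimensionalSubalgebra.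

(** * The tower and the Fourier transform *)

(** With [f] the preceding Jones projection, this is the Temperley-Lieb relation that
    [jones_sandwich] does not give. *)
Lemma jones_corner {R : realType} {M : cstarAlgType R} (C D D1 : set M)
    (E : M -> M) (e f : M) (t : R[i]) :
  expectation C D E -> basic_construction C D E D1 e -> cstar_subalgebra D1 ->
  D f -> (forall x, D x -> f * E (f * x) = t *: (f * x)) ->
  f * e * f = t *: f.
Proof.
move=> H bc D1C Df fE; have D1S := cstar_star_subalg D1C.
have [CS /cstar_star_subalg DS CD ce] := H.
have D1e := jones_mem H bc; have DD1 : D `<=` D1 by case: bc.
have D1f := DD1 _ Df; have D1fe : D1 (f * e) by exact: memM.
have [pi [[piD piM piZ _] piI piL pie]] := jones_rep H bc D1C.
apply: piI; [exact: memM|exact: memZ|] => x Dx.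
have Dfx : D (f * x) by exact: memM.
have DEfx : D (E (f * x)) by apply: (ce_memD H).
rewrite (piM (f * e) f)// (piL f x)// (piM f e)// (pie (f * x))//.
by rewrite (piL f)// fE// piZ// piL.
Qed.

Section Tower.
Context {R : realType} {M : cstarAlgType R}.
Implicit Types (x y z : M).
Variables (B : set M) (A : nat -> set M) (E : nat -> M -> M) (e : nat -> M).
Variable ind : R.
Hypotheses (subB : cstar_subalgebra B) (BA : B `<=` A 0%N).
Hypotheses (simpleB : simple B) (simpleA : simple (A 0%N)).
Hypotheses (minE0 : minimal_cond_exp B (A 0%N) (E 0%N) ind).
Hypothesis tower : jones_tower B A E e ind.
Local Notation t := (ind^-1).
Local Notation w := (jones_word e).
Local Notation phi := (comp_exp E).

Let AC n : cstar_subalgebra (A n). Proof. by case: tower. Qed.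
Let AS n : star_subalg (A n). Proof. exact: cstar_star_subalg. Qed.
Let BS : star_subalg B. Proof. exact: cstar_star_subalg. Qed.
Let bcn n : basic_construction (level B A n) (A n) (E n) (A n.+1) (e n.+1).
Proof. by case: tower. Qed.
Let ceS n : cond_exp (A n) (A n.+1) (E n.+1). Proof. by case: tower. Qed.
Let EE n x y : A n x -> A n y ->
  E n.+1 (x * e n.+1 * y) = t%:C *: (x * y).
Proof. by case: tower => _ _ _ h *; exact: h. Qed.
Let BB : scalars B B. Proof. exact: simple_center. Qed.

Lemma levelS n : level B A n `<=` A n.
Proof. by case: n => [|n] //=; case: (bcn n). Qed.

Lemma B_sub n : B `<=` A n.
Proof.
elim: n => [|n IHn] //; apply: subset_trans IHn _; exact: (@levelS n.+1).
Qed.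

Lemma A0_sub n : A 0%N `<=` A n.
Proof. by elim: n => [|n IHn] //; apply: subset_trans IHn _; exact: (@levelS n.+1). Qed.

Lemma tower_expectation n : expectation (level B A n) (A n) (E n).
Proof.
case: n => [|n]; first by split=> //; case: minE0 => -[].
split; [exact: AS|exact: AC|exact: (@levelS n.+1)|exact: ceS].
Qed.
Let HE := tower_expectation.

(** Triviality of the center of A_n is part of the induction because the next dual expectation takes
    values there. Simplicity supplies the first two centers, and each step derives the center two
    levels up. *)
Lemma tower_extremal n :
  extremal (level B A n) (A n) (E n) ind /\ scalars (A n) (A n).
Proof.
elim: n => [|n [[H CC [m [l [qb qc qe]]]] AA]].
  have AA : scalars (A 0%N) (A 0%N) by exact: simple_center.
  by split=> //; apply: minimal_extremal => //; exact: HE.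
split.
  by apply: (dual_extremal H (bcn n) (AC n.+1) (ceS n) (@EE n) qb qc).
exact: (dual_scalars H (bcn n) (AC n.+1) (ceS n) (@EE n) qb qc).
Qed.

Lemma phi_extremal n : extremal B (A n) (phi n) (ind ^+ n.+1).
Proof.
elim: n => [|n IHn]; first by rewrite expr1; case: (tower_extremal 0).
rewrite exprSr; have [X _] := tower_extremal n.+1.
exact: (extremal_comp IHn X).
Qed.

Lemma phi_expectation n : expectation B (A n) (phi n).
Proof. by case: (phi_extremal n). Qed.
Let HP := phi_expectation.

Local Notation N n := (commutant B (A n)).
Local Notation K n := (commutant (A 0%N) (A n)).
Local Notation T n := (rtau (phi n)).

Let NS n : star_subalg (N n). Proof. exact: commutant_star_subalg (HP n). Qed.
Let KS n : star_subalg (K n).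
Proof. by apply: commutant_subalg => // c; exact: mem_star. Qed.
Lemma K_sub n : K n `<=` N n.
Proof. by move=> x [Ax xA]; split=> // b /BA; exact: xA. Qed.
Lemma N_succ n : N n `<=` N n.+1.
Proof. by move=> x [Ax xB]; split=> //; exact: (@levelS n.+1). Qed.
Lemma K_succ n : K n `<=` K n.+1.
Proof. by move=> x [Ax xB]; split=> //; exact: (@levelS n.+1). Qed.

Lemma N_exp n x : N n.+1 x -> N n (E n.+1 x).
Proof.
move=> [Ax xB]; split; first exact: (ce_mem (HE n.+1)).
move=> b Bb; have Ab : level B A n.+1 b := B_sub n Bb.
by rewrite -(ceMr (HE n.+1) Ab)// -(ceMl (HE n.+1) Ab)// xB.
Qed.

Lemma T_exp n x : T n (E n.+1 x) = T n.+1 x.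
Proof. by []. Qed.

Lemma T_succ n x : A n x -> T n.+1 x = T n x.
Proof. by move=> Ax; rewrite -T_exp (ce_id (HE n.+1)). Qed.

(** The composite with [E 0] split off: unlike [phi], it is an A_0-bimodule map. *)
Fixpoint rest n x : M := if n is k.+1 then rest k (E k.+1 x) else x.

Lemma phi_rest n x : phi n x = E 0%N (rest n x).
Proof. by elim: n x => [|n IHn] x //=. Qed.

Lemma rest_expectation n : expectation (A 0%N) (A n) (rest n).
Proof.
elim: n => [|n IHn].
  by split=> //; split=> // x Ax; exists x.
exact: (expectation_comp IHn (HE n.+1)).
Qed.

Lemma ind_ge1 : 1 <= ind.
Proof.
by have [[H _ [m [l [qb qc _]]]] _] := tower_extremal 0; exact: (index_ge1 H qb qc).
Qed.
Let ind0 : 0 < ind. Proof. by have := ind_ge1; lra. Qed.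
Let indV : ind * t = 1. Proof. by rewrite mulfV// gt_eqF. Qed.

Lemma e_proj n : projection (e n.+1). Proof. exact: (jones_proj (bcn n)). Qed.
Let se n : star (e n.+1) = e n.+1. Proof. by case: (e_proj n). Qed.
Let ee n : e n.+1 * e n.+1 = e n.+1. Proof. by case: (e_proj n). Qed.
Let e_mem n : A n.+1 (e n.+1). Proof. exact: (jones_mem (HE n) (bcn n)). Qed.

Lemma e_comm n b : level B A n b -> e n.+1 * b = b * e n.+1.
Proof. exact: (jones_comm (HE n) (bcn n) (AC n.+1)). Qed.

Lemma e_sandwich n a : A n a -> e n.+1 * a * e n.+1 = E n a * e n.+1.
Proof. exact: (jones_sandwich (HE n) (bcn n) (AC n.+1)). Qed.

Lemma e_N n : N n.+1 (e n.+1).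
Proof.
split=> // b Bb; apply: e_comm; case: n => [|n] //=; exact: B_sub.
Qed.

Lemma e_up n : e n.+2 * e n.+1 * e n.+2 = t%:C *: e n.+2.
Proof.
by rewrite e_sandwich// (jones_exp (HE n) (@EE n)) -scalerAl mul1r.
Qed.

Lemma e_down n : e n.+1 * e n.+2 * e n.+1 = t%:C *: e n.+1.
Proof.
apply: (jones_corner (HE n.+1) (bcn n.+1) (AC n.+2)) => // x Ax.
exact: (jones_pushl (HE n) (bcn n) (AC n.+1) (ceS n) (@EE n)).
Qed.

Lemma w_mem n : N n (w n).
Proof.
elim: n => [|n IHn]; first exact: mem1.
by apply: memM => //; [exact: e_N|exact: N_succ].
Qed.

Lemma w_corner n : star (w n) * e n.+1 * w n = (t ^+ n)%:C *: e 1%N.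
Proof.
elim: n => [|n IHn]; first by rewrite /= star1 mul1r mulr1 expr0 rmorph1 scale1r.
have -> : star (w n.+1) * e n.+2 * w n.+1 =
    star (w n) * (e n.+1 * e n.+2 * e n.+1) * w n.
  by rewrite /= starM se !mulrA.
by rewrite e_down -scalerAr -scalerAl IHn scalerA -rmorphM exprS.
Qed.

Lemma w_conj n a : A 0%N a ->
  w n.+1 * a * star (w n.+1) = (t ^+ n)%:C *: (E 0%N a * e n.+1).
Proof.
move=> Aa; elim: n => [|n IHn].
  by rewrite /= !mulr1 se e_sandwich// expr0 rmorph1 scale1r.
have -> : w n.+2 * a * star (w n.+2) =
    e n.+2 * (w n.+1 * a * star (w n.+1)) * e n.+2.
  by rewrite [w n.+2]/= starM se !mulrA.
have BE : B (E 0%N a) by apply: (ce_mem (HE 0)).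
have eB : e n.+2 * E 0%N a = E 0%N a * e n.+2 by apply: e_comm; exact: B_sub.
rewrite IHn; move: (E 0%N a) eB => b eB.
have -> : e n.+2 * ((t ^+ n)%:C *: (b * e n.+1)) * e n.+2 =
    (t ^+ n)%:C *: (e n.+2 * b * e n.+1 * e n.+2) by ncring.
rewrite eB -(mulrA b (e n.+2)) -(mulrA b (e n.+2 * e n.+1)) e_up -scalerAr scalerA.
by rewrite -rmorphM exprSr.
Qed.

Lemma w_sandwich n y : A n y ->
  star (w n.+1) * y * w n.+1 = star (w n) * (E n y * e n.+1) * w n.
Proof. by move=> Ay; rewrite -e_sandwich// /= starM se !mulrA. Qed.

(** * Averages over a quasi-basis of [E 0] *)

Variables (q : nat) (l : 'I_q -> M).
Hypotheses (qb : quasi_basis (A 0%N) (E 0%N) l).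
Hypothesis qe : forall a, commutant B (A 0%N) a ->
  \sum_i l i * a * star (l i) = ind%:C *: E 0%N a.
Let Al i : A 0%N (l i). Proof. exact: qb_mem qb i. Qed.
Let Asl i : A 0%N (star (l i)). Proof. exact: mem_star. Qed.

Definition avg x := \sum_i l i * x * star (l i).

Lemma avg_K n x : N n x -> K n (avg x).
Proof. exact: (quasi_basis_commutant (HE 0) qb (AS n) (@A0_sub n)). Qed.

(** The bimodule map [rest] carries the average down to the relative commutant of B in A_0, where
    extremality of [E 0] evaluates it. *)
Lemma T_avg n x : N n x -> T n (avg x) = ind * T n x.
Proof.
move=> Nx; have [Ax xB] := Nx; have RE := rest_expectation n.
have Nr : N 0 (rest n x).
  split; first exact: (ce_mem RE).
  by move=> b Bb; rewrite -(ceMr RE) -?(ceMl RE) ?xB//; exact: BA.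
have Alx i : A n (l i * x) by apply: memM => //; exact: A0_sub.
have pE : phi n (avg x) = ind%:C *: phi n x.
  rewrite !phi_rest (ce_sum RE) => [|i]; last by apply: memM => //; exact: A0_sub.
  under eq_bigr => i _ do rewrite (ceMr RE (Asl i) (Alx i)) (ceMl RE (Al i) Ax).
  rewrite qe//; have [Ar _] := Nr; have BE := ce_mem (HE 0) Ar.
  by rewrite (ceZ (HE 0) _ (BA BE)) (ce_id (HE 0) BE).
rewrite /rtau {1}/tau pE (tauE (HP n) BB Nx) scalerA scalar_ofA.
by case: (tau _ _) => a b /=; ring.
Qed.

Lemma avg_e : avg (e 1%N) = 1.
Proof. exact: (jones_sum (HE 0) (bcn 0) (AC 1) qb). Qed.

Variables (m : nat) (EA : M -> M).
Hypothesis trEA : tr_preserving_cond_exp B A E m.+2 EA.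
Let n := m.+1.

Lemma EA_mem x : N n.+1 x -> K n.+1 (EA x).
Proof. by case: trEA => [[h _ _ _ _]] _; exact: h. Qed.
Lemma EAl c x : K n.+1 c -> N n.+1 x -> EA (c * x) = c * EA x.
Proof.
move=> Kc Nx; case: trEA => [[_ _ _ h _]] _.
by have := h c x 1 Kc Nx (mem1 (KS _)); rewrite !mulr1.
Qed.
Lemma EAr c x : K n.+1 c -> N n.+1 x -> EA (x * c) = EA x * c.
Proof.
move=> Kc Nx; case: trEA => [[_ _ _ h _]] _.
by have := h 1 x c (mem1 (KS _)) Nx Kc; rewrite !mul1r.
Qed.
Lemma T_EA x : N n.+1 x -> T n.+1 (EA x) = T n.+1 x.
Proof. by move=> Nx; case: trEA => _ /(_ x Nx) h; exact: (congr1 (@complex.Re R) h). Qed.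

(** The difference [z] commutes with A_0, so [star z] passes through both [EA] and [avg]; both terms
    then contribute the trace of [star z * x], and [star z * z] has trace 0. *)
Lemma EA_avg x : N n.+1 x -> EA x = t%:C *: avg x.
Proof.
move=> Nx; apply/eqP; rewrite -subr_eq0; apply/eqP; set z := _ - _.
have KE := EA_mem Nx; have Ka := avg_K Nx.
have Kta : K n.+1 (t%:C *: avg x) by exact: memZ.
have Kz : K n.+1 z by exact: memB.
have Ksz : K n.+1 (star z) by exact: mem_star.
have Nz := K_sub Kz; have Nsz := K_sub Ksz.
have Nzx : N n.+1 (star z * x) by exact: memM.
apply/eqP; apply: contraT => zn0.
have := rtau_gt0 (phi_extremal n.+1) Nz zn0; rewrite {2}/z mulrBr.
have -> : star z * (t%:C *: avg x) = t%:C *: avg (star z * x).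
  rewrite -scalerAr /avg mulr_sumr; congr (_ *: _); apply: eq_bigr => i _.
  have [_ zC] := Ksz; have A1 : A 0%N (l i) by [].
  by rewrite !mulrA zC.
rewrite -EAl// (rtauB (phi_extremal n.+1)); last first.
- by apply: memZ => //; apply: K_sub; exact: avg_K.
- by apply: K_sub; exact: EA_mem.
rewrite (rtauZ (phi_extremal n.+1)); last by apply: K_sub; exact: avg_K.
by rewrite T_EA// T_avg// mulrA [t * _]mulrC indV mul1r subrr ltxx.
Qed.

(** The averaging formula stays in A_n although [EA] is defined one level higher. *)
Lemma EA_N p : N n p -> K n (EA p).
Proof. by move=> Np; rewrite EA_avg; [apply: memZ => //; exact: avg_K|exact: N_succ]. Qed.

Lemma e1_N k : N k.+1 (e 1%N).
Proof. by elim: k => [|k IHk]; [exact: e_N|exact: N_succ]. Qed.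

Lemma EA_e1 : EA (e 1%N) = t%:C%:A.
Proof. by rewrite EA_avg ?avg_e//; exact: e1_N. Qed.

(** * The Fourier transform and its inverse *)

Local Notation F := (fourier e ind EA n).
Local Notation Finv := (inv_fourier E e ind n).
Let k : R := t `^ (- ((n%:R + 2) / 2)).

Let FE x : F x = k%:C *: EA (x * w n.+1). Proof. by []. Qed.
Let FinvE y : Finv y = k%:C *: E n.+1 (y * star (w n.+1)). Proof. by []. Qed.

Let kk : k * k = ind ^+ n.+2.
Proof.
have t0 : 0 < t by rewrite invr_gt0.
rewrite /k -powRD; last by apply/implyP => _; rewrite gt_eqF.
have -> : - ((n%:R + 2) / 2) + - ((n%:R + 2) / 2) = - n.+2%:R :> R.
  by rewrite -(addn2 n) natrD; field.
by rewrite powRN powR_mulrn ?exprVn ?invrK// ltW.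
Qed.

(** In either composite of the two transforms, one [t] comes from [EA_avg], [t^n] from the Jones
    word, and the last [t] from [E n.+1] applied around [e n.+1]. *)
Let kk1 : k * k * t * t ^+ n.+1 = 1.
Proof. by rewrite kk -mulrA -exprS -exprMn indV expr1n. Qed.

Let Nw : N n.+1 (w n.+1). Proof. exact: w_mem. Qed.
Let Nsw : N n.+1 (star (w n.+1)). Proof. exact: mem_star. Qed.

Lemma fourier_mem x : N n x -> K n.+1 (F x).
Proof.
by move=> Nx; apply: memZ => //; apply: EA_mem; apply: memM => //; exact: N_succ.
Qed.

Lemma inv_fourier_mem y : K n.+1 y -> N n (Finv y).
Proof.
by move=> /K_sub Ky; apply: memZ => //; apply: N_exp; exact: memM.
Qed.

(** By [w_conj] the two words around [star (l i)] collapse to [E 0 (star (l i)) * e n.+1]. What is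
    left is the quasi-basis expansion of 1, once [x] is moved past elements of B. *)
Lemma inv_fourierK x : N n x -> Finv (F x) = x.
Proof.
move=> Nx; have [Ax xB] := Nx; have Nx1 := N_succ Nx; have [Ax1 _] := Nx1.
have Nxw : N n.+1 (x * w n.+1) by exact: memM.
have Aw : A n.+1 (w n.+1) by case: Nw.
have Al1 i : A n (l i) by exact: A0_sub.
have B0 i : B (E 0%N (star (l i))) by apply: (ce_mem (HE 0)); exact: Asl.
rewrite FinvE FE EA_avg//.
have -> : k%:C *: (t%:C *: avg (x * w n.+1)) * star (w n.+1) =
    \sum_i (k * t * t ^+ n)%:C *: ((l i * x * E 0%N (star (l i))) * e n.+1 * 1).
  rewrite scalerA -scalerAl /avg mulr_suml scaler_sumr; apply: eq_bigr => i _.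
  have := w_conj n (Asl i) => h.
  have -> : l i * (x * w n.+1) * star (l i) * star (w n.+1) =
     l i * x * (w n.+1 * star (l i) * star (w n.+1)) by ncring.
  by rewrite h; ncring.
have AE i : A n (l i * x * E 0%N (star (l i))).
  by apply: memM => //; [exact: memM|exact: B_sub].
have Ae : A n.+1 (e n.+1) by exact: e_mem.
rewrite (ce_sum (HE n.+1)) => [|i]; last first.
  apply: memZ => //; apply: memM => //; last exact: mem1.
  by apply: memM => //; apply: (@levelS n.+1).
rewrite scaler_sumr.
transitivity (\sum_i (k * k * t * t ^+ n.+1)%:C *: (l i * x * E 0%N (star (l i)))).
  apply: eq_bigr => i _; rewrite (ceZ (HE n.+1)); last first.
    apply: memM => //; last exact: mem1.
    by apply: memM => //; apply: (@levelS n.+1).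
  rewrite EE//; last exact: mem1.
  by rewrite exprS; ncring.
rewrite kk1 -[RHS]mul1r -[in RHS](qb1 qb (mem1 (AS 0))) mulr_suml.
apply: eq_bigr => i _; rewrite rmorph1 scale1r mulr1 -!mulrA; congr (_ * _).
exact: xB.
Qed.

(** Push-down and [w_corner] reduce [Finv y * w n.+1] to a multiple of [y * e 1], and [e 1] averages
    to 1. *)
Lemma fourierK y : K n.+1 y -> F (Finv y) = y.
Proof.
move=> Ky; have Ny := K_sub Ky; have [Ay yA] := Ky.
have Nif := inv_fourier_mem Ky; have Nif1 := N_succ Nif.
have A1 : A n.+1 (y * star (w n)).
  have Aw : A n (star (w n)) by apply: mem_star => //; case: (w_mem n).
  by apply: memM => //; exact: (@levelS n.+1).
have ifw : Finv y * w n.+1 = (k * t * t ^+ n)%:C *: (y * e 1%N).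
  have wS : w n.+1 = e n.+1 * w n by [].
  rewrite FinvE -scalerAl wS starM se mulrA.
  rewrite (mulrA y) (jones_pushr (HE n) (bcn n) (AC n.+1) (@EE n) A1).
  have := w_corner n => h.
  have -> : t%:C *: (y * star (w n) * e n.+1) * w n =
    t%:C *: (y * (star (w n) * e n.+1 * w n)) by ncring.
  by rewrite h; ncring.
rewrite FE ifw EA_avg; last by apply: memZ => //; apply: memM => //; exact: e1_N.
have -> : avg ((k * t * t ^+ n)%:C *: (y * e 1%N)) = (k * t * t ^+ n)%:C *: (y * avg (e 1%N)).
  rewrite /avg mulr_sumr scaler_sumr; apply: eq_bigr => i _.
  by rewrite -scalerAr -scalerAl !mulrA yA.
rewrite avg_e mulr1 !scalerA -!rmorphM/=.
have -> : k * t * (k * t * t ^+ n) = k * k * t * t ^+ n.+1 by rewrite exprS; ring.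
by rewrite kk1 rmorph1 scale1r.
Qed.

(** Moving [star y] inside [EA] and using the trace turns one factor into [star (Finv y)]. *)
Lemma plancherel x y : N n x -> K n.+1 y -> y = F x -> x = Finv y ->
  T n.+1 (y * star y) = T n (star x * x).
Proof.
move=> Nx Ky yE xE; have Nx1 := N_succ Nx; have Ny := K_sub Ky.
have Ksy : K n.+1 (star y) by exact: mem_star.
have Nsy := K_sub Ksy; have Nxw : N n.+1 (x * w n.+1) by exact: memM.
have Nsx : N n (star x) by exact: mem_star.
have Nwy : N n.+1 (w n.+1 * star y) by exact: memM.
have Nxwy : N n.+1 (x * w n.+1 * star y) by exact: memM.
rewrite {1}yE FE -scalerAl -EAr// (rtauZ (phi_extremal n.+1)); last first.
  by apply: K_sub; exact: EA_mem.
rewrite T_EA// -T_exp.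
have -> : E n.+1 (x * w n.+1 * star y) = x * E n.+1 (w n.+1 * star y).
  rewrite -mulrA; apply: (ceMl (HE n.+1)); first by case: Nx.
  by case: Nwy.
have <- : T n (x * (k%:C *: E n.+1 (w n.+1 * star y))) =
    k * T n (x * E n.+1 (w n.+1 * star y)).
  rewrite -scalerAr (rtauZ (phi_extremal n))//; apply: memM => //.
  exact: N_exp.
have -> : k%:C *: E n.+1 (w n.+1 * star y) = star x.
  have [Ayw _] : N n.+1 (y * star (w n.+1)) by exact: memM.
  by rewrite xE FinvE starZr -(ce_star (HE n.+1) Ayw) starM starK.
by rewrite (rtauC (phi_extremal n)).
Qed.

(** As [n = m.+1], [kp] and [km] are the constants of index [n - 1]; the one for A' has its algebra
    and its trace at level [n]. *)
Local Notation kp := (min_rtau (phi m) (N m)).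
Local Notation km := (min_rtau (phi n) (K n)).

(** Under the trace, [p] between two copies of [r] may be replaced by [EA p], which lies in A_n and
    is therefore subject to [order_bound] with [km]. *)
Lemma EA_bound p r : N n p -> projection p -> K n.+1 r -> projection r ->
  km * T n.+1 (r * p * r) <= T n p * T n.+1 r.
Proof.
move=> Np [sp pp] Kr [sr rr]; have Np1 := N_succ Np; have KE := EA_N Np.
have XN := phi_extremal n.+1.
have sE : sa (EA p).
  rewrite EA_avg//; apply: saZ; rewrite /sa /avg star_sum; apply: eq_bigr => i _.
  by rewrite !starM starK sp mulrA.
have EAc f : K n.+1 f -> EA (f * p * f) = f * EA p * f.
  by move=> Kf; rewrite EAr ?EAl//; apply: memM => //; exact: K_sub.
have Tc f : K n.+1 f -> T n.+1 (f * EA p * f) = T n.+1 (f * p * f).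
  move=> Kf; rewrite -EAc// T_EA//.
  by apply: memM => //; [apply: memM => //|]; exact: K_sub.
have [b [Kb sb bE]] : exists b, [/\ K n b, sa b &
    (T n (EA p))%:C%:A - km%:C *: EA p = b * b].
  apply: (order_bound (phi_extremal n) (KS n) (@K_sub n) KE sE) => f Kf [sf ff].
  have Kf1 := K_succ Kf; have [Afp _] : K n (f * EA p * f) by do 2 (apply: memM => //).
  rewrite -(T_succ Afp) Tc//.
  have -> : f * p * f = star (p * f) * (p * f).
    by rewrite starM sf sp !mulrA -(mulrA f p p) pp.
  by apply: (rtau_ge0 XN); apply: memM => //; exact: K_sub.
have TE : T n (EA p) = T n p.
  have [AE _] := KE; have [Ap _] := Np.
  by rewrite -(T_succ AE) T_EA// (T_succ Ap).
rewrite -Tc// -TE.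
have Nr := K_sub Kr; have Nb := K_sub (K_succ Kb).
have NE := K_sub (K_succ KE).
rewrite -subr_ge0 -(rtauZ XN) -?(rtauZ XN) -?(rtauB XN).
- have -> : (T n (EA p))%:C *: r - km%:C *: (r * EA p * r) = star (b * r) * (b * r).
    rewrite starM sb sr -{1}rr.
    have -> : (T n (EA p))%:C *: (r * r) - km%:C *: (r * EA p * r) =
      r * ((T n (EA p))%:C%:A - km%:C *: EA p) * r by ncring.
    by rewrite bE !mulrA.
  by apply: (rtau_ge0 XN); exact: memM.
- exact: memZ.
- by apply: memZ => //; do 2 (apply: memM => //).
- by do 2 (apply: memM => //).
- by [].
Qed.

(** The outer letters [e n.+1] turn [star x * x] into [g = E n (star x * x)], which commutes with
    [e n.+1] and is dominated by a scalar; the word then collapses onto [e 1]. *)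
Lemma word_bound x z : N n x -> N n.+1 z ->
  kp * T n.+1 (star z * (star (w n.+1) * (star x * x) * w n.+1) * z) <=
  T n (star x * x) * (t ^+ n * T n.+1 (star z * e 1%N * z)).
Proof.
move=> Nx Nz; have XN := phi_extremal n.+1.
have Nsx : N n (star x) by exact: mem_star.
have Nxx : N n (star x * x) by exact: memM.
have [Axx _] := Nxx; set g := E n (star x * x).
have Ng : N m g by exact: N_exp.
have sg : sa g by rewrite /sa /g -(ce_star (HE n))// starM starK.
have [d [Nd sd dE]] : exists d, [/\ N m d, sa d &
    (T m g)%:C%:A - kp%:C *: g = d * d].
  apply: (order_bound (phi_extremal m) (NS m) (fun _ h => h) Ng sg) => f Nf [sf ff].
  have [Af _] := Nf; have Nf1 := N_succ Nf.
  have -> : f * g * f = E n (star (x * f) * (x * f)).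
    rewrite /g starM sf -!mulrA (mulrA (star x)).
    rewrite (ceMl (HE n) (Af : level B A n f)); last by apply: memM => //; case: Nf1.
    by rewrite (ceMr (HE n) (Af : level B A n f)).
  by rewrite T_exp; apply: (rtau_ge0 (phi_extremal n)); exact: memM.
have Ad : level B A n d by case: Nd.
have ed := e_comm Ad.
have Nd1 : N n.+1 d by do 2 apply: N_succ.
have Nwn : N n.+1 (w n) by apply: N_succ; exact: w_mem.
have Ne := e_N n; have Nsz : N n.+1 (star z) by exact: mem_star.
have Nswn : N n.+1 (star (w n)) by exact: mem_star.
have Ng1 : N n.+1 g by do 2 apply: N_succ.
rewrite w_sandwich//.
have Ne1 := e1_N n.
pose u := e n.+1 * d * w n * z.
have Nu : N n.+1 u by do 3 (apply: memM => //).
have uu : star u * u = (T m g)%:C *: (star z * (star (w n) * e n.+1 * w n) * z)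
    - kp%:C *: (star z * (star (w n) * (g * e n.+1) * w n) * z).
  have -> : (T m g)%:C *: (star z * (star (w n) * e n.+1 * w n) * z)
      - kp%:C *: (star z * (star (w n) * (g * e n.+1) * w n) * z) =
    star z * (star (w n) * (((T m g)%:C%:A - kp%:C *: g) * e n.+1) * w n) * z.
    by ncring.
  rewrite dE /u (starM _ z) (starM _ (w n)) (starM _ d) sd se.
  have -> : star z * (star (w n) * (d * e n.+1)) * (e n.+1 * d * w n * z) =
    star z * (star (w n) * (d * ((e n.+1 * e n.+1) * d)) * w n) * z by ncring.
  by rewrite ee ed (mulrA d d).
have N1 : N n.+1 (star z * (star (w n) * (g * e n.+1) * w n) * z).
  by do 5 (apply: memM => //).
have N2 : N n.+1 (star z * e 1%N * z) by do 2 (apply: memM => //).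
have := rtau_ge0 XN Nu; rewrite uu w_corner.
have -> : (T m g)%:C *: (star z * ((t ^+ n)%:C *: e 1%N) * z) =
    (T m g * t ^+ n)%:C *: (star z * e 1%N * z) by ncring.
rewrite (rtauB XN) ?(rtauZ XN)//; [|exact: memZ..].
by rewrite subr_ge0 -[X in _ <= X -> _]mulrA; exact.
Qed.

(** Expand the trace of [star (a - s b) * (a - s b)] with [a = p * r] and [b = k x w (star y) r].
    The cross term is [mu] times the trace of [r]: [p] disappears into [x], and [EA] turns [k x w]
    into [y]. *)
Lemma eigenvalue_bound x y p r (mu s : R) : N n x -> K n.+1 y -> y = F x ->
    N n p -> projection p -> p * x = x -> K n.+1 r -> projection r ->
    y * star y * r = mu%:C *: r ->
  2 * s * (mu * T n.+1 r) <= T n.+1 (r * p * r) + s ^+ 2 * (k ^+ 2 *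
    T n.+1 (star (star y * r) * (star (w n.+1) * (star x * x) * w n.+1) * (star y * r))).
Proof.
move=> Nx Ky yE Np [sp pp] px Kr [sr rr] yr; have XN := phi_extremal n.+1.
have Nx1 := N_succ Nx; have Np1 := N_succ Np; have Ny := K_sub Ky; have Nr := K_sub Kr.
have Ksy : K n.+1 (star y) by exact: mem_star.
have Nsy := K_sub Ksy; have Kz : K n.+1 (star y * r) by exact: memM.
have Nz := K_sub Kz; set z := star y * r in Kz Nz *.
have Nxw : N n.+1 (x * w n.+1) by exact: memM.
pose a := p * r; pose b := k%:C *: (x * w n.+1 * z).
have Na : N n.+1 a by exact: memM.
have Nb : N n.+1 b by apply: memZ => //; exact: memM.
have Nsa : N n.+1 (star a) by exact: mem_star.
have Nsb : N n.+1 (star b) by exact: mem_star.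
have aa : star a * a = r * p * r.
  by rewrite /a starM sp sr !mulrA -(mulrA r p p) pp.
have bb : star b * b = (k ^+ 2)%:C *:
    (star z * (star (w n.+1) * (star x * x) * w n.+1) * z).
  by rewrite /b starZr (starM _ z) (starM x); ncring.
have ab : T n.+1 (star a * b) = mu * T n.+1 r.
  have -> : star a * b = k%:C *: (r * (x * w n.+1) * z).
    rewrite /a /b starM sp sr -[in RHS]px; ncring.
  have Nrxz : N n.+1 (r * (x * w n.+1) * z) by do 2 (apply: memM => //).
  rewrite (rtauZ XN)// -T_EA// EAr//; last exact: memM.
  rewrite EAl// -(rtauZ XN); last first.
    by apply: memM => //; apply: memM => //; apply: K_sub; exact: EA_mem.
  have -> : k%:C *: (r * EA (x * w n.+1) * z) = r * (y * star y * r).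
    by rewrite yE FE /z yE FE; ncring.
  by rewrite yr -scalerAr rr (rtauZ XN).
have ba : T n.+1 (star b * a) = mu * T n.+1 r.
  by rewrite -ab -(rtau_star XN (memM (NS _) Nsa Nb)) starM starK.
have Nab : N n.+1 (a - s%:C *: b) by apply: memB => //; exact: memZ.
have := rtau_ge0 XN Nab.
have -> : star (a - s%:C *: b) * (a - s%:C *: b) = (star a * a
    - s%:C *: (star a * b)) + ((s ^+ 2)%:C *: (star b * b) - s%:C *: (star b * a)).
  by rewrite starB starZr; ncring.
have Naa : N n.+1 (star a * a) by exact: memM.
have Nsab : N n.+1 (star a * b) by exact: memM.
have Nsbb : N n.+1 (star b * b) by exact: memM.
have Nsba : N n.+1 (star b * a) by exact: memM.
have N1 : N n.+1 (s%:C *: (star a * b)) by exact: memZ.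
have N2 : N n.+1 (s%:C *: (star b * a)) by exact: memZ.
have N3 : N n.+1 ((s ^+ 2)%:C *: (star b * b)) by exact: memZ.
rewrite (rtauD XN (memB (NS _) Naa N1) (memB (NS _) N3 N2)) !(rtauB XN)//.
rewrite !(rtauZ XN)// ab ba aa bb (rtauZ XN); last first.
  have [sNx sNw] : N n.+1 (star x) /\ N n.+1 (star z) by split; exact: mem_star.
  by do 5 (apply: memM => //).
lra.
Qed.

Lemma uncertainty x y p r : N n x -> K n.+1 y -> y = F x -> x = Finv y ->
    x != 0 -> N n p -> projection p -> p * x = x ->
    K n.+1 r -> projection r -> r * y = y ->
  kp * km / ind <= T n p * T n.+1 r.
Proof.
move=> Nx Ky yE xE xn0 Np pp px Kr pr ry; have XN := phi_extremal n.+1.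
have Xp : 0 < T n (star x * x) by exact: rtau_gt0 (phi_extremal n) _ Nx xn0.
set X := T n (star x * x) in Xp.
have P0 : 0 <= T n p by exact: rtau_proj_ge0 (phi_extremal n) _ Np pp.
have Q0 : 0 <= T n.+1 r by exact: rtau_proj_ge0 XN _ (K_sub Kr) pr.
have kp0 : 0 <= kp by exact: (min_rtau_ge0 (phi_extremal m) (NS m) (@subset_refl _ (N m))).
have km0 : 0 <= km by exact: (min_rtau_ge0 (phi_extremal n) (KS n) (@K_sub n)).
have Ksy : K n.+1 (star y) by exact: mem_star.
have Ny := K_sub Ky; have Nsy := K_sub Ksy.
have Kyy : K n.+1 (y * star y) by exact: memM.
have syy : sa (y * star y) by rewrite /sa starM starK.
have [kk' [a [f S]]] := sub_spectral XN (KS _) (@K_sub n.+1) Kyy syy.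
have [fP fn0 _ f1 hE] := S.
have Kf i : K n.+1 (f i) by have [] := fP i.
have pf i : projection (f i) by have [] := fP i.
have Nf i := K_sub (Kf i); have [sr rr] := pr; have Nr := K_sub Kr.
have eig i : kp * km * a i <= ind * T n p * X.
  have [ai|ai] := leP (a i) 0.
    apply: (@le_trans _ _ 0); first by rewrite mulr_ge0_le0// mulr_ge0.
    by rewrite !mulr_ge0// ltW.
  (* The parameter [s] below would degenerate for [kp = 0], where the claim is trivial. *)
  have [->|kpn0] := eqVneq kp 0; first by rewrite !mul0r !mulr_ge0// ltW.
  have kpp : 0 < kp by rewrite lt_def kpn0.
  have tf : 0 < T n.+1 (f i) by exact: rtau_proj_gt0 XN _ (Nf i) (pf i) (fn0 i).
  have Nz : N n.+1 (star y * f i) by exact: memM.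
  have := eigenvalue_bound (kp / (ind * X)) Nx Ky yE Np pp px (Kf i) (pf i)
    (spectral_mul i S).
  have := EA_bound Np pp (Kf i) (pf i).
  have := word_bound Nx Nz; rewrite -/X.
  have -> : T n.+1 (star (star y * f i) * e 1%N * (star y * f i)) = t * (a i * T n.+1 (f i)).
    have [sf ff] := pf i.
    have -> : star (star y * f i) * e 1%N * (star y * f i) =
      (f i * y) * e 1%N * (star y * f i) by rewrite starM sf starK.
    have Kfy : K n.+1 (f i * y) by exact: memM.
    have Kyf : K n.+1 (star y * f i) by exact: memM.
    have Ne1 := e1_N n.
    rewrite -T_EA; last by do 2 (apply: memM => //; try exact: K_sub).
    rewrite EAr ?EAl ?EA_e1//; last by apply: memM => //; exact: K_sub.
    have -> : f i * y * t%:C%:A * (star y * f i) = t%:C *: (f i * (y * star y * f i)).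
      by ncring.
    by rewrite (spectral_mul i S) -scalerAr ff scalerA -rmorphM (rtauZ XN)// mulrA.
  set W := T n.+1 (_ * _ * _); set V := T n.+1 (f i * p * f i).
  set G := T n.+1 (f i) in tf *; set P := T n p in P0 *.
  have W0 : k ^+ 2 = ind ^+ n.+2 by rewrite expr2.
  move=> h1 h2 h3.
  have h1' : kp * (k ^+ 2 * W) <= ind * X * (a i * G).
    rewrite W0 mulrCA.
    have -> : ind * X * (a i * G) = ind ^+ n.+2 * (X * (t ^+ n * (t * (a i * G)))).
      have -> : ind ^+ n.+2 * (X * (t ^+ n * (t * (a i * G)))) =
        (ind ^+ n.+1 * t ^+ n.+1) * (ind * X * (a i * G)) by rewrite !exprS; ring.
      by rewrite -exprMn indV expr1n mul1r.
    by apply: ler_wpM2l => //; apply: exprn_ge0; exact: ltW.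
  (* With this [s], [h1'] bounds the quadratic term by [s * (a i * G)], half of the left side of
     [h3]; the other half is at most [V]. *)
  pose s := kp / (ind * X).
  have iX : 0 < ind * X by exact: mulr_gt0.
  have s0 : 0 < s by rewrite /s divr_gt0.
  have sE : s * (ind * X) = kp by rewrite /s divfK// gt_eqF.
  rewrite -/s in h3; clearbody s W V G P X.
  move: (k ^+ 2 * W) h1' h3 => U h1' h3.
  have aF : 0 < a i * G by exact: mulr_gt0.
  have h4 : s ^+ 2 * U <= s * (a i * G).
    rewrite expr2 -mulrA ler_pM2l//.
    rewrite -sE in h1'.
    by rewrite -(ler_pM2r iX); move: h1'; rewrite mulrAC [_ * (ind * X)]mulrC; lra.
  have h5 : s * (a i * G) <= V by lra.
  have h6 : km * (s * (a i * G)) <= P * G.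
    by apply: le_trans h2; exact: ler_wpM2l.
  have h7 : km * s * a i <= P.
    by rewrite -(ler_pM2r tf); lra.
  have := ler_wpM2r (ltW iX) h7; rewrite -sE; lra.
(* Inserting [r] around [y * star y] makes the weights of the eigenvalues add up to the trace of [r]
   instead of 1. *)
have TX : X = \sum_i a i * T n.+1 (star (f i * r) * (f i * r)).
  rewrite /X -(plancherel Nx Ky yE xE).
  have -> : y * star y = r * (y * star y) * r.
    by rewrite -{1 2}ry starM sr; ncring.
  rewrite hE mulr_sumr mulr_suml (rtau_sum XN) => [|i]; last first.
    by do 2 (apply: memM => //); exact: memZ.
  apply: eq_bigr => i _; have [sf ff] := pf i.
  have -> : r * ((a i)%:C *: f i) * r = (a i)%:C *: (star (f i * r) * (f i * r)).
    by rewrite starM sf sr -{1}ff; ncring.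
  rewrite (rtauZ XN)//; apply: memM; [exact: NS| |exact: memM].
  by apply: mem_star => //; exact: memM.
have TQ : T n.+1 r = \sum_i T n.+1 (star (f i * r) * (f i * r)).
  rewrite -(rtau_sum XN) => [|i]; last first.
    by apply: memM; [exact: NS|apply: mem_star => //; exact: memM|exact: memM].
  congr (rtau _ _); rewrite -[LHS]rr -{1}(mulr1 r) -f1 mulr_sumr mulr_suml.
  apply: eq_bigr => i _; have [sf ff] := pf i.
  by rewrite starM sf sr -{1}ff !mulrA.
have h : kp * km * X <= ind * T n p * X * T n.+1 r.
  rewrite {1}TX TQ !mulr_sumr; apply: ler_sum => i _.
  rewrite mulrA; apply: ler_wpM2r; last exact: eig.
  by apply: (rtau_ge0 XN); exact: memM.
rewrite ler_pdivrMr// -(ler_pM2r Xp); move: h; lra.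
Qed.
End Tower.

Theorem theorem4p9 (R : realType) (M : cstarAlgType R)
    (B : set M) (A : nat -> set M) (E : nat -> M -> M) (e : nat -> M)
    (ind : R)
    (subB : cstar_subalgebra B) (subA : cstar_subalgebra (A 0%N))
    (BA : B `<=` A 0%N)
    (simpleB : simple B) (simpleA : simple (A 0%N))
    (minE0 : minimal_cond_exp B (A 0%N) (E 0%N) ind)
    (tower : jones_tower B A E e ind)
    (n : nat) (n_ge1 : (1 <= n)%N)
    (EA : M -> M) (trEA : tr_preserving_cond_exp B A E n.+1 EA) :
  (forall x : M, commutant B (A n) x -> x != 0 ->
     support_size (commutant B (A n)) E n x *
     support_size (commutant (A 0%N) (A n.+1)) E n.+1 (fourier e ind EA n x)
     >= kappa B A E n.-1 ^+ 2 / ind) /\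
  (forall w : M, commutant (A 0%N) (A n.+1) w -> w != 0 ->
     support_size (commutant (A 0%N) (A n.+1)) E n.+1 w *
     support_size (commutant B (A n)) E n (inv_fourier E e ind n w)
     >= kappa B A E n.-1 ^+ 2 / ind).
Proof.
case: n n_ge1 trEA => // m _ trEA.
have [[_ _ [q [l [qb _ qe]]]] _] :=
  tower_extremal subB BA simpleB simpleA minE0 tower 0.
have X n := phi_extremal subB BA simpleB simpleA minE0 tower n.
have NS n : star_subalg (commutant B (A n)).
  by have [H _ _] := X n; exact: (commutant_star_subalg H).
have KN n := @K_sub _ _ _ _ BA n.
have KS n : star_subalg (commutant (A 0%N) (A n)).
  apply: commutant_subalg => [c|]; last by apply: cstar_star_subalg; case: tower.
  by apply: mem_star; exact: cstar_star_subalg.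
have kappaE : kappa B A E m ^+ 2 =
    min_rtau (comp_exp E m) (commutant B (A m)) *
    min_rtau (comp_exp E m.+1) (commutant (A 0%N) (A m.+1)).
  apply: sqr_sqrtr; apply: mulr_ge0.
    exact: (min_rtau_ge0 (X m) (NS m) (@subset_refl _ _)).
  exact: (min_rtau_ge0 (X m.+1) (KS m.+1) (KN m.+1)).
(* Stated for a pair exchanged by the transform and its inverse, the estimate covers both parts at
   once. *)
have main x y : commutant B (A m.+1) x -> commutant (A 0%N) (A m.+2) y ->
    y = fourier e ind EA m.+1 x -> x = inv_fourier E e ind m.+1 y -> x != 0 ->
    kappa B A E m ^+ 2 / ind <=
    support_size (commutant B (A m.+1)) E m.+1 x *
    support_size (commutant (A 0%N) (A m.+2)) E m.+2 y.
  move=> Nx Ky yE xE xn0; rewrite kappaE.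
  have [Np pp px _] := range_projP (X m.+1) (NS _) (@subset_refl _ _) Nx.
  have [Kr pr ry _] := range_projP (X m.+2) (KS _) (KN _) Ky.
  exact: (uncertainty subB BA simpleB simpleA minE0 tower qb qe trEA Nx Ky yE xE
    xn0 Np pp px Kr pr ry).
split=> [x Nx xn0|y Ky yn0].
  have Ky := fourier_mem subB BA simpleB simpleA minE0 tower trEA Nx.
  apply: main => //.
  by rewrite (inv_fourierK subB BA simpleB simpleA minE0 tower qb qe trEA Nx).
have Nx := inv_fourier_mem subB BA simpleB simpleA minE0 tower Ky.
have yE := fourierK subB BA simpleB simpleA minE0 tower qb qe trEA Ky.
rewrite [X in _ <= X]mulrC; apply: main => //.
apply: contra_neq yn0 => x0; rewrite -yE x0 /fourier mul0r.
have EA0 : EA 0 = 0 by case: trEA => [[_ _ EAid _ _] _]; apply: EAid; exact: mem0.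
by rewrite EA0 scaler0.
Qed.
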